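(* Let $\mathcal{H}=H^{-1}(\mathbb{T})\oplus H^{-1}(\mathbb{T})$. For each $n\in\mathbb{N}$ let $\mathbb{I}_n$ be a standard probability space, $w^{(n)}\in L^\infty(\mathbb{I}_n\times\mathbb{I}_n)$ and $X^{(n)}:\mathbb{I}_n\to\mathbb{T}$ measurable. Assume that there is a constant $w_{\max}<\infty$ with $\|w^{(n)}\|_{L^\infty(\mathbb{I}_n\times\mathbb{I}_n)}\le w_{\max}$ for all $n$. Then the following are equivalent (for any $1<p\le\infty$ and $1\le q<\infty$ in (2) and (4)): (1) $\displaystyle\lim_{n\to\infty}\sup_{n_1,n_2\ge n}\gamma_{\square;\mathcal{H}}(\boldsymbol{w}_{w^{(n_1)},X^{(n_1)}},\boldsymbol{w}_{w^{(n_2)},X^{(n_2)}})=0$; (2) $\displaystyle\lim_{n\to\infty}\sup_{n_1,n_2\ge n}\gamma_{p,q;\mathcal{H}}(\boldsymbol{w}_{w^{(n_1)},X^{(n_1)}},\boldsymbol{w}_{w^{(n_2)},X^{(n_2)}})=0$; (3) $\displaystyle\lim_{n\to\infty}\sup_{n_1,n_2\ge n}d_{\square,W_1}\big[(w^{(n_1)},X^{(n_1)}),(w^{(n_2)},X^{(n_2)})\big]=0$; (4) $\displaystyle\lim_{n\to\infty}\sup_{n_1,n_2\ge n}d_{L^p\to L^q,W_1}\big[(w^{(n_1)},X^{(n_1)}),(w^{(n_2)},X^{(n_2)})\big]=0$.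
   Context: $\mathbb{T}=\mathbb{R}/\mathbb{Z}$; $\hat f(m)=\int_{\mathbb{T}}f(x)e^{-2\pi imx}\,\mathrm{d}x$ and $\|f\|_{H^{-1}(\mathbb{T})}^2=\sum_{m\in\mathbb{Z}}(1+4\pi^2m^2)^{-1}|\hat f(m)|^2$; finite measures on $\mathbb{T}$ belong to $H^{-1}(\mathbb{T})$. The kernel associated to $(w,X)$ is $\boldsymbol{w}_{w,X}(\xi,\zeta)=(\delta_{X(\zeta)},\,w(\xi,\zeta)\delta_{X(\zeta)})\in H^{-1}(\mathbb{T})\oplus H^{-1}(\mathbb{T})$, $(\xi,\zeta)\in\mathbb{I}\times\mathbb{I}$. Norms of $\boldsymbol{u}\in L^\infty(\mathbb{I}_1\times\mathbb{I}_2;\mathcal{H})$: $\|\boldsymbol{u}\|_{\square;\mathcal{H}}=\sup\langle\boldsymbol{e},\int_{S\times T}\boldsymbol{u}\,\mathrm{d}\xi\,\mathrm{d}\zeta\rangle_{\mathcal{H}}$ over $\|\boldsymbol{e}\|_{\mathcal{H}}\le1$ and measurable $S\subset\mathbb{I}_1,T\subset\mathbb{I}_2$; $\|\boldsymbol{u}\|_{p,q;\mathcal{H}}=\sup\langle\boldsymbol{e},\int_{\mathbb{I}_1\times\mathbb{I}_2}f(\xi)\boldsymbol{u}(\xi,\zeta)g(\zeta)\,\mathrm{d}\xi\,\mathrm{d}\zeta\rangle_{\mathcal{H}}$ over $\|\boldsymbol{e}\|_{\mathcal{H}}\le1$ and $f\in L^{q'}(\mathbb{I}_1)$, $g\in L^p(\mathbb{I}_2)$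 in the unit balls, with $q'=q/(q-1)$. When $\mathcal{H}=\mathbb{R}$ these are written $\|\cdot\|_\square$ (cut norm) and $\|\cdot\|_{L^p\to L^q}$ (operator norm of the adjacency operator). Couplings: $\Pi(\mathbb{I}_1,\mathbb{I}_2)$ is the set of probability measures on $\mathbb{I}_1\times\mathbb{I}_2$ with the given marginals $P_1,P_2$. For $\gamma=P_1(\mathrm{d}\xi)\gamma^\xi(\mathrm{d}\zeta)=\gamma_\zeta(\mathrm{d}\xi)P_2(\mathrm{d}\zeta)$ and (scalar- or $\mathcal{H}$-valued) kernels $\boldsymbol{w}_k$ on $\mathbb{I}_k\times\mathbb{I}_k$: $(\boldsymbol{w}_1\gamma)(\xi,\zeta)=\int\boldsymbol{w}_1(\xi,\iota)\gamma_\zeta(\mathrm{d}\iota)$, $(\gamma\boldsymbol{w}_2)(\xi,\zeta)=\int\boldsymbol{w}_2(\iota,\zeta)\gamma^\xi(\mathrm{d}\iota)$, $(\gamma^T\boldsymbol{w}_1)(\zeta,\xi)=\int\boldsymbol{w}_1(\iota,\xi)\gamma_\zeta(\mathrm{d}\iota)$, $(\boldsymbol{w}_2\gamma^T)(\zeta,\xi)=\int\boldsymbol{w}_2(\zeta,\iota)\gamma^\xi(\mathrm{d}\iota)$. Coupling distances: $\gamma_{\ast;\mathcal{H}}(\boldsymbol{w}_1,\boldsymbol{w}_2)=\inf_{\gamma\in\Pi(\mathbb{I}_1,\mathbb{I}_2)}\big(\|\boldsymbol{w}_1\gamma-\gamma\boldsymbol{w}_2\|_{\ast;\mathcal{H}}+\|\gamma^T\boldsymbol{w}_1-\boldsymbol{w}_2\gamma^T\|_{\ast;\mathcal{H}}\big)$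 for $\ast=\square$ or $\ast=(p,q)$. Bi-coupling distances: $$d_{\ast,W_1}[(w^{(1)},X^{(1)}),(w^{(2)},X^{(2)})]=\inf_{\gamma\in\Pi(\mathbb{I}_1,\mathbb{I}_2)}\Big[\int|X^{(1)}(\xi_1)-X^{(2)}(\xi_2)|\,\gamma(\mathrm{d}\xi_1,\mathrm{d}\xi_2)+\|w^{(1)}\gamma-\gamma w^{(2)}\|_\ast+\|\gamma^Tw^{(1)}-w^{(2)}\gamma^T\|_\ast\Big]$$ for $\ast=\square$ or $\ast=L^p\to L^q$, with $|x-y|$ the torus distance. *)

(* Defs.v *)
From HB Require Import structures.
From mathcomp Require Import all_boot all_order all_algebra.
From mathcomp Require Import complex.
From mathcomp Require Import all_classical all_reals all_analysis.
From mathcomp Require Import measurable_realfun.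
From mathcomp Require Import ring lra.

Set Implicit Arguments.
Unset Strict Implicit.
Unset Printing Implicit Defensive.
Import Order.TTheory GRing.Theory Num.Theory.
Import numFieldNormedType.Exports.

Local Open Scope classical_set_scope.
Local Open Scope ring_scope.

Local Open Scope quotient_scope.
Local Open Scope complex_scope.

Section torus.
Context (R : realType).

Definition int_pred : {pred R} := fun x => x \is a Num.int.

Fact int_pred_zmod_closed : zmod_closed int_pred.
Proof.
by split=> [|x y]; rewrite !unfold_in => *; [exact: rpred0|exact: rpredB].
Qed.

HB.instance Definition _ := GRing.isZmodClosed.Build R int_pred int_pred_zmod_closed.

Definition torus : Type := {ideal_quot int_pred}.
HB.instance Definition _ := GRing.Zmodule.on torus.
HB.instance Definition _ := EqQuotient.on torus.
HB.instance Definition _ := isPointed.Build torus 0.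

(* Quotient sigma-algebra: it coincides with the Borel sets of R/Z. *)
Definition torus_measurable : set (set torus) :=
  [set A | measurable (\pi_torus @^-1` A : set R)].

Let torus_measurable0 : torus_measurable set0.
Proof. by rewrite /torus_measurable/= preimage_set0. Qed.

Let torus_measurableC A : torus_measurable A -> torus_measurable (~` A).
Proof. by rewrite /torus_measurable/= preimage_setC; exact: measurableC. Qed.

Let torus_measurableU (F : (set torus)^nat) :
  (forall i, torus_measurable (F i)) -> torus_measurable (\bigcup_i F i).
Proof.
move=> mF; rewrite /torus_measurable/= preimage_bigcup.
by apply: bigcupT_measurable => i; exact: mF.
Qed.

HB.instance Definition _ := @isMeasurable.Build default_measure_display torus
  torus_measurable torus_measurable0 torus_measurableC torus_measurableU.

Definition torus_dist (x y : torus) : R :=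
  inf [set `|r| | r in [set r : R | \pi_torus r = x - y]].

(* e^{2 i pi m x}; torus_charE shows independence of the representative. *)
Definition torus_char (m : int) (x : torus) : R[i] :=
  let t := 2 * pi * m%:~R * repr x in cos t +i* sin t.

Lemma torus_charE m (r : R) :
  torus_char m (\pi_torus r) =
  cos (2 * pi * m%:~R * r) +i* sin (2 * pi * m%:~R * r).
Proof.
suff [k rk] : exists k : int, repr (\pi_torus r) = r + k%:~R.
  have E : 2 * pi * m%:~R * (r + k%:~R) =
      2 * pi * m%:~R * r + (pi *+ 2) *~ (m * k) :> R.
    by rewrite mulrDr -(mulrzr (pi *+ 2)) intrM -[X in X * (_ * _)]mulr_natl mulrA.

  have cosz (a : R) (n : int) : cos (a + (pi *+ 2) *~ n) = cos a.
    case: n => n; first exact: (periodicn (@cosD2pi R)).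
    have := periodicn (@cosD2pi R) n.+1 (a + (pi *+ 2) *~ Negz n).
    by rewrite NegzE mulrNz subrK.
  have sinz (a : R) (n : int) : sin (a + (pi *+ 2) *~ n) = sin a.
    case: n => n; first exact: (periodicn (@sinD2pi R)).
    have := periodicn (@sinD2pi R) n.+1 (a + (pi *+ 2) *~ Negz n).
    by rewrite NegzE mulrNz subrK.
  by rewrite /torus_char/= rk E cosz sinz.
have : repr (\pi_torus r) = r %[mod torus] by rewrite reprK.
move=> /eqmodP; rewrite /= /Quotient.equiv unfold_in => /intrP[k kE].
by exists k; rewrite -kE addrC subrK.
Qed.

Lemma measurable_Re_torus_char m :
  measurable_fun setT (fun x => complex.Re (torus_char m x)).
Proof.
move=> _ Y mY; rewrite setTI.
have mc : measurable_fun setT (fun r : R => cos (2 * pi * m%:~R * r)).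
  apply: continuous_measurable_fun => r.
  by apply: continuous_comp; [exact: mulrl_continuous|exact: continuous_cos].
have := mc measurableT _ mY; rewrite setTI.
suff -> : (fun r : R => cos (2 * pi * m%:~R * r)) =
    (fun x => complex.Re (torus_char m x)) \o \pi_torus by [].
by apply/funext => r; rewrite /comp torus_charE.
Qed.

Lemma measurable_Im_torus_char m :
  measurable_fun setT (fun x => complex.Im (torus_char m x)).
Proof.
move=> _ Y mY; rewrite setTI.
have mc : measurable_fun setT (fun r : R => sin (2 * pi * m%:~R * r)).
  apply: continuous_measurable_fun => r.
  by apply: continuous_comp; [exact: mulrl_continuous|exact: continuous_sin].
have := mc measurableT _ mY; rewrite setTI.
suff -> : (fun r : R => sin (2 * pi * m%:~R * r)) =
    (fun x => complex.Im (torus_char m x)) \o \pi_torus by [].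
by apply/funext => r; rewrite /comp torus_charE.
Qed.

Definition fourier_coef (mu : {measure set torus -> \bar R}) (m : int) : R[i] :=
  \int[mu]_x (complex.Re (torus_char (- m) x)) +i*
  \int[mu]_x (complex.Im (torus_char (- m) x)).

Definition hm1_weight (m : int) : R := (1 + 4 * pi ^+ 2 * m%:~R ^+ 2)^-1.


(* A distribution on the torus is given by its Fourier coefficients. H^{-1} is
   thus the weighted l^2 space of coefficient families; the symmetry condition
   selects the real distributions, and makes H^{-1} a Hilbert space over R. *)
Definition hm1_pred : {pred int -> Rcomplex R} := fun a =>
  `[< (forall m, a (- m) = (a m)^*) /\
      (\esum_(m in [set: int]) (hm1_weight m * `|a m| ^+ 2)%:E < +oo)%E >].

Lemma hm1_weight_gt0 m : 0 < hm1_weight m.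
Proof.
rewrite /hm1_weight invr_gt0 ltr_pwDl// mulr_ge0 ?sqr_ge0//.
by rewrite mulr_ge0 ?sqr_ge0.
Qed.

Lemma esum_scale_lty (f : int -> R) (c : R) : (forall m, 0 <= f m) -> 0 <= c ->
  (\esum_(m in [set: int]) (f m)%:E < +oo)%E ->
  (\esum_(m in [set: int]) (c * f m)%:E < +oo)%E.
Proof.
move=> f0 c0 fy; apply: (@le_lt_trans _ _
    (c%:E * \esum_(m in [set: int]) (f m)%:E)%E); last exact: lte_mul_pinfty.
apply: ge_ereal_sup => _ [X [finX _] <-].
under eq_fsbigr do rewrite EFinM.
rewrite -ge0_mule_fsumr; last by move=> m; rewrite lee_fin.
by rewrite lee_wpmul2l ?lee_fin//; apply: esum_ge; exists X.
Qed.

Fact hm1_submod_closed : submod_closed hm1_pred.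
Proof.
split=> [|c u v /asboolP[uh us] /asboolP[vh vs]]; apply/asboolP; split.
- by move=> m; apply/eqP; rewrite eq_complex /= oppr0 !eqxx.
- rewrite esum1// => m _; rewrite (_ : (0 : int -> Rcomplex R) m = 0)//.
  by rewrite normr0 expr0n mulr0.
- move=> m; rewrite /GRing.add/= /GRing.scale/= uh vh.
  by case: (u m) (v m) => [a b] [a1 b1] /=; congr (_ +i* _); ring.
- have w0 (u' : int -> Rcomplex R) m : 0 <= hm1_weight m * `|u' m| ^+ 2.
    by rewrite mulr_ge0 ?sqr_ge0// ltW// hm1_weight_gt0.
  apply: (@le_lt_trans _ _ (\esum_(m in [set: int])
      ((2 * c ^+ 2) * (hm1_weight m * `|u m| ^+ 2))%:E +
      \esum_(m in [set: int]) (2 * (hm1_weight m * `|v m| ^+ 2))%:E)%E).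
    rewrite -esumD; last 2 first.
    + by move=> m _; rewrite lee_fin mulr_ge0// mulr_ge0// sqr_ge0.
    + by move=> m _; rewrite lee_fin mulr_ge0.
    apply: le_esum => m _; rewrite -EFinD lee_fin.
    have -> : (c *: u + v) m = c *: (u m) + v m by [].
    have := ler_normD (c *: u m) (v m).
    have -> : `|c *: u m| = `|c| * `|u m|.
      case: (u m) => a b; rewrite /Num.norm/=.
      by rewrite !exprMn -mulrDr sqrtrM ?sqr_ge0// sqrtr_sqr.
    move=> h1; have {h1} : `|c *: u m + v m| ^+ 2 <= (`|c| * `|u m| + `|v m|) ^+ 2.
      by apply: lerXn2r; rewrite // nnegrE// addr_ge0// mulr_ge0.
    move=> h; have cc : `|c| ^+ 2 = c ^+ 2 by rewrite real_normK// num_real.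
    have := hm1_weight_gt0 m; move: (hm1_weight m) h => W h W0.
    rewrite -cc.
    apply: (@le_trans _ _ (W * (`|c| * `|u m| + `|v m|) ^+ 2)).
      by rewrite ler_wpM2l// ltW.
    have := mulr_ge0 (ltW W0) (sqr_ge0 (`|c| * `|u m| - `|v m|)).
    lra.
  rewrite lte_add_pinfty//; apply: esum_scale_lty => //.
  by rewrite mulr_ge0// sqr_ge0.
Qed.

HB.instance Definition _ :=
  GRing.isSubmodClosed.Build R _ hm1_pred hm1_submod_closed.

Record hm1 : Type := HM1 { hm1_coef :> int -> Rcomplex R ;
                           hm1P : hm1_coef \in hm1_pred }.

HB.instance Definition _ := [isSub for hm1_coef].
HB.instance Definition _ := [Choice of hm1 by <:].
HB.instance Definition _ := [SubChoice_isSubLmodule of hm1 by <:].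

Lemma hm1_weight_sum :
  (\esum_(m in [set: int]) (hm1_weight m)%:E < +oo)%E.
Proof.
pose b n : R := 4 * (n.+1%:R^-1 - n.+2%:R^-1).
have b0 n : 0 <= b n.
  by rewrite mulr_ge0// subr_ge0 lef_pV2 ?posrE// ler_nat.
have key n (x : R) : n%:R ^+ 2 <= x ^+ 2 -> (1 + 4 * pi ^+ 2 * x ^+ 2)^-1 <= b n.
  move=> nx; have p2 : 1 <= 4 * pi ^+ 2 :> R.
    have := @pi_ge2 R; nra.
  have n0 : 0 <= n%:R :> R by [].
  rewrite /b -[n.+2%:R]natr1 -[n.+1%:R]natr1.
  have -> : 4 * ((n%:R + 1)^-1 - (n%:R + 1 + 1)^-1) =
            ((n%:R + 1) * (n%:R + 1 + 1) / 4)^-1 :> R by field; lra.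
  have h : n%:R ^+ 2 <= 4 * pi ^+ 2 * x ^+ 2 :> R.
    by rewrite (le_trans nx)// ler_peMl// sqr_ge0.
  move: (4 * pi ^+ 2 * x ^+ 2) h => y h; have h0 := sqr_ge0 (n%:R : R).
  rewrite lef_pV2 ?posrE; last 2 first.
  - lra.
  - by rewrite divr_gt0// mulr_gt0//; lra.
  have := sqr_ge0 (n%:R - 1 / 2 : R); rewrite ler_pdivrMr//; nra.
have bs : (\esum_(n in [set: nat]) (b n)%:E < +oo)%E.
  rewrite -nneseries_esumT; last by move=> n; rewrite lee_fin.
  apply: (@le_lt_trans _ _ 4%:E); last exact: ltry.
  apply: lime_le; first by apply: is_cvg_nneseries => n _ _; rewrite lee_fin.
  apply: nearW => n; rewrite sumEFin lee_fin /b -mulr_sumr.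
  under eq_bigr do rewrite -opprB.
  rewrite sumrN telescope_sumr// opprB invr1.
  by rewrite -[leRHS]mulr1 ler_wpM2l// gerBl.
rewrite (esumID [set m : int | 0 <= m]); last first.
  by move=> m _; rewrite lee_fin ltW// hm1_weight_gt0.
rewrite setTI setTI lte_add_pinfty//.
- rewrite (_ : [set m | _] = Posz @` setT); last first.
    apply/seteqP; split=> [[n|n]//= _|_ [n _ <-]//=]; first by exists n.
  rewrite esum_image; last by move=> ? ? _ _ [].
  apply: le_lt_trans bs; apply: le_esum => n _; rewrite lee_fin.
  exact: key.
- rewrite (_ : ~` [set m | _] = Negz @` setT); last first.
    apply/seteqP; split=> [[n|n]//= _|_ [n _ <-]//=]; first by exists n.
  rewrite esum_image; last by move=> ? ? _ _ [].
  apply: le_lt_trans bs; apply: le_esum => n _; rewrite lee_fin.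
  apply: key; rewrite NegzE rmorphN/= sqrrN ler_sqr ?nnegrE//.
  by rewrite ler_nat.
Qed.

Lemma finite_integrable_le1 (mu : {finite_measure set torus -> \bar R})
    (f : torus -> R) : measurable_fun setT f -> (forall x, `|f x| <= 1) ->
  mu.-integrable setT (EFin \o f).
Proof.
move=> mf f1; apply: measurable_bounded_integrable => //.
  by rewrite ltey_eq fin_num_measure.
exists 1; split; first exact: num_real.
by move=> y y1 x _; apply: le_trans (f1 x) _; exact: ltW.
Qed.

Lemma norm_Rintegral_le1 (mu : {finite_measure set torus -> \bar R})
    (f : torus -> R) : measurable_fun setT f -> (forall x, `|f x| <= 1) ->
  `|\int[mu]_x f x| <= fine (mu setT).
Proof.
move=> mf f1.
rewrite (le_trans (le_normr_Rintegral _ (finite_integrable_le1 mu mf f1)))//.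
rewrite -[leRHS]mul1r -(Rintegral_cst mu measurableT).
apply: le_Rintegral => //.
- apply: finite_integrable_le1 => [|x]; last by rewrite normr_id.
  exact: measurableT_comp.
- apply: finite_integrable_le1 => [|x]; first exact: measurable_cst.
  by rewrite /cst normr1.
Qed.

Lemma norm_Re_torus_char m x : `|complex.Re (torus_char m x)| <= 1.
Proof. by rewrite ler_norml cos_geN1 cos_le1. Qed.

Lemma norm_Im_torus_char m x : `|complex.Im (torus_char m x)| <= 1.
Proof. by rewrite ler_norml sin_geN1 sin_le1. Qed.

Lemma fourier_coef_hm1 (mu : {finite_measure set torus -> \bar R}) :
  fourier_coef mu \in hm1_pred.
Proof.
apply/asboolP; split.
- move=> m; rewrite /fourier_coef opprK /=; congr (_ +i* _).
  + apply: eq_Rintegral => x _; rewrite /torus_char/=.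
    by rewrite rmorphN/= mulrN mulNr cosN.
  + have -> : (fun x => complex.Im (torus_char m x)) =
              (fun x => -1 * complex.Im (torus_char (- m) x)).
      apply/funext => x; rewrite /torus_char/=.
      by rewrite mulN1r -sinN rmorphN/= mulrN mulNr opprK.
    rewrite RintegralZl ?mulN1r//; apply: finite_integrable_le1.
    * exact: measurable_Im_torus_char.
    * exact: norm_Im_torus_char.
- pose M := fine (mu setT).
  apply: (@le_lt_trans _ _
      (\esum_(m in [set: int]) ((2 * M ^+ 2) * hm1_weight m)%:E)%E).
    apply: le_esum => m _; rewrite lee_fin mulrC ler_wpM2r//.
      by rewrite ltW// hm1_weight_gt0.
    have sqM (a : R) : `|a| <= M -> a ^+ 2 <= M ^+ 2.
      by move=> aM; rewrite -(real_normK (num_real a)) lerXn2r// nnegrE fine_ge0.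
    have := sqM _ (norm_Rintegral_le1 mu (measurable_Re_torus_char (- m))
      (norm_Re_torus_char (- m))).
    have := sqM _ (norm_Rintegral_le1 mu (measurable_Im_torus_char (- m))
      (norm_Im_torus_char (- m))).
    rewrite -[fourier_coef mu m]/(_ +i* _) /Num.norm/= sqr_sqrtr ?addr_ge0 ?sqr_ge0//.
    move=> ? ?; lra.
  apply: esum_scale_lty; last exact: hm1_weight_sum.
  - by move=> m; rewrite ltW// hm1_weight_gt0.
  - by rewrite mulr_ge0// sqr_ge0.
Qed.

Definition hm1_of_measure (mu : {finite_measure set torus -> \bar R}) : hm1 :=
  HM1 (fourier_coef_hm1 mu).


(* Unconditional sum of a family indexed by int, as in esumB. *)
Definition int_sum (F : int -> R) : R :=
  fine (\esum_(m in [set: int]) (EFin \o F)^\+ m -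
        \esum_(m in [set: int]) (EFin \o F)^\- m)%E.

Definition hm1_ip (a b : hm1) : R :=
  int_sum (fun m => hm1_weight m * complex.Re (a m * (b m)^*)).

Lemma hm1_ipxx (a : hm1) : (hm1_ip a a)%:E =
  (\esum_(m in [set: int]) (hm1_weight m * `|a m| ^+ 2)%:E)%E.
Proof.
have E m : hm1_weight m * complex.Re (a m * (a m)^*) =
    hm1_weight m * `|a m| ^+ 2.
  congr (_ * _); case: (a m) => x y; rewrite /Num.norm/= sqr_sqrtr.
    by rewrite mulrN opprK !expr2.
  by rewrite addr_ge0// sqr_ge0.
have F0 m : (0 <= (hm1_weight m * `|a m| ^+ 2)%:E)%E.
  by rewrite lee_fin mulr_ge0 ?sqr_ge0// ltW// hm1_weight_gt0.
rewrite /hm1_ip /int_sum [X in (_ - X)%E]esum1; last first.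
  by move=> m _; rewrite funenegE /= E max_r// lee_fin oppr_le0 -lee_fin.
rewrite sube0 (_ : esum _ _ = \esum_(m in [set: int])
    (hm1_weight m * `|a m| ^+ 2)%:E)%E; last first.
  by apply: eq_esum => m _; rewrite funeposE /= E max_l.
have /asboolP[_ fin] := hm1P a.
by rewrite fineK// ge0_fin_numE// esum_ge0.
Qed.

Definition hm1x2_ip (x y : hm1 * hm1) : R := hm1_ip x.1 y.1 + hm1_ip x.2 y.2.

Definition scalar_ip (x y : R^o) : R := x * y.

Definition w_kernel d (T : measurableType d) (w : T * T -> R) (X : T -> torus)
    (z : T * T) : hm1 * hm1 :=
  let delta := hm1_of_measure (\d_(X z.2)) in (delta, w z *: delta).

End torus.

(* Isomorphic mod 0 to a Borel subset of the reals with a Borel probability. *)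
Definition standard_probability d (T : measurableType d) (R : realType)
    (P : probability T R) : Prop :=
  exists (f : {mfun T >-> R}) (T0 : set T),
    [/\ measurable T0, P T0 = 1%E, set_inj T0 f &
        forall A, measurable A -> A `<=` T0 -> measurable (f @` A)].

Section vector_integral.
Context (R : realType) (V : lmodType R) (ip : V -> V -> R).

Definition ip_norm (v : V) : R := Num.sqrt (ip v v).

(* Weak integral in the Hilbert space (V, ip), and 0 if u is not integrable. *)
Definition vintegral d (T : measurableType d) (mu : {measure set T -> \bar R})
    (D : set T) (u : T -> V) : V :=
  xget 0 [set v | forall e,
    mu.-integrable D (fun x => (ip e (u x))%:E) /\
    ip e v = \int[mu]_(x in D) ip e (u x)].

Section norms.
Context d1 d2 (T1 : measurableType d1) (T2 : measurableType d2).
Context (P1 : probability T1 R) (P2 : probability T2 R).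

Definition cut_norm (u : T1 * T2 -> V) : \bar R :=
  ereal_sup [set r | exists (e : V) (S : set T1) (T : set T2),
    [/\ ip_norm e <= 1, measurable S, measurable T &
        r = (ip e (vintegral (P1 \x P2)%E (S `*` T) u))%:E]].

Definition pq_norm (p q : \bar R) (u : T1 * T2 -> V) : \bar R :=
  ereal_sup [set r | exists (e : V) (f : {mfun T1 >-> R}) (g : {mfun T2 >-> R}),
    [/\ ip_norm e <= 1,
        ('N[P1]_(hoelder_conjugate q)[EFin \o f] <= 1)%E,
        ('N[P2]_p[EFin \o g] <= 1)%E &
        r = (ip e (vintegral (P1 \x P2)%E setT
                     (fun z => (f z.1 * g z.2) *: u z)))%:E]].

End norms.

Section couplings.
Context d1 d2 (T1 : measurableType d1) (T2 : measurableType d2).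
Context (P1 : probability T1 R) (P2 : probability T2 R).

Definition coupling (gamma : probability (T1 * T2)%type R) : Prop :=
  (forall A, measurable A -> gamma (A `*` setT) = P1 A) /\
  (forall B, measurable B -> gamma (setT `*` B) = P2 B).

(* gamma = P1(dx) kr_x(dy) = kl_y(dx) P2(dy) *)
Definition disintegration (gamma : probability (T1 * T2)%type R)
    (kr : R.-pker T1 ~> T2) (kl : R.-pker T2 ~> T1) : Prop :=
  forall C, measurable C ->
    gamma C = (\int[P1]_x kr x (xsection C x))%E /\
    gamma C = (\int[P2]_y kl y (ysection C y))%E.

Definition ker_coupling (u1 : T1 * T1 -> V) (kl : R.-pker T2 ~> T1) :
    T1 * T2 -> V :=
  fun z => vintegral (kl z.2) setT (fun i => u1 (z.1, i)).

Definition coupling_ker (kr : R.-pker T1 ~> T2) (u2 : T2 * T2 -> V) :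
    T1 * T2 -> V :=
  fun z => vintegral (kr z.1) setT (fun i => u2 (i, z.2)).

Definition couplingT_ker (kl : R.-pker T2 ~> T1) (u1 : T1 * T1 -> V) :
    T2 * T1 -> V :=
  fun z => vintegral (kl z.1) setT (fun i => u1 (i, z.2)).

Definition ker_couplingT (u2 : T2 * T2 -> V) (kr : R.-pker T1 ~> T2) :
    T2 * T1 -> V :=
  fun z => vintegral (kr z.2) setT (fun i => u2 (z.1, i)).

(* N12 and N21 are the norm * for kernels on T1 * T2 and on T2 * T1. *)
Definition coupling_gap (N12 : (T1 * T2 -> V) -> \bar R)
    (N21 : (T2 * T1 -> V) -> \bar R) (kr : R.-pker T1 ~> T2)
    (kl : R.-pker T2 ~> T1) (u1 : T1 * T1 -> V) (u2 : T2 * T2 -> V) : \bar R :=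
  (N12 (fun z => (ker_coupling u1 kl z - coupling_ker kr u2 z)%R) +
   N21 (fun z => (couplingT_ker kl u1 z - ker_couplingT u2 kr z)%R))%E.

(* A coupling comes with its two disintegrations, which are unique up to null
   sets, and which exist when P1 and P2 are standard. *)
Definition coupling_dist N12 N21 u1 u2 : \bar R :=
  ereal_inf [set r | exists gamma kr kl,
    [/\ coupling gamma, disintegration gamma kr kl &
        r = coupling_gap N12 N21 kr kl u1 u2]].

End couplings.

Definition gamma_cut d1 d2 (T1 : measurableType d1) (T2 : measurableType d2)
    (P1 : probability T1 R) (P2 : probability T2 R) u1 u2 : \bar R :=
  coupling_dist P1 P2 (cut_norm P1 P2) (cut_norm P2 P1) u1 u2.

Definition gamma_pq (p q : \bar R) d1 d2
    (T1 : measurableType d1) (T2 : measurableType d2)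
    (P1 : probability T1 R) (P2 : probability T2 R) u1 u2 : \bar R :=
  coupling_dist P1 P2 (pq_norm P1 P2 p q) (pq_norm P2 P1 p q) u1 u2.

End vector_integral.

Section bicoupling.
Context (R : realType).
Context d1 d2 (T1 : measurableType d1) (T2 : measurableType d2).
Context (P1 : probability T1 R) (P2 : probability T2 R).

Definition bicoupling_dist (N12 : (T1 * T2 -> R^o) -> \bar R)
    (N21 : (T2 * T1 -> R^o) -> \bar R)
    (w1 : T1 * T1 -> R) (X1 : T1 -> torus R)
    (w2 : T2 * T2 -> R) (X2 : T2 -> torus R) : \bar R :=
  ereal_inf [set r | exists gamma kr kl,
    [/\ coupling P1 P2 gamma, disintegration P1 P2 gamma kr kl &
        r = (\int[gamma]_z (torus_dist (X1 z.1) (X2 z.2))%:E +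
             coupling_gap (@scalar_ip R) N12 N21 kr kl w1 w2)%E]].

Definition d_cut_W1 w1 X1 w2 X2 : \bar R :=
  bicoupling_dist (cut_norm (@scalar_ip R) P1 P2)
    (cut_norm (@scalar_ip R) P2 P1) w1 X1 w2 X2.

Definition d_pq_W1 (p q : \bar R) w1 X1 w2 X2 : \bar R :=
  bicoupling_dist (pq_norm (@scalar_ip R) P1 P2 p q)
    (pq_norm (@scalar_ip R) P2 P1 p q) w1 X1 w2 X2.

End bicoupling.

Definition asymptotically_cauchy (R : realType) (D : nat -> nat -> \bar R) : Prop :=
  ereal_sup [set D n1 n2 | n1 in [set k | (n <= k)%N] & n2 in [set k | (n <= k)%N]]
    @[n --> \oo] --> 0%E.

(* Main.v *)
(* Each of the four distances is an infimum over the same triples: a coupling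
   and its two disintegrations. For a fixed triple, each of the four quantities
   is at most [eps + C r], where [r] is any other one and [C] depends only on
   [eps], [p], [q] and the bound on the weights; this is enough to transfer the
   Cauchy property.

   Cut norm versus (p,q)-norm, for bounded kernels: indicators are admissible
   test functions, and conversely test functions in the unit balls of [L^q'] and
   [L^p] (where [q' > 1] and [p > 1]) are truncated at a height that makes the
   remainder small in [L^1], and bounded functions are handled by splitting
   according to signs.

   Vector versus scalar kernels: the mode [0] of the second component of the
   vector gap is the scalar gap, and the modes [1] and [-1] of its first component
   give the average of [1 - cos (2 pi (X1 - X2))], which controls the average
   torus distance. Conversely [delta x - delta y] is at most
   [eps + C |x - y|] in [H^-1], so that the vector gap differs little from
   the scalar gap times [delta (X2)]. *)

Require Import Defs.
From HB Require Import structures.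
From mathcomp Require Import all_boot all_order all_algebra.
From mathcomp Require Import complex.
From mathcomp Require Import all_classical all_reals all_analysis.
From mathcomp Require Import measurable_realfun ess_sup_inf.
From mathcomp Require Import zify ring lra.

Set Implicit Arguments.
Unset Strict Implicit.
Unset Printing Implicit Defensive.
Import Order.TTheory GRing.Theory Num.Theory.
Import numFieldNormedType.Exports.

Local Open Scope classical_set_scope.
Local Open Scope ring_scope.
Local Open Scope quotient_scope.
Local Open Scope complex_scope.

(** * Unconditional sums over the integers *)

Section int_sum.
Context (R : realType).
Implicit Types f g F G : int -> R.

(** The weights are bounded only almost everywhere for the product of the marginals, whereas a gap
    integrates them along the fibres of a coupling that may be singular. Each marginal is a mixture
    of the fibre measures, so a null set of the product remains null on almost every fibre. On the
    other fibres the weights may fail to be integrable; the weak integral then takes its default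
    value 0, and measurability must be checked there too. The comparison of positions is asymmetric:
    in [gamma w2] the Dirac mass sits at the fixed variable and leaves the average, so only the
    first half of the gap moves positions. The factor [delta (X2)] then depends on the second
    variable alone and can be absorbed in a test function. The additive [eps] cannot be avoided:
    [1 - cos] is quadratic near 0, the distance of two Dirac masses in [H^-1] behaves like the
    square root of the torus distance, and truncation always leaves a remainder. [C] may blow up as
    [eps] decreases; this is harmless, because [eps] is fixed before [r] is made small. *)

Lemma esumZl f (c : R) : (forall m, 0 <= f m) -> 0 <= c ->
  \esum_(m in [set: int]) (c * f m)%:E =
  (c%:E * \esum_(m in [set: int]) (f m)%:E)%E.
Proof.
have le a (h : int -> R) : (forall m, 0 <= h m) -> 0 <= a ->
    (\esum_(m in [set: int]) (a * h m)%:E <=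
     a%:E * \esum_(m in [set: int]) (h m)%:E)%E.
  move=> h0 a0; apply: ge_ereal_sup => _ [X [finX _] <-].
  under eq_fsbigr do rewrite EFinM.
  rewrite -ge0_mule_fsumr; last by move=> m; rewrite lee_fin.
  by rewrite lee_wpmul2l ?lee_fin//; apply: esum_ge; exists X.
move=> f0; rewrite le_eqVlt => /predU1P[<-|c0].
  by rewrite mul0e esum1// => m _; rewrite mul0r.
apply/eqP; rewrite eq_le; apply/andP; split; first by apply: le => //; exact: ltW.
have cf0 m : 0 <= c * f m by rewrite mulr_ge0// ltW.
have := le c^-1 _ cf0 (ltW _); rewrite invr_gt0 => /(_ c0).
under eq_esum do rewrite mulKf ?gt_eqF//.
by rewrite lee_pdivlMl.
Qed.

Definition abs_summable F := summable [set: int] (EFin \o F).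

Lemma abs_summableW F g : (forall m, `|F m| <= g m) ->
  (\esum_(m in [set: int]) (g m)%:E < +oo)%E -> abs_summable F.
Proof.
move=> Fg; apply: le_lt_trans; apply: le_esum => m _.
by rewrite /= lee_fin.
Qed.

Lemma abs_summableD F G : abs_summable F -> abs_summable G ->
  abs_summable (fun m => F m + G m).
Proof. exact: summableD. Qed.

Lemma abs_summableZ (a : R) F : abs_summable F -> abs_summable (fun m => a * F m).
Proof.
move=> sF; apply: (@abs_summableW _ (fun m => `|a| * `|F m|)).
  by move=> m; rewrite normrM.
by apply: esum_scale_lty.
Qed.

Lemma abs_summable_posneg F : abs_summable F ->
  abs_summable (fun m => Num.max (F m) 0) /\
  abs_summable (fun m => Num.max (- F m) 0).
Proof.
move=> sF; split; apply: (@abs_summableW _ (fun m => `|F m|)) => // m.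
  by rewrite ger0_norm ?le_max ?lexx ?orbT// ge_max ler_norm/=.
by rewrite ger0_norm ?le_max ?lexx ?orbT// ge_max -normrN ler_norm/=.
Qed.

Lemma maxrB (x : R) : Num.max x 0 - Num.max (- x) 0 = x.
Proof.
have [x0|x0] := leP 0 x.
  by rewrite max_r ?oppr_le0// subr0.
by rewrite max_l ?oppr_ge0 ?(ltW x0)// sub0r opprK.
Qed.

Lemma esum_fin_num f : (forall m, 0 <= f m) -> abs_summable f ->
  \esum_(m in [set: int]) (f m)%:E \is a fin_num.
Proof.
move=> f0; rewrite /abs_summable/summable => sf.
rewrite ge0_fin_numE; last by apply: esum_ge0 => m _; rewrite lee_fin.
apply: le_lt_trans sf; apply: le_esum => m _ /=.
by rewrite lee_fin ler_norm.
Qed.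

Lemma eq_int_sum F G : F =1 G -> int_sum F = int_sum G.
Proof. by move=> /funext ->. Qed.

(** Any splitting into nonnegative summable families computes the sum, not only the positive and
    negative parts. Additivity needs this freedom: the positive part of a sum is not the sum of the
    positive parts. *)
Lemma int_sumB_nneg f g : (forall m, 0 <= f m) -> (forall m, 0 <= g m) ->
  abs_summable f -> abs_summable g ->
  int_sum (fun m => f m - g m) =
  fine (\esum_(m in [set: int]) (f m)%:E) -
  fine (\esum_(m in [set: int]) (g m)%:E).
Proof.
move=> f0 g0 sf sg; rewrite /int_sum -fineB; try exact: esum_fin_num.
congr fine; apply: (@esumB R int [set: int] (EFin \o f) (EFin \o g) sf sg);
by move=> m _; rewrite /= lee_fin.
Qed.

Lemma int_sum_ge0E f : (forall m, 0 <= f m) -> abs_summable f ->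
  int_sum f = fine (\esum_(m in [set: int]) (f m)%:E).
Proof.
move=> f0 sf; have s0 : abs_summable (fun=> 0).
  by apply: (@abs_summableW _ (fun=> 0)) => [m|]; rewrite ?normr0// esum1.
rewrite (_ : f = (fun m => f m - 0)); last by apply/funext => m; rewrite subr0.
rewrite int_sumB_nneg// [X in _ - fine X]esum1// subr0.
by congr fine; apply: eq_esum => m _; rewrite subr0.
Qed.

Lemma int_sumD F G : abs_summable F -> abs_summable G ->
  int_sum (fun m => F m + G m) = int_sum F + int_sum G.
Proof.
move=> sF sG; have [sFp sFn] := abs_summable_posneg sF.
have [sGp sGn] := abs_summable_posneg sG.
have p0 (x : R) : 0 <= Num.max x 0 by rewrite le_max lexx orbT.
have E (H : int -> R) : int_sum H = int_sum (fun m => Num.max (H m) 0 - Num.max (- H m) 0).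
  by apply: eq_int_sum => m; rewrite maxrB.
have -> : (fun m => F m + G m) =
    (fun m => (Num.max (F m) 0 + Num.max (G m) 0) -
              (Num.max (- F m) 0 + Num.max (- G m) 0)).
  by apply/funext => m; have := maxrB (F m); have := maxrB (G m); lra.
rewrite (E F) (E G) !int_sumB_nneg// ?abs_summableD//; last 2 first.
- by move=> m; rewrite addr_ge0.
- by move=> m; rewrite addr_ge0.
have eD (f g : int -> R) : (forall m, 0 <= f m) -> (forall m, 0 <= g m) ->
    abs_summable f -> abs_summable g ->
    fine (\esum_(m in [set: int]) (f m + g m)%:E) =
    fine (\esum_(m in [set: int]) (f m)%:E) +
    fine (\esum_(m in [set: int]) (g m)%:E).
  move=> f0 g0 sf sg; rewrite -fineD; try exact: esum_fin_num.
  by rewrite -esumD//; move=> m _; rewrite lee_fin.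
by rewrite !eD//; ring.
Qed.

Lemma int_sumZ (a : R) F : abs_summable F ->
  int_sum (fun m => a * F m) = a * int_sum F.
Proof.
move=> sF; have [sFp sFn] := abs_summable_posneg sF.
have p0 (x : R) : 0 <= Num.max x 0 by rewrite le_max lexx orbT.
have E (H : int -> R) : int_sum H = int_sum (fun m => Num.max (H m) 0 - Num.max (- H m) 0).
  by apply: eq_int_sum => m; rewrite maxrB.
have eZ (c : R) f : 0 <= c -> (forall m, 0 <= f m) -> abs_summable f ->
    fine (\esum_(m in [set: int]) (c * f m)%:E) =
    c * fine (\esum_(m in [set: int]) (f m)%:E).
  by move=> c0 f0 sf; rewrite esumZl// fineM//; exact: esum_fin_num.
rewrite (E F); have [a0|a0] := leP 0 a.
  have -> : (fun m => a * F m) =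
      (fun m => a * Num.max (F m) 0 - a * Num.max (- F m) 0).
    by apply/funext => m; rewrite -mulrBr [in RHS]maxrB.
  rewrite !int_sumB_nneg// ?abs_summableZ//; last 2 first.
  - by move=> m; rewrite mulr_ge0.
  - by move=> m; rewrite mulr_ge0.
  by rewrite !eZ// mulrBr.
have a0' : 0 <= - a by rewrite oppr_ge0 ltW.
have -> : (fun m => a * F m) =
    (fun m => (- a) * Num.max (- F m) 0 - (- a) * Num.max (F m) 0).
  by apply/funext => m; rewrite -mulrBr -(opprB (Num.max (F m) 0)) maxrB mulrNN.
rewrite !int_sumB_nneg// ?abs_summableZ//; last 2 first.
- by move=> m; rewrite mulr_ge0.
- by move=> m; rewrite mulr_ge0.
by rewrite !eZ//; ring.
Qed.

Lemma abs_summable1 (k : int) (x : R) :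
  abs_summable (fun m => if m == k then x else 0).
Proof.
rewrite /abs_summable /summable (esumID [set k])// setTI setTI.
rewrite esum_set1//= eqxx esum1 ?adde0 ?ltry// => m /= mk.
by case: eqP => // _; rewrite normr0.
Qed.

Lemma int_sum1 (k : int) (x : R) : int_sum (fun m => if m == k then x else 0) = x.
Proof.
have P (y : R) : 0 <= y -> int_sum (fun m => if m == k then y else 0) = y.
  move=> y0; rewrite int_sum_ge0E; [|by move=> m; case: ifP|exact: abs_summable1].
  rewrite (esumID [set k]); last by move=> m _; case: ifP => _; rewrite lee_fin.
  rewrite !setTI esum_set1 eqxx ?lee_fin// esum1 ?adde0// => m /= mk.
  by case: eqP.
have [x0|x0] := leP 0 x; first exact: P.
rewrite (_ : (fun m => _) = (fun m => -1 * (if m == k then - x else 0))).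
  by rewrite int_sumZ ?P ?mulN1r ?opprK// ?oppr_ge0 ?ltW//; exact: abs_summable1.
by apply/funext => m; case: ifP => _; rewrite ?mulr0// mulN1r opprK.
Qed.

End int_sum.

(** * Inner products and the Riesz property *)

Section inner_product.
Context (R : realType) (V : lmodType R) (ip : V -> V -> R).

Record inner_product : Prop := InnerProduct {
  ip_linear : forall a u v w, ip (a *: u + v) w = a * ip u w + ip v w ;
  ip_sym : forall u v, ip u v = ip v u ;
  ip_ge0 : forall u, 0 <= ip u u ;
  ip_def : forall u, ip u u = 0 -> u = 0 }.

(* The form of completeness that the weak integral [vintegral] needs: bounded
   functionals are represented. *)
Definition riesz : Prop := forall L : V -> R,
  (forall a u v, L (a *: u + v) = a * L u + L v) ->
  (exists C, forall e, `|L e| <= C * ip_norm ip e) ->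
  exists v, forall e, L e = ip e v.

Hypothesis ipP : inner_product.

Lemma ip0l v : ip 0 v = 0.
Proof. by have := ip_linear ipP (-1) v v v; rewrite scaleN1r addNr mulN1r addNr. Qed.

Lemma ipZl a u v : ip (a *: u) v = a * ip u v.
Proof. by have := ip_linear ipP a u 0 v; rewrite ip0l !addr0. Qed.

Lemma ipDl u v w : ip (u + v) w = ip u w + ip v w.
Proof. by have := ip_linear ipP 1 u v w; rewrite scale1r mul1r. Qed.

Lemma ipNl u v : ip (- u) v = - ip u v.
Proof. by rewrite -scaleN1r ipZl mulN1r. Qed.

Lemma ipBl u v w : ip (u - v) w = ip u w - ip v w.
Proof. by rewrite ipDl ipNl. Qed.

Lemma ip0r v : ip v 0 = 0. Proof. by rewrite (ip_sym ipP) ip0l. Qed.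

Lemma ipZr a u v : ip u (a *: v) = a * ip u v.
Proof. by rewrite (ip_sym ipP) ipZl (ip_sym ipP). Qed.

Lemma ipBr u v w : ip w (u - v) = ip w u - ip w v.
Proof. by rewrite (ip_sym ipP) ipBl !(ip_sym ipP w). Qed.

Lemma ipNr u v : ip v (- u) = - ip v u.
Proof. by rewrite (ip_sym ipP) ipNl (ip_sym ipP). Qed.

Lemma ip_norm_ge0 u : 0 <= ip_norm ip u. Proof. exact: sqrtr_ge0. Qed.

Lemma ip_norm0 : ip_norm ip 0 = 0.
Proof. by rewrite /ip_norm ip0l sqrtr0. Qed.

Lemma ip_normZ a u : ip_norm ip (a *: u) = `|a| * ip_norm ip u.
Proof.
by rewrite /ip_norm ipZl ipZr mulrA -expr2 sqrtrM ?sqr_ge0// sqrtr_sqr.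
Qed.

Lemma ip_normN u : ip_norm ip (- u) = ip_norm ip u.
Proof. by rewrite -scaleN1r ip_normZ normrN1 mul1r. Qed.

Lemma ip_norm_sqr u : ip_norm ip u ^+ 2 = ip u u.
Proof. by rewrite sqr_sqrtr// ip_ge0. Qed.

Lemma cauchy_schwarz u v : `|ip u v| <= ip_norm ip u * ip_norm ip v.
Proof.
rewrite -sqrtrM ?ip_ge0// -sqrtr_sqr ler_wsqrtr//.
have [v0|] := eqVneq (ip v v) 0; first by rewrite (ip_def ipP v0) !ip0r mulr0 expr0n.
move=> vn0; have vp : 0 < ip v v by rewrite lt_neqAle eq_sym vn0 ip_ge0.
(* [t *: v] is the orthogonal projection of [u] on the line of [v]. *)
pose t := ip u v / ip v v.
have := ip_ge0 ipP (u - t *: v); rewrite ipBl !ipBr !ipZl !ipZr.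
rewrite (ip_sym ipP v u) -(ler_pM2r vp) mul0r.
have -> : (ip u u - t * ip u v - (t * ip u v - t * (t * ip v v))) * ip v v =
  ip u u * ip v v - ip u v ^+ 2 by rewrite /t; field.
by rewrite subr_ge0.
Qed.

Lemma ip_norm_le u c : 0 <= c -> ip u u <= c ^+ 2 -> ip_norm ip u <= c.
Proof.
by move=> c0 uc; rewrite -[leRHS]ger0_norm// -sqrtr_sqr ler_wsqrtr.
Qed.

End inner_product.

Lemma scalar_inner_product (R : realType) : inner_product (@scalar_ip R).
Proof.
split; rewrite /scalar_ip.
- by move=> a u v w; rewrite mulrDl /GRing.scale/= mulrA.
- by move=> u v; rewrite mulrC.
- by move=> u; rewrite -expr2 sqr_ge0.
- by move=> u /eqP; rewrite mulf_eq0 orbb => /eqP.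
Qed.

Lemma scalar_riesz (R : realType) : riesz (@scalar_ip R).
Proof.
move=> L L_lin _; exists (L 1) => e; rewrite /scalar_ip.
have L0 : L 0 = 0 by have := L_lin (-1) 1 1; rewrite scaleN1r addNr mulN1r addNr.
by have := L_lin e 1 0; rewrite L0 !addr0 /GRing.scale/= mulr1.
Qed.

Section prod_hilbert.
Context (R : realType) (V : lmodType R) (ip : V -> V -> R).
Hypotheses (ipP : inner_product ip) (ipR : riesz ip).
Let ip2 (x y : V * V) : R := ip x.1 y.1 + ip x.2 y.2.

Lemma prod_inner_product : inner_product ip2.
Proof.
split; rewrite /ip2.
- move=> a [u1 u2] [v1 v2] [w1 w2] /=; rewrite !(ip_linear ipP); ring.
- by move=> u v; rewrite (ip_sym ipP u.1) (ip_sym ipP u.2).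
- by move=> u; rewrite addr_ge0// ip_ge0.
- move=> [u v]/= /eqP; rewrite paddr_eq0 ?(ip_ge0 ipP)// => /andP[/eqP u0 /eqP v0].
  by rewrite (ip_def ipP u0) (ip_def ipP v0).
Qed.

(** Both factors embed isometrically, so the functional restricted to either factor is bounded by
    the same constant and is represented there. *)
Lemma prod_riesz : riesz ip2.
Proof.
move=> L L_lin [C LC].
have L0 : L 0 = 0 by have := L_lin (-1) 0 0; rewrite scaleN1r addNr mulN1r addNr.
have n1 u : ip_norm ip2 (u, 0) = ip_norm ip u.
  by rewrite /ip_norm /ip2/= (ip0l ipP) addr0.
have n2 u : ip_norm ip2 (0, u) = ip_norm ip u.
  by rewrite /ip_norm /ip2/= (ip0l ipP) add0r.
have [||v1 v1E] := ipR (L := fun u => L (u, 0)).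
- move=> a u v; rewrite -L_lin; congr L; apply: injective_projections => //=.
  by rewrite scaler0 addr0.
- by exists C => e; rewrite -n1.
have [||v2 v2E] := ipR (L := fun u => L (0, u)).
- move=> a u v; rewrite -L_lin; congr L; apply: injective_projections => //=.
  by rewrite scaler0 addr0.
- by exists C => e; rewrite -n2.
exists (v1, v2) => -[e1 e2]; rewrite /ip2/= -v1E -v2E.
have := L_lin 1 (e1, 0) (0, e2); rewrite mul1r => <-; congr L.
by apply: injective_projections => /=; rewrite scale1r ?addr0// add0r.
Qed.

End prod_hilbert.

(** * The Hilbert space H^-1 *)

Section hm1_inner_product.
Context (R : realType).
Local Notation H := (hm1 R).
Local Notation hw := (@hm1_weight R).
Local Notation Re := complex.Re.
Local Notation Im := complex.Im.
Implicit Types a b u v : H.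

Lemma Rcomplex_norm_sqr (x : Rcomplex R) : `|x| ^+ 2 = Re x ^+ 2 + Im x ^+ 2.
Proof. by case: x => x y; rewrite /Num.norm/= sqr_sqrtr// addr_ge0// sqr_ge0. Qed.

Lemma Re_mul_conj (x y : Rcomplex R) :
  Re (x * y^*) = Re x * Re y + Im x * Im y.
Proof. by case: x y => [x1 x2] [y1 y2] /=; rewrite mulrN opprK. Qed.

Definition hm1_term a b m : R := hw m * (Re (a m) * Re (b m) + Im (a m) * Im (b m)).

Lemma hm1_ipE a b : hm1_ip a b = int_sum (hm1_term a b).
Proof. by apply: eq_int_sum => m; rewrite Re_mul_conj. Qed.

Lemma hm1_conj a m : a (- m) = (a m)^*.
Proof. by have /asboolP[] := hm1P a. Qed.

Lemma hm1_sqr_fin a :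
  (\esum_(m in [set: int]) (hw m * (Re (a m) ^+ 2 + Im (a m) ^+ 2))%:E < +oo)%E.
Proof.
have /asboolP[_] := hm1P a.
by under eq_esum do rewrite Rcomplex_norm_sqr.
Qed.

Lemma hm1_sqr_ge0 a m : 0 <= hw m * (Re (a m) ^+ 2 + Im (a m) ^+ 2).
Proof. by rewrite mulr_ge0 ?addr_ge0 ?sqr_ge0 ?ltW ?hm1_weight_gt0. Qed.

Lemma hm1_term_summable a b : abs_summable (hm1_term a b).
Proof.
apply: (@abs_summableW _ _ (fun m => hw m * (Re (a m) ^+ 2 + Im (a m) ^+ 2) +
   hw m * (Re (b m) ^+ 2 + Im (b m) ^+ 2))).
  move=> m; rewrite normrM gtr0_norm ?hm1_weight_gt0// -mulrDr.
  apply: ler_wpM2l; first exact/ltW/hm1_weight_gt0.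
  move: (Re _) (Im _) (Re _) (Im _) => x y z t; rewrite ler_norml; apply/andP; split.
    have := sqr_ge0 (x + z); have := sqr_ge0 (y + t).
    have := sqr_ge0 x; have := sqr_ge0 y; have := sqr_ge0 z; have := sqr_ge0 t; nra.
  have := sqr_ge0 (x - z); have := sqr_ge0 (y - t).
  have := sqr_ge0 x; have := sqr_ge0 y; have := sqr_ge0 z; have := sqr_ge0 t; nra.
under eq_esum do rewrite EFinD.
rewrite esumD ?lte_add_pinfty ?hm1_sqr_fin//.
  by move=> m _; rewrite lee_fin hm1_sqr_ge0.
by move=> m _; rewrite lee_fin hm1_sqr_ge0.
Qed.

Lemma hm1_coef_linear (c : R) a b m : (c *: a + b) m = c *: a m + b m.
Proof. by []. Qed.

Lemma ReZD (c : R) (x y : Rcomplex R) : Re (c *: x + y) = c * Re x + Re y.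
Proof. by case: x y => [? ?] [? ?]. Qed.

Lemma ImZD (c : R) (x y : Rcomplex R) : Im (c *: x + y) = c * Im x + Im y.
Proof. by case: x y => [? ?] [? ?]. Qed.

Lemma hm1_ipxxE a : (hm1_ip a a)%:E =
  \esum_(m in [set: int]) (hw m * (Re (a m) ^+ 2 + Im (a m) ^+ 2))%:E.
Proof. by rewrite hm1_ipxx; apply: eq_esum => m _; rewrite Rcomplex_norm_sqr. Qed.

Lemma hm1_eq a b : (forall m, Re (a m) = Re (b m)) ->
  (forall m, Im (a m) = Im (b m)) -> a = b.
Proof.
move=> rab iab; apply/val_inj/funext => m /=; move: (rab m) (iab m).
by case: (a m) (b m) => [? ?] [? ?] /= -> ->.
Qed.

Lemma hm1_inner_product : inner_product (@hm1_ip R).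
Proof.
split.
- move=> c u v x; rewrite !hm1_ipE.
  rewrite (@eq_int_sum _ _ (fun m => c * hm1_term u x m + hm1_term v x m)).
    rewrite int_sumD; [|exact/abs_summableZ/hm1_term_summable
                       |exact: hm1_term_summable].
    by rewrite (int_sumZ c (hm1_term_summable u x)).
  by move=> m; rewrite /hm1_term hm1_coef_linear ReZD ImZD; ring.
- by move=> u v; rewrite !hm1_ipE; apply: eq_int_sum => m; rewrite /hm1_term; ring.
- move=> u; rewrite -lee_fin hm1_ipxxE esum_ge0// => m _.
  by rewrite lee_fin hm1_sqr_ge0.
- move=> u u0.
  have z m : Re (u m) ^+ 2 + Im (u m) ^+ 2 = 0.
    apply/eqP; rewrite eq_le addr_ge0 ?sqr_ge0// andbT.
    rewrite -(ler_pM2l (hm1_weight_gt0 R m)) mulr0 -lee_fin.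
    rewrite -[leRHS]/(0%:E) -u0 hm1_ipxxE.
    apply: esum_ge; exists [set m]; first by split.
    by rewrite fsbig_set1.
  apply: hm1_eq => m; have /eqP := z m; rewrite paddr_eq0 ?sqr_ge0// !sqrf_eq0.
    by move=> /andP[/eqP].
  by move=> /andP[_ /eqP].
Qed.

(** Windows symmetric about 0, so that truncation to a window keeps the conjugate symmetry of a real
    distribution. *)
Definition in_range N (m : int) := (`|m| < N)%N.

Lemma in_rangeN N m : in_range N (- m) = in_range N m.
Proof. by rewrite /in_range abszN. Qed.

Lemma finite_in_range N : finite_set [set m | in_range N m].
Proof.
apply: (@sub_finite_set _ _ (Posz @` `I_N `|` Negz @` `I_N)).
  move=> [n|n] /=; rewrite /in_range/= => nN; first by left; exists n.
  by right; exists n => //=; rewrite ltnW.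
by rewrite finite_setU; split; apply: finite_image; exact: finite_II.
Qed.

Lemma finite_sub_range (A : set int) : finite_set A ->
  exists N, A `<=` [set m | in_range N m].
Proof.
move=> /finite_seqP[F ->]; exists (\max_(m <- F) `|m|%N).+1 => m /= mF.
by rewrite /in_range ltnS (@leq_bigmax_seq _ _ xpredT (fun m : int => `|m|%N)).
Qed.

(** An unconditional sum is a supremum over finite sets of indices. A finite set that attains it up
    to [eps] lies in a window, and at most [eps] is left outside. *)
Lemma esum_tail (f : int -> R) (eps : R) : (forall m, 0 <= f m) ->
  (\esum_(m in [set: int]) (f m)%:E < +oo)%E -> 0 < eps ->
  exists N, (\esum_(m in [set: int]) (if in_range N m then 0 else f m)%:E
    <= eps%:E)%E.
Proof.
move=> f0 fin eps0.
have finS : \esum_(m in [set: int]) (f m)%:E \is a fin_num.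
  by rewrite ge0_fin_numE// esum_ge0// => m _; rewrite lee_fin.
have [_ [X [finX _] <-] Xlt] := ub_ereal_sup_adherent eps0 finS.
have [N XN] := finite_sub_range finX; exists N.
rewrite (esumID [set m | in_range N m]); last first.
  by move=> m _; case: ifP; rewrite lee_fin.
rewrite setTI setTI esum1 ?add0e; last by move=> m /= ->.
have fE : \esum_(m in [set: int]) (f m)%:E =
  (\esum_(m in [set m | in_range N m]) (f m)%:E +
   \esum_(m in ~` [set m | in_range N m])
     (if in_range N m then 0 else f m)%:E)%E.
  rewrite (esumID [set m | in_range N m]); last by move=> m _; rewrite lee_fin.
  rewrite !setTI; congr (_ + _)%E; apply: eq_esum => m /= mN.
  by case: ifP.
have XA : (\sum_(m \in X) (f m)%:E <= \esum_(m in [set m | in_range N m]) (f m)%:E)%E.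
  by apply: esum_ge; exists X.
move: Xlt; rewrite -[ereal_sup _]/(\esum_(m in [set: int]) (f m)%:E) fE.
move: XA; set B := \esum_(m in ~` _) _; set A := \esum_(m in [set m | in_range N m]) _.
move=> XA; have : (A + B)%E \is a fin_num by rewrite -fE.
rewrite fin_numD => /andP[Afin Bfin] h.
have {h XA} := lt_le_trans h XA; move: A B fE Afin Bfin => -[x||] [y||] _ // _ _.
by rewrite lte_fin lee_fin => {}h; lra.
Qed.

End hm1_inner_product.

(** * Riesz representation in [H^-1] by Fourier truncation *)

Section hm1_riesz.
Context (R : realType).
Local Notation H := (hm1 R).
Local Notation hw := (@hm1_weight R).
Local Notation Re := complex.Re.
Local Notation Im := complex.Im.

Definition conj_symmetric (u : int -> Rcomplex R) := forall m, u (- m) = (u m)^*.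

Definition htrunc_coef N (u : int -> Rcomplex R) m : Rcomplex R :=
  if in_range N m then u m else 0.

Lemma htrunc_coefP N u : conj_symmetric u -> htrunc_coef N u \in @hm1_pred R.
Proof.
move=> us; apply/asboolP; split.
- move=> m; rewrite /htrunc_coef in_rangeN us; case: ifP => // _.
  by apply/eqP; rewrite eq_complex /= oppr0 !eqxx.
- rewrite (esumID [set m | in_range N m]); last first.
    by move=> m _; rewrite lee_fin mulr_ge0 ?sqr_ge0// ltW// hm1_weight_gt0.
  rewrite !setTI [X in (_ + X)%E]esum1 ?adde0; last first.
    by move=> m /= /negP/negbTE; rewrite /htrunc_coef => ->; rewrite normr0 expr0n mulr0.
  rewrite -[[set m | in_range N m]]set_mem_set esum_fset; last 2 first.
  - by rewrite set_mem_set; exact: finite_in_range.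
  - by move=> m _; rewrite lee_fin mulr_ge0 ?sqr_ge0// ltW// hm1_weight_gt0.
  by rewrite fsumEFin ?ltry// set_mem_set; exact: finite_in_range.
Qed.

Definition htrunc N u (us : conj_symmetric u) : H := HM1 (htrunc_coefP N us).

Lemma htruncE N u (us : conj_symmetric u) m :
  htrunc N us m = if in_range N m then u m else 0.
Proof. by []. Qed.

Lemma esum_tail_ge (f : int -> R) (eps : R) : (forall m, 0 <= f m) ->
  (\esum_(m in [set: int]) (f m)%:E < +oo)%E -> 0 < eps ->
  exists N0, forall N, (N0 <= N)%N ->
  (\esum_(m in [set: int]) (if in_range N m then 0 else f m)%:E <= eps%:E)%E.
Proof.
move=> f0 fin /(esum_tail f0 fin)[N0 N0P]; exists N0 => N N0N.
apply: le_trans N0P; apply: le_esum => m _; rewrite lee_fin.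
have [mN0|_] := boolP (in_range N0 m); last by case: ifP.
by rewrite /in_range (leq_trans mN0).
Qed.

Lemma hm1_coefB (a b : H) m : (a - b) m = a m - b m. Proof. by []. Qed.

Lemma htrunc_approx (e : H) (eps : R) : 0 < eps -> exists N0, forall N,
  (N0 <= N)%N -> ip_norm (@hm1_ip R) (e - htrunc N (hm1_conj e)) <= eps.
Proof.
move=> eps0; have [|N0 N0P] := esum_tail_ge (hm1_sqr_ge0 e) (hm1_sqr_fin e)
  (eps := eps ^+ 2); first by rewrite exprn_gt0.
exists N0 => N /N0P {}N0P; apply: ip_norm_le; first exact: ltW.
rewrite -lee_fin hm1_ipxxE; apply: le_trans N0P.
apply: le_esum => m _; rewrite lee_fin hm1_coefB htruncE.
case: ifP => _; first by rewrite subrr/= expr0n/= addr0 mulr0.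
by rewrite subr0.
Qed.

Definition ecos_coef (k : nat) (m : int) : Rcomplex R :=
  (if `|m|%N == k then 1 else 0) +i* 0.

Definition esin_coef (k : nat) (m : int) : Rcomplex R :=
  0 +i* (if `|m|%N == k then (sgz m)%:~R else 0).

Lemma ecos_sym k : conj_symmetric (ecos_coef k).
Proof. by move=> m; rewrite /ecos_coef abszN /= oppr0. Qed.

Lemma esin_sym k : conj_symmetric (esin_coef k).
Proof.
move=> m; rewrite /esin_coef abszN sgzN /=; congr (_ +i* _).
by case: ifP; rewrite ?oppr0// rmorphN.
Qed.

(* [ecos k] and [esin k] span, over the reals, the elements supported on the
   modes [k] and [-k]; [esin 0 = 0]. *)
Definition ecos k : H := htrunc k.+1 (ecos_sym k).
Definition esin k : H := htrunc k.+1 (esin_sym k).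

Lemma ecosE k m : ecos k m = ecos_coef k m.
Proof.
rewrite htruncE; case: ifPn => //; rewrite /in_range /ecos_coef -leqNgt => km.
by rewrite gtn_eqF.
Qed.

Lemma esinE k m : esin k m = esin_coef k m.
Proof.
rewrite htruncE; case: ifPn => //; rewrite /in_range /esin_coef -leqNgt => km.
by rewrite gtn_eqF.
Qed.

Lemma int_sum_abs (g : int -> R) k :
  int_sum (fun m => if `|m|%N == k then g m else 0) =
  g k%:Z + (if k == 0%N then 0 else g (- k%:Z)).
Proof.
rewrite -(int_sum1 k%:Z (g k%:Z)) -[X in _ + X](int_sum1 (- k%:Z)).
rewrite -int_sumD; try exact: abs_summable1.
apply: eq_int_sum => m.
have [->|mk] := eqVneq m k%:Z.
  by rewrite absz_nat eqxx; case: k => [|k]; rewrite addr0.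
rewrite add0r; have [mk'|mk'] := eqVneq m (- k%:Z).
  by rewrite mk' abszN absz_nat eqxx; case: k mk mk' => [|//] mk mk'; lia.
by rewrite ifF//; lia.
Qed.

Lemma hm1_weightN m : hw (- m) = hw m.
Proof. by rewrite /hm1_weight rmorphN/= sqrrN. Qed.

(** The squared norm of [ecos k], and of [esin k] for [k > 0]; the modes [k] and [-k] merge when
    [k = 0]. *)
Definition basis_weight (k : nat) : R := if k == 0%N then hw 0 else 2 * hw k%:Z.

Lemma basis_weight_gt0 k : 0 < basis_weight k.
Proof.
by rewrite /basis_weight; case: ifP => _; rewrite ?mulr_gt0// hm1_weight_gt0.
Qed.

Lemma ip_ecos k v : hm1_ip (ecos k) v = basis_weight k * Re (v k%:Z).
Proof.
rewrite hm1_ipE (@eq_int_sum _ _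
  (fun m => if `|m|%N == k then hw m * Re (v m) else 0)); last first.
  move=> m; rewrite /hm1_term ecosE /=; case: ifP => _; last by rewrite !mul0r addr0 mulr0.
  by rewrite mul1r mul0r addr0.
rewrite int_sum_abs /basis_weight; case: eqP => [->|_]; first by rewrite addr0.
by rewrite hm1_weightN hm1_conj; case: (v k) => x y /=; ring.
Qed.

Lemma ip_esin k v : hm1_ip (esin k) v = basis_weight k * ((k != 0%N)%:R * Im (v k%:Z)).
Proof.
rewrite hm1_ipE (@eq_int_sum _ _
  (fun m => if `|m|%N == k then hw m * ((sgz m)%:~R * Im (v m)) else 0)); last first.
  move=> m; rewrite /hm1_term esinE /=; case: ifP => _; last by rewrite !mul0r addr0 mulr0.
  by rewrite mul0r add0r.
rewrite int_sum_abs /basis_weight; case: eqP => [->|/eqP k0] /=.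
  by rewrite sgz0 !mul0r mulr0 addr0.
rewrite hm1_weightN hm1_conj sgzN gtr0_sgz ?ltz_nat ?lt0n//.
by case: (v k) => x y /=; rewrite !mulN1r opprK; ring.
Qed.

(** By conjugate symmetry the coefficient at [N] determines the one at [-N], so one step of
    truncation adds real multiples of two fixed vectors. Linear statements on truncations follow by
    induction. *)
Lemma htruncS N u (us : conj_symmetric u) :
  htrunc N.+1 us = Re (u N%:Z) *: ecos N + (Im (u N%:Z) *: esin N + htrunc N us).
Proof.
have cE m : (Re (u N%:Z) *: ecos N + (Im (u N%:Z) *: esin N + htrunc N us)) m =
   Re (u N%:Z) *: ecos_coef N m + (Im (u N%:Z) *: esin_coef N m + htrunc N us m).
  by rewrite -ecosE -esinE.
apply/val_inj/funext => m; rewrite [LHS]htruncE [RHS]cE htruncE.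
rewrite /in_range ltnS leq_eqVlt /ecos_coef /esin_coef.
have [mN|mN] := eqVneq `|m|%N N => /=; last first.
  case: (u m) => x y; apply/eqP; case: ifP => _;
  by rewrite eq_complex /= !(mulr0, addr0, add0r) !eqxx.
rewrite mN ltnn; have [u0|u0] : m = N%:Z \/ m = - N%:Z.
    lia.
- rewrite u0; case: N {mN u0 cE} => [|N].
    (* Conjugate symmetry makes the coefficient at 0 real, so nothing is lost by [esin 0 = 0]. *)
    have /= := us 0; rewrite oppr0; case: (u 0) => x y [] /eqP.
    rewrite -addr_eq0 -mulr2n mulrn_eq0/= => /eqP ->.
    by apply/eqP; rewrite eq_complex/= !(mulr0, mulr1, mul0r, addr0, add0r) !eqxx.
  case: (u N.+1) => x y; apply/eqP.
  by rewrite eq_complex/= !(mulr0, mulr1, mul0r, addr0, add0r) !eqxx.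
- rewrite u0 us; case: N {mN u0 cE} => [|N].
    have /= := us 0; rewrite oppr0; case: (u 0) => x y [] /eqP.
    rewrite -addr_eq0 -mulr2n mulrn_eq0/= => /eqP ->.
    by apply/eqP; rewrite eq_complex/= !(mulr0, mulr1, mul0r, addr0, add0r, oppr0) !eqxx.
  rewrite sgzN; case: (u N.+1) => x y; apply/eqP.
  by rewrite eq_complex/= !(mulr0, mulr1, mulrN1, mul0r, addr0, add0r) !eqxx.
Qed.

Section representation.
Variable L : H -> R.
Hypothesis L_lin : forall a u v, L (a *: u + v) = a * L u + L v.

(** Only the basis elements below [N] constrain [v], which may thus be a truncation of the
    representer, before the whole family is known to lie in [H^-1]. *)
Lemma L_htrunc (v : H) N u (us : conj_symmetric u) :
  (forall k, (k < N)%N -> L (ecos k) = hm1_ip (ecos k) v) ->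
  (forall k, (k < N)%N -> L (esin k) = hm1_ip (esin k) v) ->
  L (htrunc N us) = hm1_ip (htrunc N us) v.
Proof.
elim: N => [_ _|N IH Lc Ls].
  have -> : htrunc 0 us = 0.
    by apply/val_inj/funext => m; rewrite [LHS]htruncE.
  rewrite (ip0l (hm1_inner_product R)).
  by have := L_lin (-1) 0 0; rewrite scaleN1r addNr mulN1r addNr.
rewrite htruncS !L_lin !(ip_linear (hm1_inner_product R)) IH ?Lc ?Ls//.
- by move=> k kN; rewrite Lc// ltnW.
- by move=> k kN; rewrite Ls// ltnW.
Qed.

(** The coefficients forced by [ecos k] and [esin k], whose pairings see only the mode [k] of a real
    distribution; [sgz] extends the imaginary part oddly to the negative modes. *)
Definition representer (m : int) : Rcomplex R :=
  (L (ecos `|m|%N) / basis_weight `|m|%N) +i*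
  ((sgz m)%:~R * (L (esin `|m|%N) / basis_weight `|m|%N)).

Lemma representer_sym : conj_symmetric representer.
Proof.
by move=> m; rewrite /representer abszN sgzN rmorphN mulNr.
Qed.

Lemma esin0 : esin 0 = 0.
Proof.
apply: hm1_eq => m; rewrite esinE /esin_coef//=.
by case: eqP => // /eqP; rewrite absz_eq0 => /eqP ->.
Qed.

Lemma representer_ecos (v : H) k : v k%:Z = representer k%:Z ->
  L (ecos k) = hm1_ip (ecos k) v.
Proof.
move=> vk; rewrite ip_ecos vk /= mulrC divfK// gt_eqF//.
exact: basis_weight_gt0.
Qed.

Lemma representer_esin (v : H) k : v k%:Z = representer k%:Z ->
  L (esin k) = hm1_ip (esin k) v.
Proof.
move=> vk; rewrite ip_esin vk /=; case: k {vk} => [|k].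
  rewrite esin0 eqxx mul0r mulr0.
  by have := L_lin (-1) 0 0; rewrite scaleN1r addNr mulN1r addNr.
rewrite !mul1r mulrC divfK// gt_eqF//.
exact: basis_weight_gt0.
Qed.

End representation.

(** On the truncated representer, [|v N|^2 = L (v N) <= C |v N|]; the partial sums thus stay below
    [C^2] and the full family lies in [H^-1]. Agreement with [L] extends from truncations to every
    [e] by continuity. *)
Lemma hm1_riesz : riesz (@hm1_ip R).
Proof.
move=> L L_lin [C LC].
have ipP := hm1_inner_product R.
pose v N := htrunc N (representer_sym L).
have vrep N k : (k < N)%N -> v N k%:Z = representer L k%:Z.
  by move=> kN; rewrite htruncE /in_range kN.
have vle N : hm1_ip (v N) (v N) <= C ^+ 2.
  have LE : L (v N) = hm1_ip (v N) (v N).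
    by apply: L_htrunc => // k kN;
      [apply: representer_ecos|apply: representer_esin] => //; exact: vrep.
  have := LC (v N); rewrite LE -(ip_norm_sqr ipP).
  have n0 := @ip_norm_ge0 _ _ (@hm1_ip R) (v N).
  rewrite ger0_norm ?sqr_ge0// => h.
  have [->|vn0] := eqVneq (ip_norm (@hm1_ip R) (v N)) 0.
    by rewrite expr0n/= sqr_ge0.
  have vp : 0 < ip_norm (@hm1_ip R) (v N) by rewrite lt_neqAle eq_sym vn0.
  move: h; rewrite expr2 ler_pM2r// => h.
  by rewrite -expr2 lerXn2r// nnegrE// (le_trans n0).
have rep_in : representer L \in @hm1_pred R.
  apply/asboolP; split; first exact: representer_sym.
  apply: (@le_lt_trans _ _ (C ^+ 2)%:E); last exact: ltry.
  apply: ge_ereal_sup => _ [X [finX _] <-].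
  have [N XN] := finite_sub_range finX.
  apply: (@le_trans _ _ (hm1_ip (v N) (v N))%:E); last by rewrite lee_fin.
  rewrite hm1_ipxx; apply: esum_ge; exists X; first by split.
  rewrite le_eqVlt; apply/orP; left; apply/eqP/eq_fsbigr => m /set_mem mX.
  by rewrite htruncE (XN _ mX).
pose w : H := HM1 rep_in.
exists w => e; apply/eqP; rewrite -subr_eq0 -normr_eq0.
rewrite eq_le normr_ge0 andbT; apply/ler_addgt0Pl => eps eps0; rewrite addr0.
(* [K] bounds the norm of the difference of the two functionals; the added 1 allows a division by
   it. *)
pose K := `|C| + ip_norm (@hm1_ip R) w + 1.
have K0 : 0 < K by rewrite ltr_wpDl// addr_ge0// ip_norm_ge0.
have [|N /(_ N (leqnn _)) NP] := htrunc_approx e (eps := eps / K).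
  exact: divr_gt0.
set eN := htrunc N _ in NP.
have LeN : L eN = hm1_ip eN w.
  by apply: L_htrunc => // k _; [apply: representer_ecos|apply: representer_esin].
have -> : L e - hm1_ip e w = L (e - eN) - hm1_ip (e - eN) w.
  have -> : L (e - eN) = L e - L eN.
    by rewrite addrC -scaleN1r L_lin mulN1r addrC.
  by rewrite (ipBl ipP) LeN; ring.
rewrite (le_trans (ler_normB _ _))//.
have n0 := @ip_norm_ge0 _ _ (@hm1_ip R) (e - eN).
apply: (@le_trans _ _ (K * ip_norm (@hm1_ip R) (e - eN))).
  rewrite mulrDl mul1r mulrDl ler_wpDr// lerD//.
    by rewrite (le_trans (LC _))// ler_wpM2r// ler_norm.
  by rewrite mulrC cauchy_schwarz.
by rewrite mulrC -ler_pdivlMr.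
Qed.

End hm1_riesz.

(** * The torus *)

Section torus_facts.
Context (R : realType).
Local Notation T := (torus R).
Local Notation Re := complex.Re.
Local Notation Im := complex.Im.
Implicit Types x y : T.

Local Notation tpi := (\pi_(torus R)).

Lemma torus_piB (r s : R) : tpi (r - s) = tpi r - tpi s.
Proof. exact: (raddfB \pi_({ideal_quot (@int_pred R)})). Qed.

Lemma torus_piE (r s : R) : tpi r = tpi s <-> exists k : int, r = s + k%:~R.
Proof.
split.
  move=> /eqmodP; rewrite /= /Quotient.equiv unfold_in => /intrP[k kE].
  by exists k; rewrite -kE addrC subrK.
move=> [k ->]; apply/eqmodP; rewrite /= /Quotient.equiv unfold_in.
by rewrite addrAC subrr add0r; apply/intrP; exists k.
Qed.

Lemma torus_dist_lbound x y :
  has_lbound [set `|r| | r in [set r : R | tpi r = x - y]].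
Proof. by exists 0 => _ [r _ <-]. Qed.

Lemma torus_dist_set_neq0 x y :
  [set `|r| | r in [set r : R | tpi r = x - y]] !=set0.
Proof. by exists `|repr (x - y)|, (repr (x - y)) => //=; rewrite reprK. Qed.

Lemma torus_dist_le x y r : tpi r = x - y -> torus_dist x y <= `|r|.
Proof. by move=> rxy; apply: (ge_inf (torus_dist_lbound x y)); exists r. Qed.

Lemma torus_dist_ge x y c : (forall r, tpi r = x - y -> c <= `|r|) ->
  c <= torus_dist x y.
Proof.
move=> h; apply: (lb_le_inf (torus_dist_set_neq0 x y)) => _ [r rxy <-].
exact: h.
Qed.

Lemma torus_dist_ge0 x y : 0 <= torus_dist x y.
Proof. by apply: torus_dist_ge => r _. Qed.

Lemma torus_distC x y : torus_dist x y = torus_dist y x.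
Proof.
suff le (a b : T) : torus_dist a b <= torus_dist b a by apply/eqP; rewrite eq_le !le.
apply: torus_dist_ge => r rE; rewrite -normrN; apply: torus_dist_le.
by rewrite -sub0r torus_piB rE (_ : tpi 0 = 0) ?sub0r ?opprB// (raddf0 \pi_({ideal_quot (@int_pred R)})).
Qed.

(** A section of the projection with values in [[0, 1)]. It does not depend on the representative,
    which makes it measurable, whereas [repr] is an arbitrary choice. *)
Definition torus_frac x : R := repr x - (Num.floor (repr x))%:~R.

Lemma torus_fracK x : tpi (torus_frac x) = x.
Proof.
rewrite -[RHS]reprK; apply/torus_piE; exists (- Num.floor (repr x)).
by rewrite rmorphN.
Qed.

Lemma torus_frac_pi r : torus_frac (tpi r) = r - (Num.floor r)%:~R.
Proof.
rewrite /torus_frac; have [k ->] : exists k : int, repr (tpi r) = r + k%:~R.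
  by apply/torus_piE; rewrite reprK.
by rewrite floorDrz ?intr_int// intrKfloor rmorphD/=; ring.
Qed.

Lemma measurable_torus_frac : measurable_fun setT torus_frac.
Proof.
move=> _ Y mY; rewrite setTI.
have mf : measurable_fun setT (fun r : R => r - (Num.floor r)%:~R).
  apply: measurable_funB; first exact: measurable_id.
  apply: nondecreasing_measurable => // a b ab.
  by rewrite ler_int le_floor.
have := mf measurableT _ mY; rewrite setTI.
suff -> : (fun r : R => r - (Num.floor r)%:~R) = torus_frac \o tpi by [].
by apply/funext => r; rewrite /comp torus_frac_pi.
Qed.

(** The distance is an infimum over the countably many integer translates of a difference of
    fractional parts, each of them measurable. *)
Lemma measurable_torus_dist d (S : measurableType d) (f g : S -> T) :
  measurable_fun setT f -> measurable_fun setT g ->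
  measurable_fun setT (fun z => torus_dist (f z) (g z)).
Proof.
move=> mf mg; have mtf := measurableT_comp measurable_torus_frac mf.
have mtg := measurableT_comp measurable_torus_frac mg.
have mk (k : int) : measurable_fun setT
    (fun z => `|torus_frac (f z) - torus_frac (g z) + k%:~R|).
  apply: measurableT_comp => //; apply: measurable_funD => //.
  exact: measurable_funB.
apply: (measurability (@RGenOInfty.G R)) => //.
  exact: RGenOInfty.measurableE.
move=> _ [_ [c ->] <-]; rewrite setTI.
(* Whether the infimum is attained is left open: a distance at most [c] is expressed by translates
   below [c + 1/(n+1)] for every [n]. *)
rewrite (_ : _ @^-1` _ = ~` \bigcap_(n in [set: nat]) \bigcup_(k in [set: int])
   [set z | `|torus_frac (f z) - torus_frac (g z) + k%:~R| < c + n.+1%:R^-1]).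
  apply: measurableC; apply: bigcapT_measurable => n.
  apply: countable_bigcupT_measurable => // k.
  have := mk k measurableT [set` `]-oo, (c + n.+1%:R^-1)[] (measurable_itv _).
  by rewrite setTI; congr measurable; apply/seteqP; split=> z /=; rewrite in_itv.
have key z e : torus_dist (f z) (g z) < e <->
    exists k : int, `|torus_frac (f z) - torus_frac (g z) + k%:~R| < e.
  split=> [/(inf_lt (torus_dist_set_neq0 _ _))[_ [r rE <-] re]|[k ke]].
    have [k kE] : exists k : int,
        r = torus_frac (f z) - torus_frac (g z) + k%:~R.
      by apply/torus_piE; rewrite rE torus_piB !torus_fracK.
    by exists k; rewrite -kE.
  apply: le_lt_trans ke; apply: torus_dist_le.
  rewrite -[X in _ = X - _]torus_fracK -[X in _ = _ - X]torus_fracK -torus_piB.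
  by apply/torus_piE; exists k.
apply/seteqP; split=> z /=; rewrite in_itv/= andbT => h.
  move=> hb; move: h; rewrite ltNge => /negP; apply.
  apply/ler_addgt0Pl => e e0; rewrite addrC.
  have [n ne] : exists n : nat, n.+1%:R^-1 < e.
    exists (Num.truncn e^-1); rewrite invf_plt ?posrE//.
    by rewrite truncnS_gt.
  have [k _ /= ke] := hb n I; apply/ltW/key; exists k.
  by apply: lt_trans ke _; rewrite ltrD2l.
rewrite ltNge; apply/negP => h'; apply: h => n _.
have /key[k ke] : torus_dist (f z) (g z) < c + n.+1%:R^-1.
  by rewrite (le_lt_trans h')// ltrDl.
by exists k.
Qed.

Lemma cos_lipschitz (a b : R) : `|cos a - cos b| <= `|a - b|.
Proof.
wlog ab : a b / b <= a.
  move=> h; have [/h//|/ltW/h] := leP b a.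
  by rewrite distrC (distrC b).
have [|c _ ->] := @MVT_segment R cos (fun t => - sin t) b a ab.
- by apply: continuous_subspaceT => x; exact: continuous_cos.
- by rewrite normrM normrN ler_piMl// sin_max.
Qed.

Lemma sin_lipschitz (a b : R) : `|sin a - sin b| <= `|a - b|.
Proof.
rewrite -!cosBpihalf (le_trans (cos_lipschitz _ _))//.
by rewrite (_ : a - pi / 2 - (b - pi / 2) = a - b)//; ring.
Qed.

Lemma torus_char_repr m x y r : tpi r = x - y ->
  torus_char m y =
  cos (2 * pi * m%:~R * (repr x - r)) +i* sin (2 * pi * m%:~R * (repr x - r)).
Proof.
by move=> rxy; rewrite -torus_charE torus_piB reprK rxy opprB addrC subrK.
Qed.

(** The bound holds for every representative of [x - y] and passes to the infimum after division by
    the Lipschitz constant, hence the separate case [m = 0]. *)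
Lemma torus_char_lipschitz m x y :
  `|Re (torus_char m x) - Re (torus_char m y)| <=
    `|2 * pi * m%:~R| * torus_dist x y /\
  `|Im (torus_char m x) - Im (torus_char m y)| <=
    `|2 * pi * m%:~R| * torus_dist x y.
Proof.
have [->|m0] := eqVneq m 0.
  by rewrite /torus_char !mulr0 !mul0r !subrr !normr0 !mul0r.
have c0 : 0 < `|2 * pi * m%:~R : R|.
  by rewrite normr_gt0 mulf_neq0 ?intr_eq0// mulf_neq0// gt_eqF// pi_gt0.
have E a b r : a = 2 * pi * m%:~R * repr x ->
    b = 2 * pi * m%:~R * (repr x - r) -> `|a - b| = `|2 * pi * m%:~R| * `|r|.
  by move=> -> ->; rewrite -normrM -mulrBr opprB addrC subrK.
split; rewrite mulrC -ler_pdivrMr//; apply: torus_dist_ge => r rxy;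
  rewrite ler_pdivrMr// mulrC (torus_char_repr m rxy) /torus_char/=.
  by rewrite (le_trans (cos_lipschitz _ _))// (E _ _ r).
by rewrite (le_trans (sin_lipschitz _ _))// (E _ _ r).
Qed.

Lemma Re_torus_charB x y r : tpi r = x - y ->
  cos (2 * pi * r) =
  Re (torus_char 1 x) * Re (torus_char 1 y) +
  Im (torus_char 1 x) * Im (torus_char 1 y).
Proof.
move=> rxy; rewrite (torus_char_repr 1 rxy) /torus_char/= -cosB; congr cos.
by rewrite !mulr1; ring.
Qed.

(** Up to distance [e] the term [eta] suffices. Beyond it, [1 - cos] is at least [1 - cos (2 pi e)],
    whose inverse serves as [C] since the distance never exceeds 1/2. *)
Lemma torus_dist_le_cos (eta : R) : 0 < eta -> exists2 C : R, 0 < C &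
  forall x y, torus_dist x y <= eta + C *
   (1 - (Re (torus_char 1 x) * Re (torus_char 1 y) +
         Im (torus_char 1 x) * Im (torus_char 1 y))).
Proof.
move=> eta0; have pi0 := pi_gt0 R.
(* The cap at 1/2 keeps [2 pi e] in [[0, pi]], where the cosine decreases. *)
pose e := Num.min eta (2^-1).
have e0 : 0 < e by rewrite lt_min eta0/= invr_gt0 ltr0n.
have ele : e <= eta by rewrite ge_min lexx.
have eh : e <= 2^-1 by rewrite ge_min lexx orbT.
have c0 : 0 < 1 - cos (2 * pi * e).
  have : cos (2 * pi * e) < cos 0.
    rewrite ltr_cos ?in_itv/= ?lexx ?pi_ge0//; first by rewrite !mulr_gt0.
    by apply/andP; split; nra.
  by rewrite cos0 subr_gt0.
exists (1 - cos (2 * pi * e))^-1; first by rewrite invr_gt0.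
move=> x y; have [r [rxy rh]] : exists r, tpi r = x - y /\ `|r| <= 2^-1.
  (* Rounding to the nearest integer gives a representative in [[-1/2, 1/2]]. *)
  pose r := repr (x - y); exists (r - (Num.floor (r + 2^-1))%:~R); split.
    rewrite -[RHS]reprK; apply/torus_piE; exists (- Num.floor (r + 2^-1)).
    by rewrite rmorphN.
  have /andP[] := floor_itv (r + 2^-1); rewrite rmorphD/= => a b.
  rewrite ler_norml; apply/andP; split; lra.
rewrite -(Re_torus_charB rxy) (le_trans (torus_dist_le rxy))//.
have [re|re] := leP `|r| e.
  by rewrite (le_trans re)// (le_trans ele)// lerDl mulr_ge0.
have h : 1 <= (1 - cos (2 * pi * e))^-1 * (1 - cos (2 * pi * r)).
  rewrite ler_pdivlMl// mulr1 lerD2l lerN2.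
  rewrite -[cos (2 * pi * r)]cos_norm normrM (gtr0_norm (_ : 0 < 2 * pi)) ?mulr_gt0//.
  apply/ltW; rewrite ltr_cos ?in_itv/=.
  - by rewrite ltr_pM2l// mulr_gt0.
  - by have := normr_ge0 r => ?; apply/andP; split; nra.
  - by apply/andP; split; nra.
by have : (2^-1 : R) <= 1; [lra|]; lra.
Qed.

End torus_facts.

(** * Dirac masses in H^-1 *)

Section delta.
Context (R : realType).
Local Notation T := (torus R).
Local Notation H := (hm1 R).
Local Notation hw := (@hm1_weight R).
Local Notation Re := complex.Re.
Local Notation Im := complex.Im.
Implicit Types x y : T.

Definition delta x : H := hm1_of_measure (\d_x).

Lemma deltaE x m : delta x m = torus_char (- m) x.
Proof.
rewrite -[LHS]/((\int[\d_x]_y Re (torus_char (- m) y)) +i*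
  (\int[\d_x]_y Im (torus_char (- m) y))) /Rintegral.
have dE (f : T -> R) : measurable_fun setT f -> fine (\int[\d_x]_y (f y)%:E)%E = f x.
  move=> mf; rewrite integral_dirac//; last exact/measurable_EFinP.
  by rewrite diracT mul1e.
rewrite !dE//; [exact: measurable_Im_torus_char|exact: measurable_Re_torus_char].
Qed.

Lemma Re_deltaE x m : Re (delta x m) = Re (torus_char m x).
Proof. by rewrite deltaE /torus_char/= rmorphN/= mulrN mulNr cosN. Qed.

Lemma Im_deltaE x m : Im (delta x m) = - Im (torus_char m x).
Proof. by rewrite deltaE /torus_char/= rmorphN/= mulrN mulNr sinN. Qed.

(** The squared [H^-1] norm shared by all Dirac masses, whose Fourier coefficients have modulus
    one. *)
Definition weight_sum : R := fine (\esum_(m in [set: int]) (hw m)%:E).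

Lemma weight_sumE : weight_sum%:E = \esum_(m in [set: int]) (hw m)%:E.
Proof.
rewrite fineK// ge0_fin_numE; first exact: hm1_weight_sum.
by rewrite esum_ge0// => m _; rewrite lee_fin ltW// hm1_weight_gt0.
Qed.

Lemma ip_deltaxx x : hm1_ip (delta x) (delta x) = weight_sum.
Proof.
apply/EFin_inj; rewrite hm1_ipxxE weight_sumE; apply: eq_esum => m _.
by rewrite Re_deltaE Im_deltaE sqrrN /torus_char/= cos2Dsin2 mulr1.
Qed.

Definition delta_norm : R := Num.sqrt weight_sum.

Lemma delta_norm_ge0 : 0 <= delta_norm. Proof. exact: sqrtr_ge0. Qed.

Lemma ip_delta_le (e : H) x : `|hm1_ip e (delta x)| <= delta_norm * ip_norm (@hm1_ip R) e.
Proof.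
rewrite mulrC (le_trans (cauchy_schwarz (hm1_inner_product R) _ _))//.
by rewrite /ip_norm ip_deltaxx.
Qed.

Lemma ip_ecos_delta k x :
  hm1_ip (ecos R k) (delta x) = basis_weight R k * Re (torus_char k%:Z x).
Proof. by rewrite ip_ecos Re_deltaE. Qed.

Lemma ip_esin_delta k x : hm1_ip (esin R k) (delta x) =
  basis_weight R k * ((k != 0%N)%:R * - Im (torus_char k%:Z x)).
Proof. by rewrite ip_esin Im_deltaE. Qed.

(** The mode 0 tests the total mass: it recovers the weight of a weighted Dirac mass wherever the
    mass sits. *)
Lemma ip_ecos0_delta x : hm1_ip (ecos R 0) (delta x) = 1.
Proof.
rewrite ip_ecos_delta /torus_char/= mulr0 mul0r cos0 mulr1 /basis_weight eqxx.
by rewrite /hm1_weight expr0n/= mulr0 addr0 invr1.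
Qed.

Lemma ip_norm_ecos0 : ip_norm (@hm1_ip R) (ecos R 0) = 1.
Proof.
rewrite /ip_norm ip_ecos ecosE /basis_weight eqxx /ecos_coef/= mulr1.
by rewrite /hm1_weight expr0n/= mulr0 addr0 invr1 sqrtr1.
Qed.

(** Truncating [e] leaves a finite combination of characters, and the truncations converge pointwise
    in [x] because all Dirac masses have the same norm. *)
Lemma measurable_ip_delta (e : H) : measurable_fun setT (fun x => hm1_ip e (delta x)).
Proof.
apply: (@measurable_fun_cvg _ _ _ _
  (fun n x => hm1_ip (htrunc n (hm1_conj e)) (delta x))) => [n|x _].
  elim: n => [|n IH].
    have -> : htrunc 0 (hm1_conj e) = 0 by apply/val_inj/funext => m; rewrite [LHS]htruncE.
    under eq_fun do rewrite (ip0l (hm1_inner_product R)).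
    exact: measurable_cst.
  under eq_fun do rewrite htruncS !(ip_linear (hm1_inner_product R)).
  apply: measurable_funD; last apply: measurable_funD => //.
    apply: measurable_funM; first exact: measurable_cst.
    under eq_fun do rewrite ip_ecos_delta.
    apply: measurable_funM; first exact: measurable_cst.
    exact: measurable_Re_torus_char.
  apply: measurable_funM; first exact: measurable_cst.
  under eq_fun do rewrite ip_esin_delta.
  apply: measurable_funM; first exact: measurable_cst.
  apply: measurable_funM; first exact: measurable_cst.
  apply: measurableT_comp => //; exact: measurable_Im_torus_char.
apply/cvgrPdist_le => eps eps0.
have D0 : 0 < delta_norm + 1 by rewrite ltr_wpDl// delta_norm_ge0.
have [|N NP] := @htrunc_approx R e (eps / (delta_norm + 1)); first exact: divr_gt0.
exists N => // n /= /NP; rewrite ler_pdivlMr// => h.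
rewrite -(ipBl (hm1_inner_product R)) (le_trans (ip_delta_le _ _))//.
apply: le_trans h; rewrite mulrC ler_wpM2l ?ip_norm_ge0//.
by rewrite lerDl.
Qed.

(* The modes [|m| >= N] contribute little uniformly in [x] and [y]; the others
   are Lipschitz. *)
Lemma deltaB_norm_le (eps : R) : 0 < eps -> exists2 C : R, 0 < C &
  forall x y, ip_norm (@hm1_ip R) (delta x - delta y) <= eps + C * torus_dist x y.
Proof.
move=> eps0.
(* Characters have modulus one, so a mode outside the window contributes at most 4 times its
   weight. *)
have [|||N NP] := @esum_tail_ge R hw (eps ^+ 2 / 4).
- by move=> m; rewrite ltW// hm1_weight_gt0.
- exact: hm1_weight_sum.
- by rewrite divr_gt0// exprn_gt0.
have {}NP := NP N (leqnn N).
pose K : R := 2 * pi * N%:R; have K0 : 0 <= K by rewrite /K mulr_ge0// mulr_ge0// pi_ge0.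
have D0 := delta_norm_ge0.
have W0 : 0 <= weight_sum.
  by rewrite -(ip_deltaxx 0) (ip_ge0 (hm1_inner_product R)).
(* Chosen for the final comparison [2 z^2 + eps^2 <= (eps + 2 z + t)^2] with [z = K t delta_norm];
   the added 1 makes [C] positive. *)
pose C := 2 * K * delta_norm + 1.
have C0 : 0 < C by rewrite /C ltr_wpDl// mulr_ge0// mulr_ge0.
exists C => // x y; have d0 := torus_dist_ge0 x y.
set t := torus_dist x y in d0 *.
apply: ip_norm_le; first by rewrite addr_ge0 ?mulr_ge0// ltW.
have S : hm1_ip (delta x - delta y) (delta x - delta y) <=
    2 * (K * t) ^+ 2 * weight_sum + 4 * (eps ^+ 2 / 4).
  rewrite -lee_fin hm1_ipxxE.
  have bound m : hw m * (Re ((delta x - delta y) m) ^+ 2 +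
       Im ((delta x - delta y) m) ^+ 2) <=
       2 * (K * t) ^+ 2 * hw m + 4 * (if in_range N m then 0 else hw m).
    have -> : Re ((delta x - delta y) m) = Re (torus_char m x) - Re (torus_char m y).
      rewrite -2!Re_deltaE hm1_coefB; move: (delta x m) (delta y m).
      by case=> ? ? [].
    have -> : Im ((delta x - delta y) m) = - (Im (torus_char m x) - Im (torus_char m y)).
      move: (Im_deltaE x m) (Im_deltaE y m); rewrite hm1_coefB.
      by case: (delta x m) (delta y m) => ? ? [? ?] /= -> ->; ring.
    have w0 := hm1_weight_gt0 R m.
    rewrite sqrrN; case: ifPn => mN.
      have [] := torus_char_lipschitz m x y.
      have mK : `|2 * pi * m%:~R : R| <= K.
        rewrite normrM ger0_norm ?mulr_ge0 ?pi_ge0// /K ler_wpM2l ?mulr_ge0 ?pi_ge0//.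
        by rewrite -intr_norm -[N%:R]/(N%:Z%:~R) ler_int; move: mN; rewrite /in_range; lia.
      have le1 u : `|u| <= `|2 * pi * m%:~R| * t -> u ^+ 2 <= (K * t) ^+ 2.
        move=> h; have {}h : `|u| <= K * t by rewrite (le_trans h)// ler_wpM2r.
        by rewrite -(real_normK (num_real u)); apply: lerXn2r => //; rewrite nnegrE mulr_ge0.
      move=> /le1 h1 /le1 h2.
      rewrite mulr0 addr0 mulrC ler_wpM2r ?(ltW w0)//.
      move: h1 h2; set A := _ ^+ 2; set B := (Im _ - _) ^+ 2; lra.
    have le4 : (Re (torus_char m x) - Re (torus_char m y)) ^+ 2 +
       (Im (torus_char m x) - Im (torus_char m y)) ^+ 2 <= 4.
      rewrite /torus_char/=; set a := _ * repr x; set b := _ * repr y.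
      have ha := cos2Dsin2 a; have hb := cos2Dsin2 b.
      have := sqr_ge0 (cos a + cos b); have := sqr_ge0 (sin a + sin b); nra.
    rewrite -[leLHS]add0r; apply: lerD; last by rewrite mulrC ler_wpM2r ?(ltW w0).
    by rewrite mulr_ge0 ?(ltW w0)// mulr_ge0// sqr_ge0.
  apply: (@le_trans _ _ (\esum_(m in [set: int])
     ((2 * (K * t) ^+ 2 * hw m)%:E + (4 * (if in_range N m then 0 else hw m))%:E))).
    by apply: le_esum => m _; rewrite -EFinD lee_fin.
  have w0 m : 0 <= hw m by rewrite ltW// hm1_weight_gt0.
  have i0 m : 0 <= (if in_range N m then 0 else hw m) by case: ifP.
  rewrite esumD; last 2 first.
  - by move=> m _; rewrite lee_fin mulr_ge0// mulr_ge0// sqr_ge0.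
  - by move=> m _; rewrite lee_fin mulr_ge0.
  have c0 : 0 <= 2 * (K * t) ^+ 2 by rewrite mulr_ge0// sqr_ge0.
  rewrite (esumZl w0 c0) (esumZl i0 (ler0n R 4)) -weight_sumE.
  rewrite [leRHS]EFinD; apply: leeD; first by rewrite -EFinM.
  by rewrite [leRHS]EFinM lee_wpmul2l ?lee_fin.
apply: le_trans S _.
have -> : weight_sum = delta_norm ^+ 2 by rewrite sqr_sqrtr.
have kt0 : 0 <= K * t * delta_norm by rewrite mulr_ge0// mulr_ge0.
have -> : 2 * (K * t) ^+ 2 * delta_norm ^+ 2 = 2 * (K * t * delta_norm) ^+ 2 by ring.
have -> : C * t = 2 * (K * t * delta_norm) + t by rewrite /C; ring.
move: (K * t * delta_norm) kt0 => z z0; nra.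
Qed.

End delta.

(** * Bilinear integrals *)

Section ae_domination.
Context d (T : measurableType d) (R : realType).
Variable mu : {measure set T -> \bar R}.

Lemma ae_le_integrable (f g : T -> R) :
  measurable_fun setT f -> mu.-integrable setT (EFin \o g) ->
  (forall x, 0 <= g x) -> {ae mu, forall x, `|f x| <= g x} ->
  mu.-integrable setT (EFin \o f).
Proof.
move=> mf ig g0 fg; apply/integrableP; split; first exact/measurable_EFinP.
have /integrableP[mg gy] := ig.
apply: le_lt_trans gy; apply: ae_ge0_le_integral => //.
- by do 2 apply: measurableT_comp => //.
- exact: measurableT_comp.
- apply: filterS fg => x fg _ /=.
  by rewrite lee_fin (le_trans fg)// ler_norm.
Qed.

Lemma ae_norm_Rintegral_le (f g : T -> R) :
  measurable_fun setT f -> mu.-integrable setT (EFin \o g) ->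
  (forall x, 0 <= g x) -> {ae mu, forall x, `|f x| <= g x} ->
  `|\int[mu]_x f x| <= \int[mu]_x g x.
Proof.
move=> mf ig g0 fg; have intf := ae_le_integrable mf ig g0 fg.
rewrite (le_trans (le_normr_Rintegral _ intf))//.
have ifn : mu.-integrable setT (EFin \o (fun x => `|f x|)) by exact: integrable_norm.
rewrite -lee_fin !fineK; try exact: integrable_fin_num.
have /integrableP[mg _] := ig; have /integrableP[mfn _] := ifn.
apply: ae_ge0_le_integral => //.
  by move=> x _; rewrite lee_fin.
by apply: filterS fg => x fg _; rewrite lee_fin.
Qed.

Lemma ae_eq_Rintegral (f g : T -> R) :
  measurable_fun setT f -> measurable_fun setT g ->
  {ae mu, forall x, f x = g x} -> \int[mu]_x f x = \int[mu]_x g x.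
Proof.
move=> mf mg fg; congr fine; apply: ae_eq_integral => //; try exact/measurable_EFinP.
by apply: filterS fg => x fg _; rewrite fg.
Qed.

(** The set where [F] is nonnegative and its complement are both admissible [A]; each carries at
    most [c] of the integral of [|F|]. *)
Lemma integral_norm_le2 (F : T -> \bar R) (c : R) : mu.-integrable setT F ->
  (forall A, measurable A ->
    `|\int[mu]_x ((\1_A x : R)%:E * F x)| <= c%:E)%E ->
  (\int[mu]_x `|F x| <= (2 * c)%:E)%E.
Proof.
move=> iF cF; have /integrableP[mF _] := iF.
pose A := [set x | (0 <= F x)%E].
have mA : measurable A.
  by rewrite -[A]setTI; exact: emeasurable_fun_c_infty.
have posE : (fun x => ((\1_A x : R)%:E * F x)%E) = F^\+%E.
  apply/funext => x; rewrite funeposE indicE.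
  have [xA|xA] := boolP (x \in A).
    by rewrite mul1e max_l//; move: xA; rewrite inE.
  rewrite mul0e max_r//; move: xA; rewrite notin_setE /A/= => /negP.
  by rewrite -ltNge => /ltW.
have negE : (fun x => ((\1_(~` A) x : R)%:E * F x)%E) = (\- F^\-)%E.
  apply/funext => x; rewrite funenegE indicE in_setC.
  have [xA|xA] := boolP (x \in A).
    rewrite mul0e max_r ?oppe0//; move: xA; rewrite inE /A/= => xA.
    by rewrite leeNl oppe0.
  rewrite mul1e max_l ?oppeK//; move: xA; rewrite notin_setE /A/= => /negP.
  by rewrite -ltNge => /ltW h; rewrite leeNr oppe0.
have := cF _ mA; rewrite posE => cp.
have := cF _ (measurableC mA); rewrite negE => cn.
rewrite (_ : (fun x => _) = (fun x => F^\+ x + F^\- x)%E); last first.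
  by apply/funext => x; rewrite -/((abse \o F) x) fune_abse.
rewrite ge0_integralD//; last 2 first.
- exact: measurable_funepos.
- exact: measurable_funeneg.
rewrite mulr_natl mulr2n EFinD leeD//.
  by apply: le_trans cp; rewrite lee_abs.
apply: le_trans cn; rewrite integral_ge0N; last by move=> x _; exact: funeneg_ge0.
by rewrite abseN lee_abs.
Qed.

End ae_domination.

(** * Bilinear forms: from indicators to bounded test functions *)

Section bilinear_bounds.
Context d1 d2 (T1 : measurableType d1) (T2 : measurableType d2) (R : realType).
Context (P1 : probability T1 R) (P2 : probability T2 R).
Local Notation mu := (P1 \x P2)%E.

Lemma measurable_fst_comp (f : T1 -> R) : measurable_fun setT f ->
  measurable_fun setT (fun z : T1 * T2 => f z.1).
Proof. by move=> mf; apply: measurableT_comp mf _; exact: measurable_fst. Qed.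

Lemma measurable_snd_comp (f : T2 -> R) : measurable_fun setT f ->
  measurable_fun setT (fun z : T1 * T2 => f z.2).
Proof. by move=> mf; apply: measurableT_comp mf _; exact: measurable_snd. Qed.

Lemma unit_mul_integrable (h K : T1 * T2 -> R) : measurable_fun setT h ->
  (forall z, `|h z| <= 1) -> mu.-integrable setT (EFin \o K) ->
  mu.-integrable setT (EFin \o (fun z => h z * K z)).
Proof.
move=> mh h1 iK; have /integrableP[/measurable_EFinP mK _] := iK.
apply: (@ae_le_integrable _ _ _ _ _ (fun z => `|K z|)) => //.
- exact: measurable_funM.
- exact: integrable_norm.
- by apply: aeW => z; rewrite normrM ler_piMl.
Qed.

(** Integrating out the second variable leaves a function on [T1] with [L^1] norm at most [2 c],
    which bounds its pairing with any [f] of modulus at most 1. *)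
Lemma fst_sign_bound (K : T1 * T2 -> R) (c : R) :
  mu.-integrable setT (EFin \o K) ->
  (forall A, measurable A -> `|\int[mu]_z (\1_A z.1 * K z)| <= c) ->
  forall f : T1 -> R, measurable_fun setT f -> (forall x, `|f x| <= 1) ->
  `|\int[mu]_z (f z.1 * K z)| <= 2 * c.
Proof.
move=> iK cK f mf f1.
have ifK (h : T1 -> R) : measurable_fun setT h -> (forall x : T1, `|h x| <= 1) ->
    mu.-integrable setT (EFin \o (fun z => h z.1 * K z)).
  by move=> mh h1; apply: (unit_mul_integrable _ _ iK) => //; exact: measurable_fst_comp.
have ind1 (A : set T1) x : `|\1_A x : R| <= 1.
  by rewrite indicE; case: (x \in A); rewrite ?normr1 ?normr0.
pose F := fubini_F P2 (EFin \o K).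
have iF : P1.-integrable setT F by exact: integrable_fubini_F.
have F2c : (\int[P1]_x `|F x| <= (2 * c)%:E)%E.
  apply: integral_norm_le2 => // A mA.
  have mi : measurable_fun setT (\1_A : T1 -> R) by exact: measurable_indic.
  have -> : (\int[P1]_x ((\1_A x : R)%:E * F x) = (\int[mu]_z (\1_A z.1 * K z))%:E)%E.
    rewrite fineK; last by apply: integrable_fin_num => //; exact: ifK.
    rewrite -integral12_prod_meas1; last exact: ifK.
    apply: eq_integral => x _; rewrite /F /fubini_F /= indicE.
    case: (x \in A); first by rewrite mul1e; apply: eq_integral => y _; rewrite mul1r.
    by rewrite mul0e; under eq_integral do rewrite mul0r; rewrite integral0.
  by rewrite lee_fin cK.
rewrite -lee_fin; apply: le_trans F2c.
rewrite EFin_normr_Rintegral//; last exact: ifK.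
have := integrable_fubini_F (ifK _ mf f1) => iF'.
rewrite -(integral12_prod_meas1 (ifK _ mf f1)).
have /integrableP[mF' _] := iF'; have /integrableP[mF _] := iF.
apply: le_trans (le_abse_integral _ _ _) _ => //.
apply: ae_ge0_le_integral => //; try exact: measurableT_comp.
(* [f x] leaves the inner integral only where the section of [K] is integrable, that is for almost
   every [x]. *)
apply: filterS (ae_integrable1 iK) => x iKx _.
rewrite /F /fubini_F /=; under eq_integral do rewrite EFinM.
rewrite integralZl//= abseM -[leRHS]mul1e lee_wpmul2r//.
by rewrite lee_fin.
Qed.

Lemma integrable_fubini_G (f : T1 * T2 -> \bar R) : mu.-integrable setT f ->
  P2.-integrable setT (fubini_G P1 f).
Proof.
move=> imf; have /integrableP[mf _] := imf.
apply/integrableP; split; first exact: (measurable_fubini_G imf).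
apply: le_lt_trans ((integrable21ltyP P1 P2 mf).1 imf).
apply: ge0_le_integral => //.
- by apply: measurableT_comp => //; exact: (measurable_fubini_G imf).
- apply: (@measurable_fun_fubini_tonelli_G _ _ _ _ _ P1 (abse \o f)).
    exact: measurableT_comp.
  by move=> y /=; exact: abse_ge0.
- move=> y _; apply: le_abse_integral => //.
  exact: measurable_fun_pair1.
Qed.

Lemma snd_sign_bound (K : T1 * T2 -> R) (c : R) :
  mu.-integrable setT (EFin \o K) ->
  (forall A, measurable A -> `|\int[mu]_z (\1_A z.2 * K z)| <= c) ->
  forall f : T2 -> R, measurable_fun setT f -> (forall x, `|f x| <= 1) ->
  `|\int[mu]_z (f z.2 * K z)| <= 2 * c.
Proof.
move=> iK cK f mf f1.
have ifK (h : T2 -> R) : measurable_fun setT h -> (forall x : T2, `|h x| <= 1) ->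
    mu.-integrable setT (EFin \o (fun z => h z.2 * K z)).
  by move=> mh h1; apply: (unit_mul_integrable _ _ iK) => //; exact: measurable_snd_comp.
have ind1 (A : set T2) x : `|\1_A x : R| <= 1.
  by rewrite indicE; case: (x \in A); rewrite ?normr1 ?normr0.
pose F := fubini_G P1 (EFin \o K).
have iF : P2.-integrable setT F by exact: integrable_fubini_G.
have F2c : (\int[P2]_x `|F x| <= (2 * c)%:E)%E.
  apply: integral_norm_le2 => // A mA.
  have mi : measurable_fun setT (\1_A : T2 -> R) by exact: measurable_indic.
  have -> : (\int[P2]_x ((\1_A x : R)%:E * F x) = (\int[mu]_z (\1_A z.2 * K z))%:E)%E.
    rewrite fineK; last by apply: integrable_fin_num => //; exact: ifK.
    rewrite -integral21_prod_meas1; last exact: ifK.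
    apply: eq_integral => x _; rewrite /F /fubini_G /= indicE.
    case: (x \in A); first by rewrite mul1e; apply: eq_integral => y _; rewrite mul1r.
    by rewrite mul0e; under eq_integral do rewrite mul0r; rewrite integral0.
  by rewrite lee_fin cK.
rewrite -lee_fin; apply: le_trans F2c.
rewrite EFin_normr_Rintegral//; last exact: ifK.
have := integrable_fubini_G (ifK _ mf f1) => iF'.
rewrite -(integral21_prod_meas1 (ifK _ mf f1)).
have /integrableP[mF' _] := iF'; have /integrableP[mF _] := iF.
apply: le_trans (le_abse_integral _ _ _) _ => //.
apply: ae_ge0_le_integral => //; try exact: measurableT_comp.
apply: filterS (ae_integrable2 iK) => x iKx _.
rewrite /F /fubini_G /=; under eq_integral do rewrite EFinM.
rewrite integralZl//= abseM -[leRHS]mul1e lee_wpmul2r//.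
by rewrite lee_fin.
Qed.

Definition weighted_integral (f : T1 -> R) (g : T2 -> R) (k : T1 * T2 -> R) : R :=
  \int[mu]_z (f z.1 * g z.2 * k z).

(** One factor 2 for each variable: the other test function is absorbed in the kernel meanwhile. *)
Lemma sign_bound (k : T1 * T2 -> R) (c : R) : mu.-integrable setT (EFin \o k) ->
  (forall A B, measurable A -> measurable B ->
    `|weighted_integral \1_A \1_B k| <= c) ->
  forall (f : T1 -> R) (g : T2 -> R), measurable_fun setT f -> measurable_fun setT g ->
  (forall x, `|f x| <= 1) -> (forall x, `|g x| <= 1) ->
  `|weighted_integral f g k| <= 4 * c.
Proof.
move=> ik ck f g mf mg f1 g1.
have ind1 d (T : measurableType d) (A : set T) x : `|\1_A x : R| <= 1.
  by rewrite indicE; case: (x \in A); rewrite ?normr1 ?normr0.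
have -> : 4 * c = 2 * (2 * c) by ring.
have igk (h : T2 -> R) : measurable_fun setT h -> (forall x : T2, `|h x| <= 1) ->
    mu.-integrable setT (EFin \o (fun z => h z.2 * k z)).
  by move=> mh h1; apply: (unit_mul_integrable _ _ ik) => //; exact: measurable_snd_comp.
have ifk (h : T1 -> R) : measurable_fun setT h -> (forall x : T1, `|h x| <= 1) ->
    mu.-integrable setT (EFin \o (fun z => h z.1 * k z)).
  by move=> mh h1; apply: (unit_mul_integrable _ _ ik) => //; exact: measurable_fst_comp.
rewrite /weighted_integral; under eq_Rintegral do rewrite -mulrA.
apply: fst_sign_bound => //; first exact: igk.
move=> A mA; under eq_Rintegral do rewrite mulrCA.
have mi : measurable_fun setT (\1_A : T1 -> R) by exact: measurable_indic.
apply: snd_sign_bound => //; first exact: (ifk _ mi (ind1 _ _ A)).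
move=> B mB; under eq_Rintegral do rewrite mulrCA mulrA.
exact: ck.
Qed.

Lemma tensor_integrable (f : T1 -> R) (g : T2 -> R) :
  P1.-integrable setT (EFin \o f) -> P2.-integrable setT (EFin \o g) ->
  mu.-integrable setT (EFin \o (fun z => f z.1 * g z.2)) /\
  \int[mu]_z `|f z.1 * g z.2| = \int[P1]_x `|f x| * \int[P2]_y `|g y|.
Proof.
move=> iF ig; have /integrableP[/measurable_EFinP mf _] := iF.
have /integrableP[/measurable_EFinP mg gy] := ig.
have mfg : measurable_fun setT (fun z : T1 * T2 => f z.1 * g z.2).
  by apply: measurable_funM; [exact: measurable_fst_comp|exact: measurable_snd_comp].
have ifn := integrable_norm iF; have ign := integrable_norm ig.
have E : (\int[P1]_x \int[P2]_y `|(f x * g y)%:E| =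
    (\int[P1]_x `|f x| * \int[P2]_y `|g y|)%:E)%E.
  under eq_integral => x _.
    under eq_integral do rewrite /= normrM EFinM.
    rewrite integralZl//; over.
  rewrite -(fineK (integrable_fin_num _ ign))//.
  rewrite integralZr//= EFinM; congr (_ * _)%E.
  by rewrite fineK//; exact: integrable_fin_num.
split.
  apply/(integrable12ltyP P1 P2); first exact/measurable_EFinP.
  by rewrite /= E ltry.
rewrite /Rintegral; apply: EFin_inj; rewrite fineK; last first.
  apply: integrable_fin_num => //; apply: integrable_norm.
  apply/(integrable12ltyP P1 P2); first exact/measurable_EFinP.
  by rewrite /= E ltry.
rewrite fubini_tonelli1 /fubini_F//=; last exact/measurable_EFinP/measurableT_comp.
Qed.

Section ess_bounded_kernel.
Variables (k : T1 * T2 -> R) (U : R).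
Hypotheses (mk : measurable_fun setT k) (U0 : 0 <= U).
Hypothesis kU : {ae mu, forall z, `|k z| <= U}.

Lemma weighted_integrable (f : T1 -> R) (g : T2 -> R) :
  P1.-integrable setT (EFin \o f) -> P2.-integrable setT (EFin \o g) ->
  mu.-integrable setT (EFin \o (fun z => f z.1 * g z.2 * k z)) /\
  `|weighted_integral f g k| <= U * (\int[P1]_x `|f x| * \int[P2]_y `|g y|).
Proof.
move=> iF ig; have [ifg fgE] := tensor_integrable iF ig.
have /integrableP[/measurable_EFinP mfg _] := ifg.
have iD : mu.-integrable setT (EFin \o (fun z => U * `|f z.1 * g z.2|)).
  have := integrableZl measurableT U (integrable_norm ifg).
  by apply: eq_integrable => // z _; rewrite /= EFinM.
have mD : measurable_fun setT (fun z => f z.1 * g z.2 * k z) by exact: measurable_funM.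
have D0 z : 0 <= U * `|f z.1 * g z.2| by rewrite mulr_ge0.
have dom : {ae mu, forall z, `|f z.1 * g z.2 * k z| <= U * `|f z.1 * g z.2|}.
  by apply: filterS kU => z kz; rewrite normrM mulrC ler_wpM2r.
split; first exact: (ae_le_integrable mD iD D0 dom).
rewrite (le_trans (ae_norm_Rintegral_le mD iD D0 dom))//.
by rewrite RintegralZl ?fgE//; exact: integrable_norm.
Qed.

Lemma kernel_integrable : mu.-integrable setT (EFin \o k).
Proof.
have i1 d (T : measurableType d) (P : probability T R) : P.-integrable setT (EFin \o (fun=> 1 : R)).
  by apply: finite_measure_integrable_cst.
have [+ _] := weighted_integrable (i1 _ _ P1) (i1 _ _ P2).
by apply: eq_integrable => // z _ /=; rewrite !mul1r.
Qed.

End ess_bounded_kernel.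
End bilinear_bounds.

(** * Cut norm and (p,q)-norm *)

Section vintegral.
Context (R : realType) (V : lmodType R) (ip : V -> V -> R).
Hypotheses (ipP : inner_product ip) (ipR : riesz ip).
Context d (T : measurableType d) (mu : {measure set T -> \bar R}).
Implicit Types (D : set T) (u : T -> V).

(** [xget] returns a vector with the defining property only if one exists. Riesz provides it, since
    the integrals form a bounded linear functional of [e]. *)
Lemma vintegralE D u : measurable D ->
  (forall e, mu.-integrable D (fun x => (ip e (u x))%:E)) ->
  (exists C, forall e, `|\int[mu]_(x in D) ip e (u x)| <= C * ip_norm ip e) ->
  forall e, ip e (vintegral ip mu D u) = \int[mu]_(x in D) ip e (u x).
Proof.
move=> mD iu bu e.
have [a v1 v2|//|v vE] := ipR (L := fun e => \int[mu]_(x in D) ip e (u x)).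
  under eq_Rintegral do rewrite (ip_linear ipP).
  have iZ := integrableZl mD a (iu v1).
  have iZ' : mu.-integrable D (EFin \o (fun x => a * ip v1 (u x))).
    by apply: eq_integrable iZ => // x _; rewrite /= EFinM.
  rewrite (RintegralD mD iZ' (iu v2)) (RintegralZl _ mD (iu v1)).
  by [].
have [] := @xgetPex _ 0 [set v | forall e,
  mu.-integrable D (fun x => (ip e (u x))%:E) /\
  ip e v = \int[mu]_(x in D) ip e (u x)] _ e => //.
by exists v => e'; split => //; rewrite vE.
Qed.

Lemma vintegral_eq0 D u e : ~ mu.-integrable D (fun x => (ip e (u x))%:E) ->
  vintegral ip mu D u = 0.
Proof. by move=> iu; apply: xgetPN => v /(_ e)[]. Qed.

End vintegral.

Lemma product_probability_setT d1 d2 (T1 : measurableType d1)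
    (T2 : measurableType d2) (R : realType) (P1 : probability T1 R)
    (P2 : probability T2 R) : (P1 \x P2)%E setT = 1%E.
Proof.
transitivity ((P1 \x P2)%E (setT `*` setT)); first by rewrite setXTT.
by rewrite product_measure1E// -[RHS](mul1e 1%E); congr (_ * _)%E; exact: probability_setT.
Qed.

(** * Norms of essentially bounded kernels *)

Section norm_comparison.
Context (R : realType) (V : lmodType R) (ip : V -> V -> R).
Hypotheses (ipP : inner_product ip) (ipR : riesz ip).
Context d1 d2 (T1 : measurableType d1) (T2 : measurableType d2).
Context (P1 : probability T1 R) (P2 : probability T2 R).
Local Notation mu := (P1 \x P2)%E.
Implicit Types u : T1 * T2 -> V.

(** The exceptional null set may depend on [e]: the norms test one [e] at a time, so weak
    measurability and weak bounds suffice. *)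
Definition ess_bounded u (U : R) := forall e,
  measurable_fun setT (fun z => ip e (u z)) /\
  {ae mu, forall z, `|ip e (u z)| <= U * ip_norm ip e}.

Lemma ess_boundedN u U : ess_bounded u U -> ess_bounded (fun z => - u z) U.
Proof.
move=> uU e; have [mu_ bu] := uU e; split.
  by under eq_fun do rewrite (ipNr ipP); apply: measurableT_comp.
by apply: filterS bu => z; rewrite (ipNr ipP) normrN.
Qed.

Section fixed_kernel.
Variables (u : T1 * T2 -> V) (U : R).
Hypotheses (U0 : 0 <= U) (uU : ess_bounded u U).

Let Ue0 e : 0 <= U * ip_norm ip e.
Proof. by rewrite mulr_ge0// ip_norm_ge0. Qed.

Lemma ess_bounded_integrable e : mu.-integrable setT (EFin \o (fun z => ip e (u z))).
Proof. by have [mk kU] := uU e; exact: kernel_integrable mk (Ue0 e) kU. Qed.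

Lemma ip_vintegral_weighted (f : T1 -> R) (g : T2 -> R) e :
  P1.-integrable setT (EFin \o f) -> P2.-integrable setT (EFin \o g) ->
  ip e (vintegral ip mu setT (fun z => (f z.1 * g z.2) *: u z)) =
  weighted_integral P1 P2 f g (fun z => ip e (u z)).
Proof.
move=> iF ig; rewrite vintegralE//.
- by apply: eq_Rintegral => z _; rewrite (ipZr ipP).
- move=> e'; have [mk kU] := uU e'.
  have [+ _] := weighted_integrable mk (Ue0 e') kU iF ig.
  by apply: eq_integrable => // z _; rewrite /= (ipZr ipP).
- exists (U * (\int[P1]_x `|f x| * \int[P2]_y `|g y|)) => e'.
  have [mk kU] := uU e'.
  have [_] := weighted_integrable mk (Ue0 e') kU iF ig.
  under [X in `|X| <= _ -> _]eq_Rintegral do rewrite -(ipZr ipP).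
  by rewrite mulrAC.
Qed.

Lemma ip_vintegral_rect A B e : measurable A -> measurable B ->
  ip e (vintegral ip mu (A `*` B) u) =
  weighted_integral P1 P2 \1_A \1_B (fun z => ip e (u z)).
Proof.
move=> mA mB; have mAB : measurable (A `*` B) by exact: measurableX.
rewrite vintegralE//.
- rewrite Rintegral_mkcond; apply: eq_Rintegral => z _.
  rewrite patchE /= !indicE in_setX.
  by case: (z.1 \in A); case: (z.2 \in B); rewrite /= ?(mul1r, mul0r, mulr0).
- by move=> e'; apply: integrableS (ess_bounded_integrable e').
- exists U => e'; have [mk kU] := uU e'; have ik := ess_bounded_integrable e'.
  rewrite Rintegral_mkcond.
  apply: (@le_trans _ _ (\int[mu]_z (cst (U * ip_norm ip e') z))).
    apply: ae_norm_Rintegral_le.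
    + have mr : measurable_fun setT ((fun x => ip e' (u x)) \_ (A `*` B)).
        by apply/(measurable_restrictT _ mAB); exact: measurable_funTS.
      exact: mr.
    + have := @finite_measure_integrable_cst _ _ _ (product_subprobability (P1 : subprobability _ _, P2 : subprobability _ _)) setT (U * ip_norm ip e').
      exact.
    + by move=> z; exact: Ue0.
    + apply: filterS kU => z kz; rewrite patchE; case: ifP => _ //.
      by rewrite normr0; exact: Ue0.
  rewrite Rintegral_cst// -[leRHS]mulr1 ler_wpM2l ?Ue0//.
  rewrite le_eqVlt; apply/orP; left; apply/eqP; rewrite -[RHS]/(fine 1%E).
  congr fine; exact: product_probability_setT.
Qed.

(** The supremum in the cut norm carries no absolute value; it comes for free because the unit ball
    contains [-e] along with [e]. *)
Lemma cut_norm_ge e A B : ip_norm ip e <= 1 -> measurable A -> measurable B ->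
  (`|weighted_integral P1 P2 \1_A \1_B (fun z => ip e (u z))|%:E <=
    cut_norm ip P1 P2 u)%E.
Proof.
move=> e1 mA mB.
have [_|_] := ger0P (weighted_integral P1 P2 \1_A \1_B (fun z => ip e (u z))).
  apply: ereal_sup_ubound; exists e, A, B; split=> //.
  by rewrite ip_vintegral_rect.
apply: ereal_sup_ubound; exists (- e), A, B; split=> //; first by rewrite ip_normN.
by rewrite (ipNl ipP) ip_vintegral_rect.
Qed.

Lemma cut_norm_le (c : \bar R) :
  (forall e A B, ip_norm ip e <= 1 -> measurable A -> measurable B ->
   ((weighted_integral P1 P2 \1_A \1_B (fun z => ip e (u z)))%:E <= c)%E) ->
  (cut_norm ip P1 P2 u <= c)%E.
Proof.
move=> h; apply: ge_ereal_sup => _ [e [A [B [e1 mA mB ->]]]].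
by rewrite ip_vintegral_rect//; exact: h.
Qed.

End fixed_kernel.

Lemma cut_norm_ge0 u : (0 <= cut_norm ip P1 P2 u)%E.
Proof.
apply: ereal_sup_ubound; exists 0, set0, set0; split=> //.
  by rewrite ip_norm0.
by rewrite (ip0l ipP).
Qed.

Lemma cut_normN u U : 0 <= U -> ess_bounded u U ->
  (cut_norm ip P1 P2 (fun z => (- u z)%R) <= cut_norm ip P1 P2 u)%E.
Proof.
move=> U0 uU; apply: (cut_norm_le U0 (ess_boundedN uU)) => e A B e1 mA mB.
apply: le_trans (cut_norm_ge U0 uU e1 mA mB); rewrite lee_fin.
apply: le_trans (ler_norm _) _; rewrite -normrN le_eqVlt; apply/orP; left.
apply/eqP; congr `|_|; rewrite -mulN1r -RintegralZl//.
  by apply: eq_Rintegral => z _; rewrite (ipNr ipP) mulrN mulN1r opprK.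
have [mk kU] := ess_boundedN uU e.
have i1 d (T : measurableType d) (P : probability T R) (A' : set T) :
    measurable A' -> P.-integrable setT (EFin \o (\1_A' : T -> R)).
  by move=> mA'; apply: integrable_indic.
by have [] := weighted_integrable mk (mulr_ge0 U0 (ip_norm_ge0 ip e)) kU
  (i1 _ _ P1 A mA) (i1 _ _ P2 B mB).
Qed.

End norm_comparison.

(** * Truncation of test functions *)

Section truncation.
Context (R : realType).

Definition cutoff (M x : R) : R := if `|x| <= M then x else 0.

Lemma cutoff_le M x : 0 <= M -> `|cutoff M x| <= M.
Proof. by rewrite /cutoff; case: ifP; rewrite ?normr0. Qed.

Lemma cutoff_le_norm M x : `|cutoff M x| <= `|x|.
Proof. by rewrite /cutoff; case: ifP; rewrite ?normr0. Qed.

Lemma measurable_cutoff d (T : measurableType d) (f : T -> R) M :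
  measurable_fun setT f -> measurable_fun setT (fun x => cutoff M (f x)).
Proof.
move=> mf; apply: measurable_fun_ifT => //.
by apply: measurable_fun_ler => //; exact: measurableT_comp.
Qed.

(* For finite [r], [|f| > M] implies [|f| <= eps * |f|^r]; [M] does
   not depend on the probability space. *)
Lemma Lnorm_tail (r : \bar R) (eps : R) : (1 < r)%E -> 0 < eps ->
  exists2 M : R, 0 < M & forall d (T : measurableType d) (P : probability T R)
    (f : {mfun T >-> R}), ('N[P]_r[EFin \o f] <= 1)%E ->
  [/\ P.-integrable setT (EFin \o f), \int[P]_x `|f x| <= 2 &
      \int[P]_x `|f x - cutoff M (f x)| <= eps].
Proof.
case: r => [r||]//; last first.
  (* For [r = +oo], [|f|] is at most 1 almost everywhere and the cutoff at 1 leaves no remainder. *)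
  move=> _ eps0; exists 1 => // d T P f.
  rewrite Lnorm.unlock /= probability_setT lte01 => /ess_supP f1.
  have ic c : P.-integrable setT (EFin \o (fun=> c : R)).
    exact: finite_measure_integrable_cst.
  have P1 : fine (P setT) = 1 by rewrite probability_setT.
  have mf : measurable_fun setT f by exact: measurable_funP.
  have f1' : {ae P, forall x, `|f x| <= 1}.
    by apply: filterS f1 => x; rewrite /= lee_fin.
  have intf := ae_le_integrable mf (ic 1) (fun=> ler01) f1'.
  split => //.
    have -> : (2 : R) = \int[P]_x (cst 2 x) by rewrite Rintegral_cst// P1 mulr1.
    rewrite (le_trans (ler_norm _))//.
    apply: (@ae_norm_Rintegral_le _ _ _ _ _ (cst 2)) => //.
    - exact: measurableT_comp.
    - exact: ic.
    - by apply: filterS f1' => x h; rewrite normr_id (le_trans h)// ler1n.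
  rewrite (@ae_eq_Rintegral _ _ _ _ _ (cst 0)).
  - by rewrite Rintegral_cst// mul0r ltW.
  - apply: measurableT_comp => //; apply: measurable_funB => //.
    exact: measurable_cutoff.
  - exact: measurable_cst.
  - by apply: filterS f1' => x h; rewrite /cutoff h subrr normr0.
rewrite lte_fin => r1 eps0.
have r0 : 0 < r by rewrite (lt_trans _ r1).
have r10 : 0 < r - 1 by rewrite subr_gt0.
(* With this height, [|f| > M] gives [|f|^(r-1) >= 1/eps]. *)
pose M := (eps^-1) `^ ((r - 1)^-1).
have M0 : 0 < M by rewrite powR_gt0// invr_gt0.
exists M => // d T P f Nf; have P1 : fine (P setT) = 1 by rewrite probability_setT.
have mf : measurable_fun setT f by exact: measurable_funP.
pose h x := `|f x| `^ r.
have h0 x : 0 <= h x by exact: powR_ge0.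
have mh : measurable_fun setT h.
  by apply: (measurableT_comp (measurable_powR r)); exact: measurableT_comp.
have h1 : (\int[P]_x (h x)%:E <= 1)%E.
  have := @poweR_Lnorm _ _ _ P (EFin \o f) r; rewrite gt_eqF// => /(_ isT).
  rewrite (_ : (fun x => _) = (fun x => (h x)%:E)); last first.
    by apply/funext => x.
  move=> <-; rewrite -(poweR1r r); apply: gt0_ler_poweR => //.
  - exact: ltW.
  - by rewrite in_itv/= Lnorm_ge0 leey.
  - by rewrite in_itv/= lee01 leey.
have ih : P.-integrable setT (EFin \o h).
  apply/integrableP; split; first exact/measurable_EFinP.
  under eq_integral do rewrite /= ger0_norm//.
  by rewrite (le_lt_trans h1)// ltry.
have Rh : \int[P]_x h x <= 1.
  by rewrite -lee_fin fineK//; exact: integrable_fin_num.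
have i1 : P.-integrable setT (EFin \o (fun=> 1 : R)).
  exact: finite_measure_integrable_cst.
(* Source of the bound 2 on the [L^1] norm: both summands have integral at most 1. *)
have le1 x : `|f x| <= 1 + h x.
  have [x1|x1] := leP `|f x| 1; first by rewrite (le_trans x1)// lerDl.
  apply: (@le_trans _ _ (h x)); last by rewrite lerDr.
  by rewrite -{1}[`|f x|]powRr1// ler_powR// ltW.
have i1h : P.-integrable setT (EFin \o (fun x => 1 + h x)).
  by have := integrableD measurableT i1 ih.
have ieh : P.-integrable setT (EFin \o (fun x => eps * h x)).
  have := integrableZl measurableT eps ih.
  by apply: eq_integrable => // x _; rewrite /= EFinM.
have i1h0 x : 0 <= 1 + h x by rewrite addr_ge0.
have ieh0 x : 0 <= eps * h x by rewrite mulr_ge0// ltW.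
split.
- by apply: (ae_le_integrable mf i1h i1h0); exact: aeW.
- rewrite (le_trans (ler_norm _))//.
  rewrite (le_trans (@ae_norm_Rintegral_le _ _ _ _ _ (fun x => 1 + h x) _ _ _ _))//.
  + exact: measurableT_comp.
  + by apply: aeW => x; rewrite normr_id.
  + rewrite RintegralD// Rintegral_cst// mul1r P1.
    by rewrite [leRHS](_ : 2 = 1 + 1)// lerD2l.
- rewrite (le_trans (ler_norm _))//.
  rewrite (le_trans (@ae_norm_Rintegral_le _ _ _ _ _ (fun x => eps * h x) _ _ _ _))//.
  + apply: measurableT_comp => //; apply: measurable_funB => //.
    exact: measurable_cutoff.
  + apply: aeW => x; rewrite normr_id /cutoff; case: ifPn => [_|].
      by rewrite subrr normr0.
    rewrite -ltNge subr0 => Mx; have x0 : 0 < `|f x| by rewrite (lt_trans M0).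
    have -> : h x = `|f x| * `|f x| `^ (r - 1).
      rewrite -[X in X * _]powRr1// -powRD; last by rewrite (gt_eqF x0) implybT.
      by rewrite addrC subrK.
    rewrite mulrCA -[leLHS]mulr1 ler_wpM2l// -ler_pdivrMl// mulr1.
    have -> : eps^-1 = M `^ (r - 1).
      by rewrite /M -powRrM mulVf ?gt_eqF// powRr1// invr_ge0 ltW.
    by apply: ge0_ler_powR; rewrite ?nnegrE ?ltW.
  + by rewrite RintegralZl// -[leRHS]mulr1 ler_wpM2l// ltW.
Qed.

Lemma Lnorm_indic_le1 d (T : measurableType d) (P : probability T R)
    (r : \bar R) (A : set T) (mA : measurable A) : (1 <= r)%E ->
  ('N[P]_r[EFin \o mindic R mA] <= 1)%E.
Proof.
have le1 x : `|mindic R mA x| <= 1.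
  by rewrite /mindic indicE; case: (x \in A); rewrite ?normr1 ?normr0.
case: r => [r||]// r1; rewrite Lnorm.unlock /=; last first.
  rewrite probability_setT lte01; apply/ess_supP/aeW => x /=.
  by rewrite lee_fin.
rewrite lee_fin in r1; have r0 : 0 < r by rewrite (lt_le_trans _ r1).
rewrite -(poweR1r r^-1); apply: gt0_ler_poweR => //.
- by rewrite invr_ge0 ltW.
- by rewrite in_itv/= leey andbT integral_ge0// => x _; exact: poweR_ge0.
- by rewrite in_itv/= lee01 leey.
apply: (@le_trans _ _ (\int[P]_x (cst 1%E x))%E).
  apply: ge0_le_integral => //.
  - rewrite (_ : (fun x => _) = (fun x => (`|mindic R mA x| `^ r)%:E)); last first.
      by apply/funext => x.
    apply/measurable_EFinP; apply: (measurableT_comp (measurable_powR r)).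
    exact: measurableT_comp.
  - move=> x _; rewrite /= lee_fin [leRHS](_ : 1 = 1 `^ r); last by rewrite powR1.
    by apply: ge0_ler_powR; rewrite ?nnegrE// ltW.
by rewrite integral_cst// mul1e [leLHS]probability_setT.
Qed.

(** Conjugation is an involution that sends 1 to [+oo]. A finite [q] thus makes the exponent of the
    first test function exceed 1, as [Lnorm_tail] requires. *)
Lemma hoelder_conjugate_gt1 (q : \bar R) : (1 <= q)%E -> (q < +oo)%E ->
  (1 < hoelder_conjugate q)%E.
Proof.
move=> q1 qy; rewrite lt_neqAle hoelder_conj_ge1// andbT.
apply: contraTneq qy => h; rewrite -leNgt -(hoelder_conjugateK q) -h.
by rewrite hoelder_conjugate1.
Qed.

End truncation.

(** * Comparison of the two norms *)

Section cut_pq.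
Context (R : realType) (V : lmodType R) (ip : V -> V -> R).
Hypotheses (ipP : inner_product ip) (ipR : riesz ip).

Lemma cut_le_pq (p q : \bar R) d1 d2 (T1 : measurableType d1)
    (T2 : measurableType d2) (P1 : probability T1 R) (P2 : probability T2 R)
    (u : T1 * T2 -> V) (U : R) : 0 <= U -> ess_bounded ip P1 P2 u U ->
  (1 <= p)%E -> (1 <= q)%E ->
  (cut_norm ip P1 P2 u <= pq_norm ip P1 P2 p q u)%E.
Proof.
move=> U0 uU p1 q1; apply: (cut_norm_le ipP ipR U0 uU) => e A B e1 mA mB.
apply: ereal_sup_ubound; exists e, (mindic R mA), (mindic R mB); split => //.
- by apply: Lnorm_indic_le1; exact: hoelder_conj_ge1.
- exact: Lnorm_indic_le1.
- by rewrite (ip_vintegral_weighted ipP ipR U0 uU)//; exact: integrable_indic.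
Qed.

Lemma pq_norm_ge0 (p q : \bar R) d1 d2 (T1 : measurableType d1)
    (T2 : measurableType d2) (P1 : probability T1 R) (P2 : probability T2 R)
    (u : T1 * T2 -> V) : (1 <= p)%E -> (1 <= q)%E ->
  (0 <= pq_norm ip P1 P2 p q u)%E.
Proof.
move=> p1 q1; apply: ereal_sup_ubound.
exists 0, (mindic R measurable0), (mindic R measurable0); split=> //.
- by rewrite ip_norm0.
- by apply: Lnorm_indic_le1; exact: hoelder_conj_ge1.
- exact: Lnorm_indic_le1.
- by rewrite (ip0l ipP).
Qed.

(** [C] is fixed before the spaces and the kernel, because the Cauchy property needs one constant
    for all pairs of indices. *)
Lemma pq_le_cut (p q : \bar R) (U eps : R) :
  (1 < p)%E -> (1 <= q)%E -> (q < +oo)%E -> 0 <= U -> 0 < eps ->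
  exists2 C : R, 0 < C & forall d1 d2 (T1 : measurableType d1)
    (T2 : measurableType d2) (P1 : probability T1 R) (P2 : probability T2 R)
    (u : T1 * T2 -> V), ess_bounded ip P1 P2 u U ->
  (pq_norm ip P1 P2 p q u <= eps%:E + C%:E * cut_norm ip P1 P2 u)%E.
Proof.
move=> p1 q1 qy U0 eps0; have q'1 := hoelder_conjugate_gt1 q1 qy.
(* Each of the two remainders is at most [U] times [de] times the bound 2 on the other test
   function, which makes [4 U de] in all. *)
pose de := eps / (4 * U + 1).
have D0 : 0 < 4 * U + 1 by rewrite ltr_wpDl// mulr_ge0.
have de0 : 0 < de by rewrite divr_gt0.
have [M1 M10 M1P] := Lnorm_tail q'1 de0.
have [M2 M20 M2P] := Lnorm_tail p1 de0.
(* The 4 comes from [sign_bound], and [M1 M2] from rescaling the truncated functions to modulus at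
   most 1. *)
exists (4 * (M1 * M2)); first by rewrite !mulr_gt0.
move=> d1 d2 T1 T2 P1 P2 u uU; apply: ge_ereal_sup => _ [e [f [g [e1 Nf Ng ->]]]].
have [iF f2 fd] := M1P _ _ _ _ Nf.
have [ig g2 gd] := M2P _ _ _ _ Ng.
rewrite (ip_vintegral_weighted ipP ipR U0 uU)//.
have cut0 := cut_norm_ge0 ipP P1 P2 u.
case cutE : (cut_norm ip P1 P2 u) => [c||]; last 2 first.
- by rewrite gt0_muley ?addey ?leey// lte_fin !mulr_gt0.
- by move: cut0; rewrite cutE.
rewrite -EFinM -EFinD lee_fin.
have [mk kU'] := uU e; set k := fun z => ip e (u z).
have kU : {ae (P1 \x P2)%E, forall z, `|k z| <= U}.
  by apply: filterS kU' => z h; rewrite (le_trans h)// ler_piMr.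
have ik := ess_bounded_integrable U0 uU e.
have mf : measurable_fun setT f by exact: measurable_funP.
have mg : measurable_fun setT g by exact: measurable_funP.
pose fM x := cutoff M1 (f x); pose gM x := cutoff M2 (g x).
have mfM : measurable_fun setT fM by exact: measurable_cutoff.
have mgM : measurable_fun setT gM by exact: measurable_cutoff.
have ifM : P1.-integrable setT (EFin \o fM).
  apply: (le_integrable measurableT _ _ iF); first exact/measurable_EFinP.
  by move=> x _; rewrite /= lee_fin cutoff_le_norm.
have igM : P2.-integrable setT (EFin \o gM).
  apply: (le_integrable measurableT _ _ ig); first exact/measurable_EFinP.
  by move=> x _; rewrite /= lee_fin cutoff_le_norm.
have ifd : P1.-integrable setT (EFin \o (fun x => f x - fM x)).
  exact: (integrableB measurableT iF ifM).
have igd : P2.-integrable setT (EFin \o (fun x => g x - gM x)).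
  exact: (integrableB measurableT ig igM).
have [i1 _] := weighted_integrable mk U0 kU ifM igM.
have [i2 b2] := weighted_integrable mk U0 kU ifd ig.
have [i3 b3] := weighted_integrable mk U0 kU ifM igd.
have splitW : weighted_integral P1 P2 f g k =
    weighted_integral P1 P2 fM gM k +
    (weighted_integral P1 P2 (fun x => f x - fM x) g k +
     weighted_integral P1 P2 fM (fun x => g x - gM x) k).
  rewrite /weighted_integral -(RintegralD measurableT i2 i3).
  rewrite -(RintegralD measurableT i1).
    by apply: eq_Rintegral => z _; rewrite /= /k; ring.
  by have := integrableD measurableT i2 i3.
have norm0 d (T : measurableType d) (P : probability T R) (h : T -> R) :
  0 <= \int[P]_x `|h x| by exact: Rintegral_ge0.
have b2' : `|weighted_integral P1 P2 (fun x => f x - fM x) g k| <= U * (de * 2).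
  by rewrite (le_trans b2)// ler_wpM2l// ler_pM.
have fM2 : \int[P1]_x `|fM x| <= 2.
  apply: le_trans f2; apply: le_Rintegral => //.
  - exact: integrable_norm ifM.
  - exact: integrable_norm iF.
  - by move=> x _; rewrite cutoff_le_norm.
have b3' : `|weighted_integral P1 P2 fM (fun x => g x - gM x) k| <= U * (2 * de).
  by rewrite (le_trans b3)// ler_wpM2l// ler_pM.
have b1 : `|weighted_integral P1 P2 fM gM k| <= 4 * (M1 * M2) * c.
  have -> : weighted_integral P1 P2 fM gM k = (M1 * M2) *
      weighted_integral P1 P2 (fun x => M1^-1 * fM x) (fun x => M2^-1 * gM x) k.
    rewrite /weighted_integral -RintegralZl//.
      by apply: eq_Rintegral => z _; rewrite /= /k; field; rewrite !gt_eqF.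
    have := integrableZl measurableT (M1^-1 * M2^-1) i1.
    by apply: eq_integrable => // z _ /=; rewrite -EFinM; rewrite /k; congr EFin; ring.
  have M120 : 0 < M1 * M2 by rewrite mulr_gt0.
  rewrite normrM (gtr0_norm M120) (_ : 4 * _ * c = M1 * M2 * (4 * c)); last by ring.
  apply: ler_wpM2l; first exact: ltW.
  apply: sign_bound => //.
  - move=> A B mA mB; have := cut_norm_ge ipP ipR U0 uU e1 mA mB.
    by rewrite cutE lee_fin.
  - exact: measurable_funM.
  - exact: measurable_funM.
  - move=> x; rewrite normrM normfV (gtr0_norm M10) ler_pdivrMl// mulr1.
    by apply: cutoff_le; exact: ltW.
  - move=> x; rewrite normrM normfV (gtr0_norm M20) ler_pdivrMl// mulr1.
    by apply: cutoff_le; exact: ltW.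
have deU : 4 * U * de <= eps.
  rewrite /de mulrCA -[leRHS]mulr1 ler_pM2l// ler_pdivrMr// mul1r.
  by rewrite lerDl.
rewrite splitW (le_trans (ler_norm _))// (le_trans (ler_normD _ _))//.
rewrite addrC lerD// (le_trans (ler_normD _ _))// (le_trans _ deU)//.
by apply: (le_trans (lerD b2' b3')); rewrite le_eqVlt; apply/orP; left; apply/eqP; ring.
Qed.

End cut_pq.

(** * Kernels and disintegrations *)

(* The image under [tau] is made a kernel, so that the integral formula for
   composed kernels turns a disintegration on sets into one on functions. *)
Section image_kernel.
Context d d' d'' (T : measurableType d) (S : measurableType d')
  (Y : measurableType d'') (R : realType).
Variables (k : R.-pker T ~> S) (tau : T * S -> Y).
Hypothesis mtau : measurable_fun setT tau.

Let tau_at (t : T) : S -> Y := fun s => tau (t, s).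

Let measurable_tau_at t : measurable_fun setT (tau_at t).
Proof. exact: measurable_fun_pair2. Qed.

Let image (z : unit * T) : {measure set Y -> \bar R} :=
  measure_function_pushforward__canonical__measure_function_Measure
    (k z.2) (measurable_tau_at z.2).

Let measurable_image U : measurable U -> measurable_fun setT (image ^~ U).
Proof.
move=> mU; have mC : measurable (tau @^-1` U).
  by rewrite -[_ @^-1` _]setTI; exact: mtau.
have := @measurable_fun_xsection_finite_kernel _ _ _ _ _ k (tau @^-1` U).
rewrite inE => /(_ mC) mk.
rewrite (_ : (fun x => image x U) = (fun t => k t (xsection (tau @^-1` U) t)) \o snd).
  by apply: measurableT_comp mk _; exact: measurable_snd.
by apply/funext => z; rewrite /= xsectionE.
Qed.

HB.instance Definition _ := @isKernel.Build _ _ _ _ _ image measurable_image.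

Let image_setT z : image z setT = 1%E.
Proof. exact: prob_kernel. Qed.

HB.instance Definition _ := @Kernel_isProbability.Build _ _ _ _ _ image image_setT.

Lemma integral_disintegrated (m : probability T R) (g : {measure set Y -> \bar R})
    (h : Y -> \bar R) :
  (forall C, measurable C -> g C = \int[m]_t k t [set s | C (tau (t, s))])%E ->
  measurable_fun setT h -> (forall y, (0 <= h y)%E) ->
  (\int[g]_y h y = \int[m]_t \int[k t]_s h (tau (t, s)))%E.
Proof.
move=> gE mh h0.
have mc : measurable_fun setT (fun _ : unit => (m : pprobability T R)).
  exact: measurable_cst.
(* [m] is viewed as a constant kernel on [unit]; its composition with the image kernel has the
   values of [g] on measurable sets. *)
transitivity (\int[kcomp (kprobability mc) image tt]_y h y)%E.
  by apply: eq_measure_integral => C mC _; rewrite gE.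
rewrite (@integral_kcomp _ _ _ _ _ _ _ (kprobability mc) image)//.
apply: eq_integral => t _; rewrite /image ge0_integral_pushforward//.
Qed.

End image_kernel.

(** * Integrals along a kernel and mixtures *)

Section kernel_integral.
Context d1 d2 d3 (T1 : measurableType d1) (T2 : measurableType d2)
  (T3 : measurableType d3) (R : realType).
Variable k : R.-pker T2 ~> T3.

Lemma measurable_kernel_integral (K : T1 * T3 -> \bar R) :
  measurable_fun setT K -> (forall y, (0 <= K y)%E) ->
  measurable_fun setT (fun z : T1 * T2 => \int[k z.2]_i K (z.1, i))%E.
Proof.
move=> mK K0.
apply: (@measurable_fun_integral_finite_kernel _ _ _ _ _
  (fun y : (T1 * T2) * T3 => K (y.1.1, y.2)) (@kernel.kernel_snd _ _ _ T1 _ _ _ k)).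
  by move=> y; exact: K0.
apply: measurableT_comp mK _; apply: measurable_fun_pair => /=.
  by apply: measurableT_comp; [exact: measurable_fst|exact: measurable_fst].
exact: measurable_snd.
Qed.

Lemma measurable_kernel_Rintegral (K : T1 * T3 -> R) : measurable_fun setT K ->
  measurable_fun setT (fun z : T1 * T2 => \int[k z.2]_i K (z.1, i)).
Proof.
move=> mK; have mE : measurable_fun setT (EFin \o K) by exact/measurable_EFinP.
rewrite (_ : (fun z => _) = fine \o (fun z : T1 * T2 =>
   \int[k z.2]_i ((EFin \o K)^\+ (z.1, i)) - \int[k z.2]_i ((EFin \o K)^\- (z.1, i)))%E).
  apply: measurableT_comp => //; apply: emeasurable_funB.
    by apply: measurable_kernel_integral => //; exact: measurable_funepos.
  by apply: measurable_kernel_integral => //; exact: measurable_funeneg.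
apply/funext => z /=; congr fine; rewrite integralE; congr (_ - _)%E.
  by apply: eq_integral => i _; rewrite !funeposE.
by apply: eq_integral => i _; rewrite !funenegE.
Qed.

Context (P1 : probability T1 R) (P2 : probability T2 R) (P3 : probability T3 R).
Hypothesis kP : forall A, measurable A -> (P3 A = \int[P2]_t k t A)%E.

Lemma integral_mixture (h : T3 -> \bar R) : measurable_fun setT h ->
  (forall y, (0 <= h y)%E) -> (\int[P3]_y h y = \int[P2]_t \int[k t]_y h y)%E.
Proof.
move=> mh h0.
exact: (@integral_disintegrated _ _ _ _ _ _ _ k snd measurable_snd P2 P3 h).
Qed.

Lemma integral_mixture_prod (K : T1 * T3 -> \bar R) : measurable_fun setT K ->
  (forall y, (0 <= K y)%E) ->
  (\int[P1 \x P2]_z \int[k z.2]_i K (z.1, i) = \int[P1 \x P3]_y K y)%E.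
Proof.
move=> mK K0; have mm := measurable_kernel_integral mK K0.
rewrite fubini_tonelli1//; last by move=> z; exact: integral_ge0.
rewrite fubini_tonelli1//; apply: eq_integral => x _; rewrite /fubini_F/=.
by rewrite integral_mixture//; exact: measurable_fun_pair2.
Qed.

(** The integral of the indicator of the exceptional set under [P1 \x P3] is the integral under
    [P1 \x P2] of its fibre masses; these vanish almost everywhere when the former is 0. This
    carries the bound on the weights to the fibres. *)
Lemma ae_mixture (Q : T1 * T3 -> bool) : measurable [set y | Q y] ->
  {ae (P1 \x P3)%E, forall y, Q y} ->
  {ae (P1 \x P2)%E, forall z, {ae k z.2, forall i, Q (z.1, i)}}.
Proof.
move=> mQ; have mN := measurableC mQ.
move=> /(negligibleP _ mN) N0.
pose K (y : T1 * T3) : \bar R := (\1_(~` [set y | Q y]) y)%:E.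
have mK : measurable_fun setT K by apply/measurable_EFinP; exact: measurable_indic.
have K0 y : (0 <= K y)%E by rewrite lee_fin.
have := integral_mixture_prod mK K0.
rewrite [RHS]integral_indic// setIT N0 => I0.
have mm := measurable_kernel_integral mK K0.
have := (ae_eq_integral_abs (P1 \x P2)%E measurableT mm).1.
under eq_integral do rewrite gee0_abs ?integral_ge0//.
move=> /(_ I0); apply: filterS => z /(_ I) /=.
rewrite (_ : \int[k z.2]_i K (z.1, i) = k z.2 (~` [set i | Q (z.1, i)]))%E.
  have mz : measurable (~` [set i | Q (z.1, i)]).
    have := measurable_xsection z.1 mN; congr measurable.
    by rewrite xsectionE.
  by move=> h; apply/(negligibleP _ mz).
have mz : measurable (~` [set i | Q (z.1, i)]).
  have := measurable_xsection z.1 mN; congr measurable.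
  by rewrite xsectionE.
by rewrite -[LHS]/(\int[k z.2]_i (\1_(~` [set i | Q (z.1, i)]) i)%:E)%E integral_indic// setIT.
Qed.

End kernel_integral.

(** The swap carries one product measure to the other, by uniqueness of the product. *)
Lemma ae_swap d1 d2 (T1 : measurableType d1) (T2 : measurableType d2)
    (R : realType) (P1 : probability T1 R) (P2 : probability T2 R)
    (Q : T2 * T1 -> Prop) : {ae (P2 \x P1)%E, forall z, Q z} ->
  {ae (P1 \x P2)%E, forall z, Q (z.2, z.1)}.
Proof.
pose sw (z : T1 * T2) := (z.2, z.1).
have msw : measurable_fun setT (fun z : T2 * T1 => (z.2, z.1)) by exact: measurable_swap.
have msw' : measurable_fun setT sw by exact: measurable_swap.
pose m' := measure_function_pushforward__canonical__measure_function_Measure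
  (P2 \x P1)%E msw.
have m'E X : measurable X -> (P1 \x P2)%E X = m' X.
  apply: product_measure_unique => A B mA mB.
  rewrite /m' /= /pushforward (_ : _ @^-1` _ = B `*` A).
    by rewrite product_measure1E// muleC.
  by apply/seteqP; split=> -[x y] [].
move=> [N [mN N0 QN]]; exists (sw @^-1` N); split.
- by rewrite -[_ @^-1` _]setTI; exact: msw'.
- rewrite m'E; last by rewrite -[_ @^-1` _]setTI; exact: msw'.
  rewrite -[RHS]N0 /m' /= /pushforward; congr (_ _).
  by apply/seteqP; split=> -[x y].
- by move=> z /= nQ; apply: QN.
Qed.

(** * Averages of weighted Dirac masses *)

Lemma hm1x2_inner_product (R : realType) : inner_product (@hm1x2_ip R).
Proof. exact: prod_inner_product (hm1_inner_product R). Qed.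

Lemma hm1x2_riesz (R : realType) : riesz (@hm1x2_ip R).
Proof. exact: prod_riesz (hm1_inner_product R) (@hm1_riesz R). Qed.

Section weighted_delta.
Context (R : realType).
Local Notation ip2 := (@hm1x2_ip R).
Implicit Types e : hm1 R * hm1 R.

Lemma ip_norm_fst e : ip_norm (@hm1_ip R) e.1 <= ip_norm ip2 e.
Proof.
by rewrite /ip_norm ler_wsqrtr// lerDl (ip_ge0 (hm1_inner_product R)).
Qed.

Lemma ip_norm_snd e : ip_norm (@hm1_ip R) e.2 <= ip_norm ip2 e.
Proof.
by rewrite /ip_norm ler_wsqrtr// lerDr (ip_ge0 (hm1_inner_product R)).
Qed.

(** Affine in the weight [a]: at a fixed position, averaging over weights amounts to pairing at the
    average weight. *)
Definition pairing e (x : torus R) (a : R) : R :=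
  hm1_ip e.1 (delta x) + a * hm1_ip e.2 (delta x).

Lemma hm1x2_ip_delta e x a : ip2 e (delta x, a *: delta x) = pairing e x a.
Proof. by rewrite /hm1x2_ip/= (ipZr (hm1_inner_product R)). Qed.

Lemma pairing_le e x a :
  `|pairing e x a| <= (delta_norm R * (1 + `|a|)) * ip_norm ip2 e.
Proof.
have D0 := delta_norm_ge0 R.
have h1 := le_trans (ip_delta_le e.1 x) (ler_wpM2l D0 (ip_norm_fst e)).
have h2 := le_trans (ip_delta_le e.2 x) (ler_wpM2l D0 (ip_norm_snd e)).
rewrite (le_trans (ler_normD _ _))// normrM mulrDr mulr1 mulrDl lerD//.
by rewrite -mulrA [X in _ <= X]mulrCA ler_wpM2l.
Qed.

Lemma measurable_pairing d (S : measurableType d) e (Y : S -> torus R)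
    (W : S -> R) : measurable_fun setT Y -> measurable_fun setT W ->
  measurable_fun setT (fun s => pairing e (Y s) (W s)).
Proof.
move=> mY mW; apply: measurable_funD.
  exact: measurableT_comp (measurable_ip_delta _) mY.
apply: measurable_funM => //.
exact: measurableT_comp (measurable_ip_delta _) mY.
Qed.

Section fixed_measure.
Context d (S : measurableType d) (nu : {measure set S -> \bar R}).
Hypothesis nu1 : nu setT = 1%E.
Variables (Y : S -> torus R) (W : S -> R).
Hypotheses (mY : measurable_fun setT Y) (mW : measurable_fun setT W).

Let weighted_delta (s : S) : hm1 R * hm1 R := (delta (Y s), W s *: delta (Y s)).

Let integrable_cst1 (c : R) : nu.-integrable setT (EFin \o (fun=> c : R)).
Proof.
apply/integrableP; split; first exact/measurable_EFinP.
by rewrite /= integral_cst// nu1 mule1 ltry.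
Qed.

Lemma integrable_pairing e : nu.-integrable setT (EFin \o W) ->
  nu.-integrable setT (EFin \o (fun s => pairing e (Y s) (W s))).
Proof.
move=> iW; have n0 := ip_norm_ge0 ip2 e; have D0 := delta_norm_ge0 R.
have iD := integrableD measurableT (integrable_cst1 1) (integrable_norm iW).
have := integrableZl measurableT (delta_norm R * ip_norm ip2 e) iD => iZ.
apply: (le_integrable measurableT _ _ iZ).
  exact/measurable_EFinP/measurable_pairing.
move=> s _ /=; rewrite lee_fin (le_trans (pairing_le _ _ _))//.
by rewrite mulrAC ler_norm.
Qed.

Lemma ip_vintegral_delta e : nu.-integrable setT (EFin \o W) ->
  ip2 e (vintegral ip2 nu setT weighted_delta) =
  \int[nu]_s pairing e (Y s) (W s).
Proof.
move=> iW; have D0 := delta_norm_ge0 R.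
rewrite (vintegralE (hm1x2_inner_product R) (@hm1x2_riesz R))//.
- by apply: eq_Rintegral => s _; rewrite hm1x2_ip_delta.
- move=> e'; have := integrable_pairing e' iW.
  by apply: eq_integrable => // s _; rewrite /= hm1x2_ip_delta.
- exists (delta_norm R * \int[nu]_s (1 + `|W s|)) => e'.
  under eq_Rintegral do rewrite hm1x2_ip_delta.
  have iD := integrableD measurableT (integrable_cst1 1) (integrable_norm iW).
  have iD' : nu.-integrable setT (EFin \o (fun s => 1 + `|W s|)) by exact: iD.
  have n0 := ip_norm_ge0 ip2 e'.
  rewrite mulrAC -RintegralZl//; apply: ae_norm_Rintegral_le.
  + exact: measurable_pairing.
  + have := integrableZl measurableT (delta_norm R * ip_norm ip2 e') iD'.
    by apply: eq_integrable => // s _; rewrite /= EFinM.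
  + by move=> s; rewrite mulr_ge0 ?mulr_ge0// addr_ge0.
  + by apply: aeW => s; rewrite mulrAC pairing_le.
Qed.

(** The test vector with the mode 0 in its second component reads off [W]; if [W] is not integrable,
    no weak integral exists and the default remains. *)
Lemma vintegral_delta_eq0 : ~ nu.-integrable setT (EFin \o W) ->
  vintegral ip2 nu setT weighted_delta = 0.
Proof.
move=> niW; apply: (@vintegral_eq0 _ _ _ _ _ _ _ _ (0, ecos R 0)).
apply: contra_not niW; apply: eq_integrable => // s _.
by rewrite /= hm1x2_ip_delta /pairing/= (ip0l (hm1_inner_product R)) ip_ecos0_delta mulr1 add0r.
Qed.

(* Valid without integrability of [W], both sides being then [0]. *)
Lemma ip_vintegral_ecos0 :
  ip2 (0, ecos R 0) (vintegral ip2 nu setT weighted_delta) =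
  vintegral (@scalar_ip R) nu setT W.
Proof.
have [iW|niW] := pselect (nu.-integrable setT (EFin \o W)).
  rewrite ip_vintegral_delta//.
  rewrite -[RHS]mul1r -[RHS]/(scalar_ip 1 _).
  rewrite (vintegralE (scalar_inner_product R) (@scalar_riesz R))//.
  - apply: eq_Rintegral => s _.
    by rewrite /pairing/= (ip0l (hm1_inner_product R)) ip_ecos0_delta mulr1 add0r /scalar_ip mul1r.
  - by move=> e; have := integrableZl measurableT e iW.
  - exists `|\int[nu]_s W s| => e.
    rewrite /scalar_ip RintegralZl// normrM mulrC ler_wpM2l//.
    by rewrite /ip_norm /scalar_ip -expr2 sqrtr_sqr.
rewrite vintegral_delta_eq0// (ip0r (hm1x2_inner_product R)).
rewrite (@vintegral_eq0 _ _ _ _ _ _ _ _ 1)//.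
apply: contra_not niW; apply: eq_integrable => // s _.
by rewrite /= /scalar_ip mul1r.
Qed.

End fixed_measure.
End weighted_delta.

(** * Averages along a kernel, with weights bounded almost everywhere *)

Section kernel_average.
Context (R : realType) d1 d2 d3 (T1 : measurableType d1) (T2 : measurableType d2)
  (T3 : measurableType d3).
Context (P1 : probability T1 R) (P2 : probability T2 R) (P3 : probability T3 R).
Variable k : R.-pker T2 ~> T3.
Variables (w : T1 * T3 -> R) (Y : T1 * T3 -> torus R) (wmax : R).
Hypotheses (mw : measurable_fun setT w) (mY : measurable_fun setT Y).
Hypotheses (wmax0 : 0 <= wmax).
Hypothesis w_le : {ae (P1 \x P3)%E, forall y, `|w y| <= wmax}.
Hypothesis kP : forall A, measurable A -> (P3 A = \int[P2]_t k t A)%E.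
Local Notation ip2 := (@hm1x2_ip R).
Implicit Types e : hm1 R * hm1 R.

(** Common form of the two halves of a gap: [T3] is the space of the integrated variable, and the
    second half is an instance after exchanging the variables. *)
Definition kernel_average (z : T1 * T2) : hm1 R * hm1 R :=
  vintegral ip2 (k z.2) setT
    (fun i => (delta (Y (z.1, i)), w (z.1, i) *: delta (Y (z.1, i)))).

Definition good_point (z : T1 * T2) :=
  {ae k z.2, forall i, `|w (z.1, i)| <= wmax}.

Lemma ae_good_point : {ae (P1 \x P2)%E, forall z, good_point z}.
Proof.
apply: (@ae_mixture _ _ _ _ _ _ _ k P1 P2 P3 kP (fun y => `|w y| <= wmax)) => //.
rewrite -[X in measurable X]setTI; apply: measurable_fun_le => //.
exact: measurableT_comp.
Qed.

Let mw_at x : measurable_fun setT (fun i => w (x, i)).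
Proof. exact: measurable_fun_pair2. Qed.

Let mY_at x : measurable_fun setT (fun i => Y (x, i)).
Proof. exact: measurable_fun_pair2. Qed.

Lemma good_point_integrable z : good_point z ->
  (k z.2).-integrable setT (EFin \o (fun i => w (z.1, i))).
Proof.
move=> gz; apply: (@ae_le_integrable _ _ _ _ _ (fun=> wmax)) => //.
apply/integrableP; split; first exact/measurable_EFinP.
by rewrite /= integral_cst// prob_kernel mule1 ltry.
Qed.

Lemma kernel_averageE e z :
  (k z.2).-integrable setT (EFin \o (fun i => w (z.1, i))) ->
  ip2 e (kernel_average z) =
  \int[k z.2]_i pairing e (Y (z.1, i)) (w (z.1, i)).
Proof.
by move=> iw; apply: ip_vintegral_delta => //; exact: prob_kernel.
Qed.

(* [kernel_average] is [0] where [w (z.1, _)] is not integrable, hence the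
   indicator of a measurable set. *)
Lemma measurable_kernel_average e :
  measurable_fun setT (fun z => ip2 e (kernel_average z)).
Proof.
pose A := [set z : T1 * T2 | (\int[k z.2]_i `|(w (z.1, i))%:E| < +oo)%E].
have mA : measurable A.
  rewrite -[A]setTI; apply: emeasurable_fun_infty_o => //.
  apply: (@measurable_kernel_integral _ _ _ _ _ _ _ k (fun y => `|(w y)%:E|%E)) => //.
  by apply: measurableT_comp => //; exact/measurable_EFinP.
have AP z : A z <-> (k z.2).-integrable setT (EFin \o (fun i => w (z.1, i))).
  split=> [Az|/integrableP[]//]; apply/integrableP; split => //.
  exact/measurable_EFinP.
rewrite (_ : (fun z => _) = (fun z => \1_A z *
    \int[k z.2]_i pairing e (Y (z.1, i)) (w (z.1, i)))).
  apply: measurable_funM; first exact: measurable_indic.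
  apply: (@measurable_kernel_Rintegral _ _ _ _ _ _ _ k (fun y => pairing e (Y y) (w y))).
  exact: measurable_pairing.
apply/funext => z; rewrite indicE; have [/set_mem/AP iw|] := boolP (z \in A).
  by rewrite mul1r kernel_averageE.
rewrite notin_setE => /AP niw; rewrite mul0r /kernel_average.
rewrite vintegral_delta_eq0// ?(ip0r (hm1x2_inner_product R))//.
Qed.

Lemma kernel_average_le e z : good_point z ->
  `|ip2 e (kernel_average z)| <= delta_norm R * (1 + wmax) * ip_norm ip2 e.
Proof.
move=> gz; rewrite kernel_averageE; last exact: good_point_integrable.
have D0 := delta_norm_ge0 R; have n0 := ip_norm_ge0 ip2 e.
set c := leRHS; have c0 : 0 <= c by rewrite /c mulr_ge0// mulr_ge0// addr_ge0.
have -> : c = \int[k z.2]_i (cst c i).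
  by rewrite Rintegral_cst// prob_kernel mulr1.
apply: ae_norm_Rintegral_le => //.
- exact: measurable_pairing.
- apply/integrableP; split; first exact/measurable_EFinP.
  by rewrite /= integral_cst// prob_kernel mule1 ltry.
- apply: filterS gz => i wi; rewrite (le_trans (pairing_le _ _ _))//.
  by rewrite /c ler_wpM2r// ler_wpM2l// lerD2l.
Qed.

Lemma kernel_average_ecos0 z : ip2 (0, ecos R 0) (kernel_average z) =
  vintegral (@scalar_ip R) (k z.2) setT (fun i => w (z.1, i)).
Proof. by apply: ip_vintegral_ecos0 => //; exact: prob_kernel. Qed.

End kernel_average.

(** * The gap of a coupling *)

Lemma torus_dist_le1 (R : realType) (x y : torus R) : torus_dist x y <= 1.
Proof.
apply: le_trans (torus_dist_le (torus_fracK (x - y))) _.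
rewrite /torus_frac; move: (repr _) => r.
have /andP[a b] := floor_itv r; move: b; rewrite rmorphD/= => b.
rewrite ler_norml; apply/andP; split; lra.
Qed.

Lemma Rintegral_snd d1 d2 (T1 : measurableType d1) (T2 : measurableType d2)
    (R : realType) (P1 : probability T1 R) (P2 : probability T2 R) (f : T2 -> R) :
  P2.-integrable setT (EFin \o f) ->
  (P1 \x P2)%E.-integrable setT (EFin \o (fun z => f z.2)) /\
  \int[(P1 \x P2)%E]_z f z.2 = \int[P2]_y f y.
Proof.
move=> iF; have i1 : P1.-integrable setT (EFin \o (fun=> 1 : R)).
  exact: finite_measure_integrable_cst.
have [+ _] := tensor_integrable i1 iF.
rewrite (_ : (fun z => _) = (fun z => f z.2)); last first.
  by apply/funext => z; rewrite mul1r.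
move=> i2; split => //.
rewrite /Rintegral -integral21_prod_meas1//; congr fine.
apply: eq_integral => y _; rewrite /fubini_G/= integral_cst//.
by rewrite [X in (_ * X)%E]probability_setT mule1.
Qed.

Lemma bounded_integrable d (S : measurableType d) (R : realType)
    (nu : {measure set S -> \bar R}) (f : S -> R) (c : R) : nu setT = 1%E ->
  measurable_fun setT f -> (forall s, `|f s| <= c) ->
  nu.-integrable setT (EFin \o f).
Proof.
move=> nu1 mf fc; have c0 : 0 <= c by apply: le_trans (fc point).
apply: (@ae_le_integrable _ _ _ _ _ (fun=> c)) => //; last exact: aeW.
apply/integrableP; split; first exact/measurable_EFinP.
by rewrite /= integral_cst// nu1 mule1 ltry.
Qed.

Lemma ae_le_Rintegral d (S : measurableType d) (R : realType)
    (nu : {measure set S -> \bar R}) (f g : S -> R) :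
  nu.-integrable setT (EFin \o f) -> nu.-integrable setT (EFin \o g) ->
  {ae nu, forall s, f s <= g s} -> \int[nu]_s f s <= \int[nu]_s g s.
Proof.
move=> iF ig fg; rewrite -subr_ge0 -RintegralB//.
have /integrableP[/measurable_EFinP mf _] := iF.
have /integrableP[/measurable_EFinP mg _] := ig.
have md : measurable_fun setT (fun s => g s - f s) by exact: measurable_funB.
rewrite (@ae_eq_Rintegral _ _ _ _ _ (fun s => Num.max (g s - f s) 0))//.
- by apply: Rintegral_ge0 => s _; rewrite le_max lexx orbT.
- by apply: measurable_maxr => //; exact: measurable_cst.
- by apply: filterS fg => s fg; rewrite max_l// subr_ge0.
Qed.

Lemma pairing_diff_le (R : realType) (e : hm1 R * hm1 R) (x y : torus R) (a : R) :
  `|pairing e x a - pairing e y a| <=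
    (1 + `|a|) * ip_norm (@hm1x2_ip R) e * ip_norm (@hm1_ip R) (delta x - delta y).
Proof.
have ipP := hm1_inner_product R.
have -> : pairing e x a - pairing e y a =
    hm1_ip e.1 (delta x - delta y) + a * hm1_ip e.2 (delta x - delta y).
  by rewrite /pairing !(ipBr ipP); ring.
have n0 := ip_norm_ge0 (@hm1_ip R) (delta x - delta y).
have h1 := le_trans (cauchy_schwarz ipP e.1 _) (ler_wpM2r n0 (ip_norm_fst e)).
have h2 := le_trans (cauchy_schwarz ipP e.2 _) (ler_wpM2r n0 (ip_norm_snd e)).
rewrite (le_trans (ler_normD _ _))// normrM !mulrDl mul1r lerD//.
by rewrite -mulrA ler_wpM2l.
Qed.

Section gap.
Context (R : realType) d1 d2 (T1 : measurableType d1) (T2 : measurableType d2).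
Context (P1 : probability T1 R) (P2 : probability T2 R).
Variables (kl : R.-pker T2 ~> T1) (kr : R.-pker T1 ~> T2).
Hypothesis klP : forall A, measurable A -> (P1 A = \int[P2]_t kl t A)%E.
Hypothesis krP : forall A, measurable A -> (P2 A = \int[P1]_t kr t A)%E.
Variables (w1 : T1 * T1 -> R) (X1 : T1 -> torus R).
Variables (w2 : T2 * T2 -> R) (X2 : T2 -> torus R) (wmax : R).
Hypotheses (mw1 : measurable_fun setT w1) (mX1 : measurable_fun setT X1).
Hypotheses (mw2 : measurable_fun setT w2) (mX2 : measurable_fun setT X2).
Hypothesis wmax0 : 0 <= wmax.
Hypothesis w1_le : {ae (P1 \x P1)%E, forall y, `|w1 y| <= wmax}.
Hypothesis w2_le : {ae (P2 \x P2)%E, forall y, `|w2 y| <= wmax}.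
Local Notation ip2 := (@hm1x2_ip R).
Local Notation mu := (P1 \x P2)%E.
Implicit Types e : hm1 R * hm1 R.

Definition vector_gap (z : T1 * T2) : hm1 R * hm1 R :=
  ker_coupling ip2 (w_kernel w1 X1) kl z - coupling_ker ip2 kr (w_kernel w2 X2) z.

Definition scalar_gap (z : T1 * T2) : R^o :=
  ker_coupling (@scalar_ip R) w1 kl z - coupling_ker (@scalar_ip R) kr w2 z.

(** The position is that of the second argument of a kernel: the integrated variable in the first
    half, the fixed one in the second half, where the arguments are exchanged. *)
Let Y1 (y : T1 * T1) : torus R := X1 y.2.
Let w2' (y : T2 * T2) : R := w2 (y.2, y.1).
Let Y2 (y : T2 * T2) : torus R := X2 y.1.

Let mY1 : measurable_fun setT Y1.
Proof. by apply: (measurableT_comp mX1); exact: measurable_snd. Qed.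

Let mY2 : measurable_fun setT Y2.
Proof. by apply: (measurableT_comp mX2); exact: measurable_fst. Qed.

Let mw2' : measurable_fun setT w2'.
Proof. by apply: (measurableT_comp mw2); exact: measurable_swap. Qed.

Let w2'_le : {ae (P2 \x P2)%E, forall y, `|w2' y| <= wmax}.
Proof. exact: (ae_swap (Q := fun y => `|w2 y| <= wmax)). Qed.

Let V1 := kernel_average kl w1 Y1.
Let V2 (z : T1 * T2) := kernel_average kr w2' Y2 (z.2, z.1).

Let vector_gapE z : vector_gap z = V1 z - V2 z.
Proof. by []. Qed.

Definition good_pair (z : T1 * T2) :=
  good_point kl w1 wmax z /\ good_point kr w2' wmax (z.2, z.1).

Lemma ae_good_pair : {ae mu, forall z, good_pair z}.
Proof.
have g1 := ae_good_point mw1 w1_le klP.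
have g2 := ae_swap (ae_good_point mw2' w2'_le krP).
by apply: filterS2 g1 g2 => z.
Qed.

Lemma measurable_vector_gap e : measurable_fun setT (fun z => ip2 e (vector_gap z)).
Proof.
under eq_fun do rewrite vector_gapE (ipBr (hm1x2_inner_product R)).
apply: measurable_funB; first exact: measurable_kernel_average.
have msw : measurable_fun setT (fun z : T1 * T2 => (z.2, z.1)) by exact: measurable_swap.
have m2 := @measurable_kernel_average _ _ _ _ T2 T1 T2 kr w2' Y2 mw2' mY2 e.
by have := measurableT_comp m2 msw; exact.
Qed.

Definition gap_bound : R := 2 * (delta_norm R * (1 + wmax)).

Lemma gap_bound_ge0 : 0 <= gap_bound.
Proof. by rewrite mulr_ge0// mulr_ge0 ?delta_norm_ge0// addr_ge0. Qed.

Lemma vector_gap_ess_bounded : ess_bounded ip2 P1 P2 vector_gap gap_bound.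
Proof.
move=> e; split; first exact: measurable_vector_gap.
apply: filterS ae_good_pair => z [g1 g2].
rewrite vector_gapE (ipBr (hm1x2_inner_product R)) (le_trans (ler_normB _ _))//.
rewrite /gap_bound mulr_natl mulr2n mulrDl.
by rewrite lerD//; exact: kernel_average_le.
Qed.

(** Holds at every point, the default values of the two weak integrals agreeing as well.
    Measurability and bounds of the scalar gap are thus inherited from the vector gap. *)
Lemma scalar_gapE z : scalar_gap z = ip2 (0, ecos R 0) (vector_gap z).
Proof.
rewrite vector_gapE (ipBr (hm1x2_inner_product R)) /V1 /V2.
by rewrite !kernel_average_ecos0.
Qed.

Let ip_norm_unit : ip_norm ip2 (0, ecos R 0) = 1.
Proof.
by rewrite -(ip_norm_ecos0 R) /ip_norm /hm1x2_ip/= (ip0l (hm1_inner_product R)) add0r.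
Qed.

Lemma scalar_gap_ip (e : R) z :
  scalar_ip e (scalar_gap z) = ip2 (e *: (0, ecos R 0)) (vector_gap z).
Proof. by rewrite scalar_gapE (ipZl (hm1x2_inner_product R)). Qed.

Let scalar_norm (e : R) : ip_norm (@scalar_ip R) e = `|e|.
Proof. by rewrite /ip_norm /scalar_ip -expr2 sqrtr_sqr. Qed.

Lemma scalar_gap_ess_bounded :
  ess_bounded (@scalar_ip R) P1 P2 scalar_gap gap_bound.
Proof.
move=> e; split.
  by under eq_fun do rewrite scalar_gap_ip; exact: measurable_vector_gap.
have [_] := vector_gap_ess_bounded (e *: (0, ecos R 0)).
apply: filterS => z; rewrite scalar_gap_ip scalar_norm => h.
by rewrite (le_trans h)// (ip_normZ (hm1x2_inner_product R)) ip_norm_unit mulr1.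
Qed.

Lemma cut_scalar_le :
  (cut_norm (@scalar_ip R) P1 P2 scalar_gap <= cut_norm ip2 P1 P2 vector_gap)%E.
Proof.
apply: (cut_norm_le (scalar_inner_product R) (@scalar_riesz R) gap_bound_ge0
  scalar_gap_ess_bounded) => e A B; rewrite scalar_norm => e1 mA mB.
have en : ip_norm ip2 (e *: (0, ecos R 0)) <= 1.
  by rewrite (ip_normZ (hm1x2_inner_product R)) ip_norm_unit mulr1.
apply: le_trans (cut_norm_ge (hm1x2_inner_product R) (@hm1x2_riesz R)
  gap_bound_ge0 vector_gap_ess_bounded en mA mB).
rewrite lee_fin (le_trans (ler_norm _))// le_eqVlt; apply/orP; left; apply/eqP.
by congr `|_|; apply: eq_Rintegral => z _; rewrite -scalar_gap_ip.
Qed.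

Lemma vector_gap_at e z : good_pair z ->
  ip2 e (vector_gap z) = \int[kl z.2]_i pairing e (X1 i) (w1 (z.1, i)) -
    \int[kr z.1]_i pairing e (X2 z.2) (w2 (i, z.2)).
Proof.
move=> [g1 g2]; rewrite vector_gapE (ipBr (hm1x2_inner_product R)).
rewrite !kernel_averageE//; [exact: (good_point_integrable mw2' wmax0 g2)|].
exact: (good_point_integrable mw1 wmax0 g1).
Qed.

Lemma scalar_gap_at z : good_pair z ->
  scalar_gap z = \int[kl z.2]_i w1 (z.1, i) - \int[kr z.1]_i w2 (i, z.2).
Proof.
move=> gz; rewrite scalar_gapE vector_gap_at//.
have E x a : pairing (0, ecos R 0) x a = a.
  by rewrite /pairing/= (ip0l (hm1_inner_product R)) ip_ecos0_delta mulr1 add0r.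
by congr (_ - _); apply: eq_Rintegral => i _; rewrite E.
Qed.

Let measurable_dist_at t : measurable_fun setT (fun i => torus_dist (X1 i) (X2 t)).
Proof. by apply: measurable_torus_dist => //; exact: measurable_cst. Qed.

Let dist_norm (x y : torus R) : `|torus_dist x y| <= 1.
Proof. by rewrite ger0_norm ?torus_dist_ge0 ?torus_dist_le1. Qed.

Let integrable_dist_at t :
  (kl t).-integrable setT (EFin \o (fun i => torus_dist (X1 i) (X2 t))).
Proof. by apply: (@bounded_integrable _ _ _ _ _ 1) => //; exact: prob_kernel. Qed.

(** The conditional mean of the distance given the second point. *)
Definition average_dist (t : T2) : R := \int[kl t]_i torus_dist (X1 i) (X2 t).

Definition mean_dist : R := \int[P2]_t average_dist t.

Lemma average_dist_ge0 t : 0 <= average_dist t.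
Proof. by apply: Rintegral_ge0 => i _; exact: torus_dist_ge0. Qed.

Lemma average_dist_le1 t : average_dist t <= 1.
Proof.
have -> : 1 = \int[kl t]_i (cst 1 i) :> R.
  by rewrite Rintegral_cst// prob_kernel mulr1.
apply: le_Rintegral => //; last by move=> i _; exact: torus_dist_le1.
by apply: (@bounded_integrable _ _ _ _ _ 1); [exact: prob_kernel|exact: measurable_cst|
  move=> i; rewrite normr1].
Qed.

Lemma measurable_average_dist : measurable_fun setT average_dist.
Proof.
pose K (y : T2 * T1) := torus_dist (X1 y.2) (X2 y.1).
have mK : measurable_fun setT K.
  apply: measurable_torus_dist; first by apply: (measurableT_comp mX1); exact: measurable_snd.
  by apply: (measurableT_comp mX2); exact: measurable_fst.
have mD := @measurable_kernel_Rintegral _ _ _ T2 _ _ _ kl _ mK.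
have mdiag : measurable_fun setT (fun t : T2 => (t, t)).
  by apply: measurable_fun_pair; exact: measurable_id.
by have := measurableT_comp mD mdiag; exact.
Qed.

Lemma integrable_average_dist : P2.-integrable setT (EFin \o average_dist).
Proof.
apply: (@bounded_integrable _ _ _ _ _ 1); first exact: probability_setT.
  exact: measurable_average_dist.
by move=> t; rewrite ger0_norm ?average_dist_ge0 ?average_dist_le1.
Qed.

(* If all positions were equal to [X2 z.2], the vector gap tested against [e]
   would be [<e.2, delta (X2 z.2)>] times the scalar gap. *)
Lemma vector_gap_remainder (eta C : R) e z : 0 <= eta -> 0 <= C ->
  (forall x y : torus R, ip_norm (@hm1_ip R) (delta x - delta y) <=
    eta + C * torus_dist x y) ->
  good_pair z ->
  `|ip2 e (vector_gap z) - hm1_ip e.2 (delta (X2 z.2)) * scalar_gap z| <=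
    (1 + wmax) * ip_norm ip2 e * (eta + C * average_dist z.2).
Proof.
move=> eta0 C0 etaC gz; have n0 := ip_norm_ge0 ip2 e.
rewrite scalar_gap_at// vector_gap_at//; case: gz => g1 g2.
have iw1 := good_point_integrable mw1 wmax0 g1.
have iw2 := good_point_integrable mw2' wmax0 g2.
set y := X2 z.2; set a1 := \int[kl z.2]_i w1 (z.1, i).
set a2 := \int[kr z.1]_i w2 (i, z.2).
have lin d (S : measurableType d) (nu : {measure set S -> \bar R}) (W : S -> R) :
    nu setT = 1%E -> nu.-integrable setT (EFin \o W) ->
    nu.-integrable setT (EFin \o (fun i => pairing e y (W i))) /\
    \int[nu]_i pairing e y (W i) = pairing e y (\int[nu]_i W i).
  move=> nu1 iW.
  have i1 : nu.-integrable setT (EFin \o cst (hm1_ip e.1 (delta y))).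
    apply: (@bounded_integrable _ _ _ _ _ `|hm1_ip e.1 (delta y)|) => //.
  have i2 : nu.-integrable setT (EFin \o (fun i => W i * hm1_ip e.2 (delta y))).
    have := integrableZr measurableT (hm1_ip e.2 (delta y)) iW.
    by apply: eq_integrable => // i _; rewrite /= EFinM.
  split; first by have := integrableD measurableT i1 i2.
  rewrite /pairing (RintegralD measurableT i1 i2) Rintegral_cst// nu1 mulr1.
  by rewrite RintegralZr.
have [ip1 ip1E] := lin _ _ (kl z.2) _ (prob_kernel _) iw1.
have [_ ip2E] := lin _ _ (kr z.1) _ (prob_kernel _) iw2.
have iX1 : (kl z.2).-integrable setT (EFin \o (fun i => pairing e (X1 i) (w1 (z.1, i)))).
  apply: integrable_pairing => //; [exact: prob_kernel|exact: measurable_fun_pair2].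
have -> : \int[kr z.1]_i pairing e y (w2 (i, z.2)) = pairing e y a2 by exact: ip2E.
(* The second half already sits at [y]. Moving the first half there too leaves [a1 - a2] times the
   pairing with [delta y], at the cost of the integral on the right. *)
have -> : \int[kl z.2]_i pairing e (X1 i) (w1 (z.1, i)) - pairing e y a2 -
    hm1_ip e.2 (delta y) * (a1 - a2) =
    \int[kl z.2]_i (pairing e (X1 i) (w1 (z.1, i)) - pairing e y (w1 (z.1, i))).
  by rewrite (RintegralB measurableT iX1 ip1) ip1E /pairing -/a1; ring.
have id := integrable_dist_at z.2.
have iCd : (kl z.2).-integrable setT (EFin \o (fun i => C * torus_dist (X1 i) y)).
  by have := integrableZl measurableT C id; apply: eq_integrable => // i _; rewrite /= EFinM.
have ieta : (kl z.2).-integrable setT (EFin \o cst eta).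
  by apply: (@bounded_integrable _ _ _ _ _ `|eta|) => //; exact: prob_kernel.
have isum : (kl z.2).-integrable setT (EFin \o (fun i => eta + C * torus_dist (X1 i) y)).
  by have := integrableD measurableT ieta iCd.
have c0 : 0 <= (1 + wmax) * ip_norm ip2 e by rewrite mulr_ge0// addr_ge0.
have s0 i : 0 <= eta + C * torus_dist (X1 i) y.
  by rewrite addr_ge0// mulr_ge0// torus_dist_ge0.
have -> : eta + C * average_dist z.2 = \int[kl z.2]_i (eta + C * torus_dist (X1 i) y).
  rewrite (RintegralD measurableT ieta iCd) Rintegral_cst// prob_kernel mulr1.
  by rewrite (RintegralZl _ measurableT id).
rewrite -RintegralZl//; apply: ae_norm_Rintegral_le.
- have /integrableP[/measurable_EFinP m1 _] := iX1.
  have /integrableP[/measurable_EFinP m2 _] := ip1.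
  exact: measurable_funB.
- have := integrableZl measurableT ((1 + wmax) * ip_norm ip2 e) isum.
  by apply: eq_integrable => // i _; rewrite /= EFinM.
- by move=> i; rewrite mulr_ge0.
- apply: filterS g1 => i wi; rewrite (le_trans (pairing_diff_le _ _ _ _))//.
  rewrite ler_pM ?ip_norm_ge0//; first by rewrite mulr_ge0// addr_ge0.
  by rewrite ler_wpM2r// lerD2l.
Qed.

Let scalar_ip1 : (fun z => scalar_ip (1 : R^o) (scalar_gap z)) = (scalar_gap : _ -> R).
Proof. by apply/funext => z; rewrite /scalar_ip mul1r. Qed.

Let measurable_scalar_gap : measurable_fun setT (scalar_gap : _ -> R).
Proof. by have [+ _] := scalar_gap_ess_bounded 1; rewrite scalar_ip1. Qed.

Let scalar_gap_le : {ae mu, forall z, `|scalar_gap z : R| <= gap_bound}.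
Proof.
have [_] := scalar_gap_ess_bounded 1; apply: filterS => z.
by rewrite scalar_norm normr1 mulr1 /scalar_ip mul1r.
Qed.

(** The factor [phi] depends on the second variable alone, so the main term is a bilinear integral
    of the scalar gap with test functions [\1_A] and [\1_B * phi]; only the remainder involves the
    distance. *)
Lemma cut_vector_le (eta C : R) : 0 <= eta -> 0 <= C ->
  (forall x y : torus R, ip_norm (@hm1_ip R) (delta x - delta y) <=
    eta + C * torus_dist x y) ->
  (cut_norm ip2 P1 P2 vector_gap <=
    ((1 + wmax) * (eta + C * mean_dist))%:E +
    (4 * (delta_norm R + 1))%:E * cut_norm (@scalar_ip R) P1 P2 scalar_gap)%E.
Proof.
move=> eta0 C0 etaC; have D0 := delta_norm_ge0 R.
have K0 : 0 < delta_norm R + 1 by rewrite ltr_wpDl.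
apply: (cut_norm_le (hm1x2_inner_product R) (@hm1x2_riesz R)
  gap_bound_ge0 vector_gap_ess_bounded) => e A B e1 mA mB.
case sE : (cut_norm (@scalar_ip R) P1 P2 scalar_gap) => [c||]; last 2 first.
- by rewrite gt0_muley ?addey ?leey// lte_fin mulr_gt0.
- by have := cut_norm_ge0 (scalar_inner_product R) P1 P2 scalar_gap; rewrite sE.
rewrite -EFinM -EFinD lee_fin.
pose phi t := hm1_ip e.2 (delta (X2 t)).
have mphi : measurable_fun setT phi.
  exact: measurableT_comp (measurable_ip_delta _) mX2.
have phi_le t : `|phi t| <= delta_norm R + 1.
  rewrite (le_trans (ip_delta_le _ _))// (@le_trans _ _ (delta_norm R))// ?lerDl//.
  by rewrite ler_piMr// (le_trans (ip_norm_snd e)).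
have [mg gU] := vector_gap_ess_bounded e.
have ig := ess_bounded_integrable gap_bound_ge0 vector_gap_ess_bounded e.
have is_ := kernel_integrable measurable_scalar_gap gap_bound_ge0 scalar_gap_le.
have ind1 d (T : measurableType d) (E : set T) x : `|\1_E x : R| <= 1.
  by rewrite indicE; case: (x \in E); rewrite ?normr1 ?normr0.
have miA : measurable_fun setT (\1_A : T1 -> R) by exact: measurable_indic.
have miB : measurable_fun setT (\1_B : T2 -> R) by exact: measurable_indic.
have miA' := @measurable_fst_comp _ _ T1 T2 R _ miA.
have miB' := @measurable_snd_comp _ _ T1 T2 R _ miB.
have mphi' := @measurable_snd_comp _ _ T1 T2 R _ mphi.
have mAB : measurable_fun setT (fun z : T1 * T2 => \1_A z.1 * \1_B z.2 : R).
  exact: measurable_funM.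
have AB1 (z : T1 * T2) : `|\1_A z.1 * \1_B z.2 : R| <= 1.
  by rewrite normrM mulr_ile1 ?ind1.
(* Normalised to modulus at most 1 for [sign_bound]; the added 1 avoids a division by zero. *)
pose g t := \1_B t * ((delta_norm R + 1)^-1 * phi t).
have mg' : measurable_fun setT g.
  by apply: measurable_funM => //; apply: measurable_funM.
have g1 t : `|g t| <= 1.
  rewrite /g normrM mulr_ile1 ?ind1// normrM normfV (gtr0_norm K0).
  by rewrite ler_pdivrMl// mulr1.
have iAg : mu.-integrable setT
    (EFin \o (fun z => \1_A z.1 * g z.2 * (scalar_gap z : R))).
  apply: unit_mul_integrable => //.
    by apply: measurable_funM => //; exact: measurable_snd_comp.
  by move=> z; rewrite normrM mulr_ile1 ?ind1 ?g1.
have second : `|weighted_integral P1 P2 \1_A g (scalar_gap : _ -> R)| <= 4 * c.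
  apply: sign_bound => // [A' B' mA' mB'|x]; last exact: ind1.
  have := cut_norm_ge (scalar_inner_product R) (@scalar_riesz R) gap_bound_ge0
    scalar_gap_ess_bounded (e := 1) _ mA' mB'.
  by rewrite scalar_norm normr1 sE scalar_ip1 lee_fin; exact.
pose D z := ip2 e (vector_gap z) - phi z.2 * scalar_gap z.
have mD : measurable_fun setT D.
  by apply: measurable_funB => //; exact: measurable_funM.
(* The remainder is dominated by a function of the second variable alone, whose integral is given by
   [mean_dist]. *)
pose h t := (1 + wmax) * (eta + C * average_dist t).
have h0 t : 0 <= h t.
  by rewrite mulr_ge0 ?addr_ge0// mulr_ge0// average_dist_ge0.
have ih1 : P2.-integrable setT (EFin \o (fun t => eta + C * average_dist t)).
  have i1 : P2.-integrable setT (EFin \o cst eta).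
    exact: finite_measure_integrable_cst.
  have i2 := integrableZl measurableT C integrable_average_dist.
  by have := integrableD measurableT i1 i2.
have ih : P2.-integrable setT (EFin \o h).
  by have := integrableZl measurableT (1 + wmax) ih1.
have hE : \int[P2]_t h t = (1 + wmax) * (eta + C * mean_dist).
  rewrite /h RintegralZl//; congr (_ * _).
  have i1 : P2.-integrable setT (EFin \o cst eta).
    exact: finite_measure_integrable_cst.
  have i2 : P2.-integrable setT (EFin \o (fun t => C * average_dist t)).
    by have := integrableZl measurableT C integrable_average_dist.
  have P21 : fine (P2 setT) = 1 by rewrite probability_setT.
  rewrite (RintegralD measurableT i1 i2) Rintegral_cst// P21 mulr1.
  by rewrite RintegralZl//; exact: integrable_average_dist.
have [ihs hs] := Rintegral_snd P1 ih.
have Dh : {ae mu, forall z, `|\1_A z.1 * \1_B z.2 * D z| <= h z.2}.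
  apply: filterS ae_good_pair => z gz.
  have := vector_gap_remainder e eta0 C0 etaC gz; rewrite -/(phi _) -/(D z) => hD.
  rewrite normrM (le_trans (ler_piMl (normr_ge0 _) (AB1 z)))// (le_trans hD)//.
  rewrite /h -mulrA ler_wpM2l ?addr_ge0// ler_piMl// addr_ge0// mulr_ge0//.
  exact: average_dist_ge0.
have mABD : measurable_fun setT (fun z => \1_A z.1 * \1_B z.2 * D z).
  exact: measurable_funM.
have h0' (z : T1 * T2) : 0 <= h z.2 by [].
have first_ := ae_norm_Rintegral_le mABD ihs h0' Dh.
have iABD := ae_le_integrable mABD ihs h0' Dh.
have iKAg := integrableZl measurableT (delta_norm R + 1) iAg.
have -> : weighted_integral P1 P2 \1_A \1_B (fun z => ip2 e (vector_gap z)) =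
    \int[mu]_z (\1_A z.1 * \1_B z.2 * D z) +
    (delta_norm R + 1) * weighted_integral P1 P2 \1_A g (scalar_gap : _ -> R).
  rewrite /weighted_integral -(RintegralZl _ measurableT iAg).
  rewrite -(RintegralD measurableT iABD); last first.
    by apply: eq_integrable iKAg => // z _; rewrite /= EFinM.
  apply: eq_Rintegral => z _; rewrite /D /g.
  by field; rewrite gt_eqF.
rewrite (le_trans (ler_norm _))// (le_trans (ler_normD _ _))// lerD//.
  by rewrite (le_trans first_)// hs hE.
rewrite normrM (gtr0_norm K0) (_ : 4 * _ * c = (delta_norm R + 1) * (4 * c)).
  by rewrite ler_pM2l.
by ring.
Qed.

(** Rescaling [e] into the unit ball costs [ip_norm e + 1], and passing from indicators to bounded
    functions costs 4. *)
Lemma weighted_vector_gap_le e (c : R) (f : T1 -> R) (g : T2 -> R) :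
  (cut_norm ip2 P1 P2 vector_gap <= c%:E)%E ->
  measurable_fun setT f -> measurable_fun setT g ->
  (forall x, `|f x| <= 1) -> (forall x, `|g x| <= 1) ->
  mu.-integrable setT (EFin \o (fun z => f z.1 * g z.2 * ip2 e (vector_gap z))) /\
  `|weighted_integral P1 P2 f g (fun z => ip2 e (vector_gap z))| <=
    4 * ((ip_norm ip2 e + 1) * c).
Proof.
move=> cutc mf mg f1 g1.
have ig := ess_bounded_integrable gap_bound_ge0 vector_gap_ess_bounded e.
have n0 := ip_norm_ge0 ip2 e.
have n1 : 0 < ip_norm ip2 e + 1 by rewrite ltr_wpDl.
split.
  have hfg (z : T1 * T2) : `|f z.1 * g z.2| <= 1 by rewrite normrM mulr_ile1.
  apply: (@unit_mul_integrable _ _ _ _ _ _ _ (fun z => f z.1 * g z.2) _) => //.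
  by apply: measurable_funM; [exact: measurable_fst_comp|exact: measurable_snd_comp].
apply: sign_bound => // A B mA mB.
pose e' := (ip_norm ip2 e + 1)^-1 *: e.
have e'1 : ip_norm ip2 e' <= 1.
  rewrite (ip_normZ (hm1x2_inner_product R)) normfV (gtr0_norm n1).
  by rewrite ler_pdivrMl// mulr1 lerDl.
have h := cut_norm_ge (hm1x2_inner_product R) (@hm1x2_riesz R)
  gap_bound_ge0 vector_gap_ess_bounded e'1 mA mB.
have := le_trans h cutc; rewrite lee_fin => {}h.
have [iAB _] := weighted_integrable (measurable_vector_gap e)
  (mulr_ge0 gap_bound_ge0 n0) (vector_gap_ess_bounded e).2
  (integrable_indic P1 mA) (integrable_indic P2 mB).
rewrite (_ : weighted_integral _ _ _ _ _ = (ip_norm ip2 e + 1) *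
    weighted_integral P1 P2 \1_A \1_B (fun z => ip2 e' (vector_gap z))).
  by rewrite normrM (gtr0_norm n1) ler_pM2l.
have iAB' := integrableZl measurableT (ip_norm ip2 e + 1)^-1 iAB.
rewrite /weighted_integral -RintegralZl//.
  apply: eq_Rintegral => z _; rewrite (ipZl (hm1x2_inner_product R)).
  by field; rewrite gt_eqF.
apply: eq_integrable iAB' => // z _; rewrite /= -EFinM; congr EFin.
by rewrite (ipZl (hm1x2_inner_product R)); ring.
Qed.

(** The costs of [weighted_vector_gap_le] for the cosine and the sine of mode 1, divided by the
    factor that these vectors produce when paired with a Dirac mass. *)
Definition mode_constant : R := (basis_weight R 1)^-1 *
  (4 * (ip_norm ip2 (ecos R 1, 0) + 1) + 4 * (ip_norm ip2 (esin R 1, 0) + 1)).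

Lemma mode_constant_gt0 : 0 < mode_constant.
Proof.
have b0 := basis_weight_gt0 R 1.
have n0 := ip_norm_ge0 ip2; rewrite /mode_constant mulr_gt0 ?invr_gt0//.
by rewrite addr_gt0// mulr_gt0// ltr_wpDl.
Qed.

(* Since [1 = cos^2 + sin^2], the quantity [1 - cos (2 pi (X1 - X2))] averaged
   over the kernel only involves the gap tested against the modes [+-1]. *)
Lemma mean_dist_le (eta C c : R) : 0 <= C ->
  (forall x y : torus R, torus_dist x y <= eta + C *
   (1 - (complex.Re (torus_char 1 x) * complex.Re (torus_char 1 y) +
         complex.Im (torus_char 1 x) * complex.Im (torus_char 1 y)))) ->
  (cut_norm ip2 P1 P2 vector_gap <= c%:E)%E ->
  mean_dist <= eta + C * (mode_constant * c).
Proof.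
move=> C0 etaC cutc.
pose co (x : torus R) := complex.Re (torus_char 1 x).
pose si (x : torus R) := complex.Im (torus_char 1 x).
have mco : measurable_fun setT co by exact: measurable_Re_torus_char.
have msi : measurable_fun setT si by exact: measurable_Im_torus_char.
have co1 x : `|co x| <= 1 by exact: norm_Re_torus_char.
have si1 x : `|si x| <= 1 by exact: norm_Im_torus_char.
have cs1 x : co x ^+ 2 + si x ^+ 2 = 1 by rewrite /co /si /torus_char/= cos2Dsin2.
pose b := basis_weight R 1; have b0 : 0 < b by exact: basis_weight_gt0.
pose gc z := ip2 (ecos R 1, 0) (vector_gap z).
pose gs z := ip2 (esin R 1, 0) (vector_gap z).
have mco2 : measurable_fun setT (co \o X2) by exact: measurableT_comp.
have msi2 : measurable_fun setT (si \o X2) by exact: measurableT_comp.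
have n1 (x : T1) : `|(fun=> 1) x : R| <= 1 by rewrite normr1.
have m1 : measurable_fun setT (fun _ : T1 => 1 : R) by exact: measurable_cst.
have [igc hgc] := weighted_vector_gap_le (ecos R 1, 0) cutc m1 mco2 n1
  (fun t => co1 (X2 t)).
have [igs hgs] := weighted_vector_gap_le (esin R 1, 0) cutc m1 msi2 n1
  (fun t => si1 (X2 t)).
have iZ (g : T1 * T2 -> R) (a : R) : mu.-integrable setT (EFin \o g) ->
    mu.-integrable setT (EFin \o (fun z => a * g z)).
  move=> ig; have := integrableZl measurableT a ig.
  by apply: eq_integrable => // z _; rewrite /= EFinM.
(* The signs differ because [ecos 1] pairs with a Dirac mass to [b cos], and [esin 1] to
   [- b sin]. *)
have iCc := iZ _ (- (C / b)) igc; have iCs := iZ _ (C / b) igs.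
have ieta : mu.-integrable setT (EFin \o cst eta).
  apply: (@bounded_integrable _ _ _ _ _ `|eta|) => //.
  exact: product_probability_setT.
have iD : mu.-integrable setT (EFin \o (fun z =>
    - (C / b) * (1 * (co \o X2) z.2 * ip2 (ecos R 1, 0) (vector_gap z)) +
    C / b * (1 * (si \o X2) z.2 * ip2 (esin R 1, 0) (vector_gap z)))).
  by have := integrableD measurableT iCc iCs.
have [imd imdE] := Rintegral_snd P1 integrable_average_dist.
rewrite /mean_dist -imdE.
apply: (@le_trans _ _ (\int[mu]_z (cst eta z +
   (- (C / b) * (1 * (co \o X2) z.2 * ip2 (ecos R 1, 0) (vector_gap z)) +
    C / b * (1 * (si \o X2) z.2 * ip2 (esin R 1, 0) (vector_gap z)))))).
  apply: ae_le_Rintegral => //; first by have := integrableD measurableT ieta iD.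
  apply: filterS ae_good_pair => z gz.
  rewrite !(vector_gap_at _ gz) /cst /comp.
  have kint (f : torus R -> R) : measurable_fun setT f -> (forall x, `|f x| <= 1) ->
      (kl z.2).-integrable setT (EFin \o (fun i => f (X1 i))).
    move=> mf f1; apply: (@bounded_integrable _ _ _ _ _ 1) => //.
      exact: prob_kernel.
    exact: measurableT_comp mf mX1.
  have pcE x a : pairing (ecos R 1, 0) x a = b * co x.
    by rewrite /pairing/= (ip0l (hm1_inner_product R)) mulr0 addr0 ip_ecos_delta.
  have psE x a : pairing (esin R 1, 0) x a = - b * si x.
    rewrite /pairing/= (ip0l (hm1_inner_product R)) mulr0 addr0 ip_esin_delta.
    by rewrite mul1r mulrN mulNr.
  have E1 : \int[kl z.2]_i pairing (ecos R 1, 0) (X1 i) (w1 (z.1, i)) =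
      b * \int[kl z.2]_i co (X1 i).
    rewrite -(RintegralZl b measurableT (kint _ mco co1)).
    by apply: eq_Rintegral => i _; rewrite pcE.
  have E2 : \int[kl z.2]_i pairing (esin R 1, 0) (X1 i) (w1 (z.1, i)) =
      - b * \int[kl z.2]_i si (X1 i).
    rewrite -(RintegralZl (- b) measurableT (kint _ msi si1)).
    by apply: eq_Rintegral => i _; rewrite psE.
  have E3 : \int[kr z.1]_i pairing (ecos R 1, 0) (X2 z.2) (w2 (i, z.2)) =
      b * co (X2 z.2).
    under eq_Rintegral do rewrite pcE.
    by rewrite Rintegral_cst// prob_kernel mulr1.
  have E4 : \int[kr z.1]_i pairing (esin R 1, 0) (X2 z.2) (w2 (i, z.2)) =
      - b * si (X2 z.2).
    under eq_Rintegral do rewrite psE.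
    by rewrite Rintegral_cst// prob_kernel mulr1.
  rewrite E1 E2 E3 E4.
  set y := X2 z.2; set Ic := \int[kl z.2]_i co (X1 i).
  set Is := \int[kl z.2]_i si (X1 i).
  have bn0 : b != 0 by rewrite gt_eqF.
  (* Against the two modes the gap equals [b (Ic - co y)] and [b (si y - Is)]; multiplied by [co y]
     and [si y], they combine through [cs1]. *)
  apply: (@le_trans _ _ (eta + C * (1 - (Ic * co y + Is * si y)))); last first.
    rewrite le_eqVlt; apply/orP; left; apply/eqP; rewrite -[X in C * (X - _)](cs1 y).
    by field.
  have ic := kint _ mco co1; have is_ := kint _ msi si1.
  have kst (a : R) : (kl z.2).-integrable setT (EFin \o cst a).
    by apply: (@bounded_integrable _ _ _ _ _ `|a|) => //; exact: prob_kernel.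
  have zi (a : R) (h : T1 -> R) : (kl z.2).-integrable setT (EFin \o h) ->
      (kl z.2).-integrable setT (EFin \o (fun i => a * h i)).
    move=> ih; have := integrableZl measurableT a ih.
    by apply: eq_integrable => // i _; rewrite /= EFinM.
  have icy := zi (- (C * co y)) _ ic; have isy := zi (- (C * si y)) _ is_.
  have isum : (kl z.2).-integrable setT (EFin \o (fun i =>
      - (C * co y) * co (X1 i) + - (C * si y) * si (X1 i))).
    by have := integrableD measurableT icy isy.
  have -> : eta + C * (1 - (Ic * co y + Is * si y)) =
      \int[kl z.2]_i (cst (eta + C) i +
         (- (C * co y) * co (X1 i) + - (C * si y) * si (X1 i))).
    rewrite (RintegralD measurableT (kst _) isum) (RintegralD measurableT icy isy).
    rewrite (RintegralZl _ measurableT ic) (RintegralZl _ measurableT is_).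
    by rewrite Rintegral_cst// prob_kernel mulr1 -/Ic -/Is; ring.
  apply: le_Rintegral => //; first by have := integrableD measurableT (kst (eta + C)) isum.
  move=> i _; rewrite (le_trans (etaC _ _))// -/(co _) -/(si _) -/(co _) -/(si _) -/y.
  by rewrite /cst le_eqVlt; apply/orP; left; apply/eqP; ring.
rewrite (RintegralD measurableT ieta iD) (RintegralD measurableT iCc iCs).
rewrite (RintegralZl _ measurableT igc) (RintegralZl _ measurableT igs).
rewrite Rintegral_cst// [fine _](_ : _ = 1); last first.
  by rewrite -[RHS]/(fine 1%E); congr fine; exact: product_probability_setT.
rewrite mulr1 lerD2l -/(weighted_integral P1 P2 (fun=> 1) (co \o X2) _).
rewrite -/(weighted_integral P1 P2 (fun=> 1) (si \o X2) _).
have := ler_norm (- weighted_integral P1 P2 (fun=> 1) (co \o X2)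
  (fun z => ip2 (ecos R 1, 0) (vector_gap z))).
rewrite normrN => h1; have {h1}hgc := le_trans h1 hgc.
have {}hgs := le_trans (ler_norm _) hgs.
rewrite mulNr -mulrN -mulrDr /mode_constant -/b -!mulrA ler_wpM2l//.
rewrite ler_pM2l ?invr_gt0// mulrDl -!mulrA lerD//.
Qed.

(** A general [tau] covers both disintegrations of a coupling: the swap for one of them, the
    identity for the other. *)
Lemma mean_dist_disintegrated d (Z : measurableType d)
    (g : {measure set Z -> \bar R}) (tau : T2 * T1 -> Z) (h : Z -> R) :
  measurable_fun setT tau -> measurable_fun setT h -> (forall z, 0 <= h z) ->
  (forall t s, h (tau (t, s)) = torus_dist (X1 s) (X2 t)) ->
  (forall C, measurable C -> g C = \int[P2]_t kl t [set s | C (tau (t, s))])%E ->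
  (\int[g]_z (h z)%:E = mean_dist%:E)%E.
Proof.
move=> mtau mh h0 hE gE.
rewrite (integral_disintegrated mtau gE); last 2 first.
- exact/measurable_EFinP.
- by move=> z; rewrite lee_fin.
rewrite fineK; last by apply: integrable_fin_num => //; exact: integrable_average_dist.
apply: eq_integral => t _; rewrite fineK.
  by apply: eq_integral => s _; rewrite hE.
by apply: integrable_fin_num => //; exact: integrable_dist_at.
Qed.

End gap.

(** * Transfer of the Cauchy property *)

Section asymptotically_cauchy.
Context (R : realType).
Implicit Types D : nat -> nat -> \bar R.

Lemma asymptotically_cauchyP D : (forall n m, (0 <= D n m)%E) ->
  asymptotically_cauchy D <->
  (forall e : R, 0 < e -> exists N, forall n m, (N <= n)%N -> (N <= m)%N ->
    (D n m <= e%:E)%E).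
Proof.
move=> D0.
pose s n := ereal_sup [set D n1 n2 | n1 in [set k | (n <= k)%N] & n2 in [set k | (n <= k)%N]].
have s0 n : (0 <= s n)%E.
  by apply: le_trans (D0 n n) _; apply: ereal_sup_ubound; exists n => //=; exists n => /=.
split=> [Dc e e0|h].
  have U : nbhs (0%E : \bar R) [set x | (x < e%:E)%E].
    by apply: open_nbhs_nbhs; split; [exact: open_ereal_lt_ereal|rewrite /= lte_fin].
  have [N _ NP] : \forall n \near \oo, (s n < e%:E)%E := Dc _ U.
  exists N => n m Nn Nm; apply: le_trans (ltW (NP N (leqnn N))).
  by apply: ereal_sup_ubound; exists n => //=; exists m.
have near_le e : 0 < e -> \forall n \near \oo, (s n <= e%:E)%E.
  move=> /h[N NP]; exists N => // n /= Nn.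
  apply: ge_ereal_sup => _ [n1 /= n1n [n2 /= n2n <-]].
  by apply: NP; [exact: leq_trans n1n|exact: leq_trans n2n].
apply/fine_cvgP; split.
  apply: filterS (near_le 1 ltr01) => n sn.
  by rewrite ge0_fin_numE ?(le_lt_trans sn (ltry _))//; exact: s0.
apply/cvgrPdist_le => e e0; apply: filterS (near_le e e0) => n sn.
have sf : s n \is a fin_num by rewrite ge0_fin_numE// (le_lt_trans sn (ltry _)).
rewrite sub0r normrN ger0_norm ?fine_ge0//.
  by rewrite -lee_fin fineK.
exact: s0.
Qed.

(** The sets may contain [+oo], but a near minimiser is finite; the comparison is therefore only
    asked of finite [r]. *)
Lemma asymptotically_cauchy_transfer (S S' : nat -> nat -> set (\bar R)) :
  (forall n m r, S n m r -> (0 <= r)%E) ->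
  (forall n m r, S' n m r -> (0 <= r)%E) ->
  (forall e : R, 0 < e -> exists2 C : R, 0 < C &
    forall n m r, S n m r%:E ->
    exists2 r', S' n m r' & (r' <= (e + C * r)%:E)%E) ->
  asymptotically_cauchy (fun n m => ereal_inf (S n m)) ->
  asymptotically_cauchy (fun n m => ereal_inf (S' n m)).
Proof.
move=> S0 S'0 h.
have inf0 (A : nat -> nat -> set (\bar R)) n m : (forall n m r, A n m r -> (0 <= r)%E) ->
    (0 <= ereal_inf (A n m))%E.
  by move=> A0; apply: le_ereal_inf_tmp => r /A0.
move=> /(asymptotically_cauchyP (fun n m => inf0 S n m S0)) SC.
apply/(asymptotically_cauchyP (fun n m => inf0 S' n m S'0)) => e e0.
have e20 : 0 < e / 2 by rewrite divr_gt0.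
have [C C0 CP] := h _ e20.
(* Halved once more, since extracting an element below [e / 2 / C] needs an infimum strictly
   smaller. *)
have [|N NP] := SC (e / 2 / C / 2); first by rewrite !divr_gt0.
exists N => n m Nn Nm.
have /ereal_inf_lt[r Sr rlt] : (ereal_inf (S n m) < (e / 2 / C)%:E)%E.
  apply: le_lt_trans (NP _ _ Nn Nm) _; rewrite lte_fin ltr_pdivrMr//.
  by rewrite ltr_pMr ?divr_gt0// ltr1n.
case: r Sr rlt => [r||] Sr rlt; last 2 first.
- by move: rlt.
- by have := S0 _ _ _ Sr.
have [r' S'r' r'le] := CP _ _ _ Sr.
apply: le_trans (ereal_inf_lbound S'r') _; apply: le_trans r'le _.
rewrite lee_fin; move: rlt; rewrite lte_fin ltr_pdivlMr// => rlt.
by rewrite [leRHS](splitr e) lerD2l mulrC ltW.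
Qed.

End asymptotically_cauchy.

Lemma adde_fin (R : realType) (x y : \bar R) (r : R) : (0 <= x)%E -> (0 <= y)%E ->
  (x + y)%E = r%:E -> exists a b : R,
  [/\ 0 <= a, 0 <= b, x = a%:E, y = b%:E & r = a + b].
Proof.
case: x y => [x||] [y||]//; rewrite !lee_fin => x0 y0 [xy].
by exists x, y; split.
Qed.

Lemma Lnorm_ae_le d (T : measurableType d) (R : realType) (P : probability T R)
    (w : T * T -> R) (c : R) : ('N[(P \x P)%E]_+oo[EFin \o w] <= c%:E)%E ->
  0 <= c /\ {ae (P \x P)%E, forall y, `|w y| <= c}.
Proof.
move=> wc; split.
  by rewrite -lee_fin; apply: le_trans wc; exact: Lnorm_ge0.
move: wc; rewrite Lnorm.unlock /= ifT; last first.
  rewrite (_ : (P \x P)%E _ = 1%E) ?lte01//; exact: product_probability_setT.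
by move=> /ess_supP; apply: filterS => y; rewrite /= lee_fin.
Qed.

Lemma pq_gap_le (R : realType) (V : lmodType R) (ip : V -> V -> R)
    (ipP : inner_product ip) (ipR : riesz ip) (p q : \bar R) (U eps : R) :
  (1 < p)%E -> (1 <= q)%E -> (q < +oo)%E -> 0 <= U -> 0 < eps ->
  exists2 C : R, 0 < C & forall d1 d2 (T1 : measurableType d1)
    (T2 : measurableType d2) (P1 : probability T1 R) (P2 : probability T2 R)
    (u : T1 * T2 -> V) (v : T2 * T1 -> V) (r : R),
  ess_bounded ip P1 P2 u U -> ess_bounded ip P2 P1 v U ->
  (cut_norm ip P1 P2 u + cut_norm ip P2 P1 v)%E = r%:E ->
  (pq_norm ip P1 P2 p q u + pq_norm ip P2 P1 p q v <= (eps + C * r)%:E)%E.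
Proof.
move=> p1 q1 qy U0 eps0; have e20 : 0 < eps / 2 by rewrite divr_gt0.
have [C C0 CP] := pq_le_cut ipP ipR p1 q1 qy U0 e20.
exists C => // d1 d2 T1 T2 P1 P2 u v r uU vU.
move=> /(adde_fin (cut_norm_ge0 ipP P1 P2 u) (cut_norm_ge0 ipP P2 P1 v)).
move=> [a [b [a0 b0 ua vb ->]]].
have := leeD (CP _ _ _ _ _ _ _ uU) (CP _ _ _ _ _ _ _ vU).
rewrite ua vb => /le_trans; apply.
rewrite -!EFinM -!EFinD lee_fin; lra.
Qed.

(** * Estimates for a fixed coupling *)

Section coupled_pair.
Context (R : realType) d1 d2 (T1 : measurableType d1) (T2 : measurableType d2).
Context (P1 : probability T1 R) (P2 : probability T2 R).
Variables (gam : probability (T1 * T2)%type R).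
Variables (kr : R.-pker T1 ~> T2) (kl : R.-pker T2 ~> T1).
Hypotheses (cpl : coupling P1 P2 gam) (dis : disintegration P1 P2 gam kr kl).
Variables (w1 : T1 * T1 -> R) (X1 : T1 -> torus R).
Variables (w2 : T2 * T2 -> R) (X2 : T2 -> torus R) (wmax : R).
Hypotheses (mw1 : measurable_fun setT w1) (mX1 : measurable_fun setT X1).
Hypotheses (mw2 : measurable_fun setT w2) (mX2 : measurable_fun setT X2).
Hypothesis wmax0 : 0 <= wmax.
Hypothesis w1_le : {ae (P1 \x P1)%E, forall y, `|w1 y| <= wmax}.
Hypothesis w2_le : {ae (P2 \x P2)%E, forall y, `|w2 y| <= wmax}.
Local Notation ip2 := (@hm1x2_ip R).
Local Notation ip1 := (@scalar_ip R).
Local Notation U := (gap_bound wmax).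

Lemma left_marginal A : measurable A -> (P1 A = \int[P2]_t kl t A)%E.
Proof.
move=> mA; rewrite -cpl.1//; have mAT := measurableX mA (@measurableT _ T2).
rewrite (dis mAT).2; apply: eq_integral => t _; congr (kl t _).
by rewrite ysectionE; apply/seteqP; split=> x //= [].
Qed.

Lemma right_marginal A : measurable A -> (P2 A = \int[P1]_t kr t A)%E.
Proof.
move=> mA; rewrite -cpl.2//; have mTA := measurableX (@measurableT _ T1) mA.
rewrite (dis mTA).1; apply: eq_integral => t _; congr (kr t _).
by rewrite xsectionE; apply/seteqP; split=> x //= [].
Qed.

Let v12 := vector_gap kl kr w1 X1 w2 X2.
Let v21 := vector_gap kr kl w2 X2 w1 X1.
Let s12 := scalar_gap kl kr w1 w2.
Let s21 := scalar_gap kr kl w2 w1.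

Let v12_bounded : ess_bounded ip2 P1 P2 v12 U.
Proof. by apply: vector_gap_ess_bounded => //; [exact: left_marginal|exact: right_marginal]. Qed.

Let v21_bounded : ess_bounded ip2 P2 P1 v21 U.
Proof. by apply: vector_gap_ess_bounded => //; [exact: right_marginal|exact: left_marginal]. Qed.

Let s12_bounded : ess_bounded ip1 P1 P2 s12 U.
Proof.
exact: (scalar_gap_ess_bounded left_marginal right_marginal mw1 mX1 mw2 mX2).
Qed.

Let s21_bounded : ess_bounded ip1 P2 P1 s21 U.
Proof.
exact: (scalar_gap_ess_bounded right_marginal left_marginal mw2 mX2 mw1 mX1).
Qed.

Let U0 : 0 <= U := gap_bound_ge0 wmax0.

(** The transposed half is the opposite of the gap with the two sides exchanged, so the estimates
    for one half apply to both. *)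
Lemma vector_coupling_gapE N12 N21 :
  coupling_gap ip2 N12 N21 kr kl (w_kernel w1 X1) (w_kernel w2 X2) =
  (N12 v12 + N21 (fun z => (- v21 z)%R))%E.
Proof.
rewrite /coupling_gap; congr (_ + N21 _)%E; apply/funext => z.
by rewrite /v21 /vector_gap opprB.
Qed.

Lemma scalar_coupling_gapE N12 N21 :
  coupling_gap ip1 N12 N21 kr kl w1 w2 =
  (N12 s12 + N21 (fun z => (- s21 z)%R))%E.
Proof.
rewrite /coupling_gap; congr (_ + N21 _)%E; apply/funext => z.
by rewrite /s21 /scalar_gap opprB.
Qed.

Let ip2P := hm1x2_inner_product R.
Let ip2R := @hm1x2_riesz R.
Let ip1P := scalar_inner_product R.
Let ip1R := @scalar_riesz R.

Let cut_opp (V : lmodType R) (ip : V -> V -> R) (u : T2 * T1 -> V) :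
  inner_product ip -> riesz ip -> ess_bounded ip P2 P1 u U ->
  cut_norm ip P2 P1 (fun z => - u z) = cut_norm ip P2 P1 u.
Proof.
move=> ipP ipR uU; apply/eqP; rewrite eq_le (cut_normN ipP ipR U0 uU) /=.
have := cut_normN ipP ipR U0 (ess_boundedN ipP uU).
by rewrite (_ : (fun z => - - u z) = u)//; apply/funext => z; rewrite opprK.
Qed.

Let dist_fun (z : T1 * T2) : R := torus_dist (X1 z.1) (X2 z.2).

Let measurable_dist_fun : measurable_fun setT dist_fun.
Proof.
apply: measurable_torus_dist; first by apply: (measurableT_comp mX1); exact: measurable_fst.
by apply: (measurableT_comp mX2); exact: measurable_snd.
Qed.

Lemma integral_dist_left :
  (\int[gam]_z (torus_dist (X1 z.1) (X2 z.2))%:E = (mean_dist P2 kl X1 X2)%:E)%E.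
Proof.
apply: (@mean_dist_disintegrated _ _ _ _ _ _ _ _ _ mX1 mX2 _ _ _
  (fun y : T2 * T1 => (y.2, y.1)) dist_fun) => //.
- exact: measurable_swap.
- by move=> z; exact: torus_dist_ge0.
- move=> C mC; apply: (etrans (dis mC).2); apply: eq_integral => t _; congr (kl t _).
  by rewrite ysectionE.
Qed.

(** The gap with exchanged sides sees the distance through [kr]; both disintegrations give the same
    mean. *)
Lemma integral_dist_right :
  (\int[gam]_z (torus_dist (X1 z.1) (X2 z.2))%:E = (mean_dist P1 kr X2 X1)%:E)%E.
Proof.
apply: (@mean_dist_disintegrated _ _ _ _ _ _ _ _ _ mX2 mX1 _ _ _
  (fun y : T1 * T2 => y) dist_fun) => //.
- by move=> z; exact: torus_dist_ge0.
- by move=> t s; rewrite /dist_fun/= torus_distC.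
- move=> C mC; apply: (etrans (dis mC).1); apply: eq_integral => t _; congr (kr t _).
  by rewrite xsectionE.
Qed.

Variables (p q : \bar R).
Hypotheses (p1 : (1 < p)%E) (q1 : (1 <= q)%E).

(** The first half of the vector gap alone controls the distance, which costs [C * mode_constant];
    each scalar half is at most the vector half, which costs 1. *)
Lemma bicoupling_le_vector (eps C r : R) : 0 <= C ->
  (forall x y : torus R, torus_dist x y <= eps + C *
   (1 - (complex.Re (torus_char 1 x) * complex.Re (torus_char 1 y) +
         complex.Im (torus_char 1 x) * complex.Im (torus_char 1 y)))) ->
  coupling_gap ip2 (pq_norm ip2 P1 P2 p q) (pq_norm ip2 P2 P1 p q) kr kl
    (w_kernel w1 X1) (w_kernel w2 X2) = r%:E ->
  (\int[gam]_z (torus_dist (X1 z.1) (X2 z.2))%:E +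
    coupling_gap ip1 (cut_norm ip1 P1 P2) (cut_norm ip1 P2 P1) kr kl w1 w2 <=
    (eps + (C * mode_constant R + 1) * r)%:E)%E.
Proof.
move=> C0 CP; rewrite vector_coupling_gapE scalar_coupling_gapE.
have p1' := ltW p1.
move=> /(adde_fin (pq_norm_ge0 _ _ _ _ p1' q1) (pq_norm_ge0 _ _ _ _ p1' q1)).
move=> /(_ ip2P ip2P)[a [b [a0 b0 va vb ->]]].
have v12a : (cut_norm ip2 P1 P2 v12 <= a%:E)%E.
  by rewrite -va; exact: (cut_le_pq ip2P ip2R U0 v12_bounded p1' q1).
have v21b : (cut_norm ip2 P2 P1 v21 <= b%:E)%E.
  rewrite -vb -(cut_opp ip2P ip2R v21_bounded).
  exact: (cut_le_pq ip2P ip2R U0 (ess_boundedN ip2P v21_bounded) p1' q1).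
have s12a : (cut_norm ip1 P1 P2 s12 <= a%:E)%E.
  apply: le_trans v12a.
  exact: (cut_scalar_le left_marginal right_marginal mw1 mX1 mw2 mX2 wmax0).
have s21b : (cut_norm ip1 P2 P1 s21 <= b%:E)%E.
  apply: le_trans v21b.
  exact: (cut_scalar_le right_marginal left_marginal mw2 mX2 mw1 mX1 wmax0).
have dle := mean_dist_le left_marginal right_marginal mw1 mX1 mw2 mX2 wmax0
  w1_le w2_le C0 CP v12a.
rewrite integral_dist_left (cut_opp ip1P ip1R s21_bounded).
apply: (@le_trans _ _ ((eps + C * (mode_constant R * a))%:E + (a%:E + b%:E))%E).
  by rewrite leeD ?leeD ?lee_fin.
rewrite -!EFinD lee_fin.
have := mulr_ge0 (mulr_ge0 C0 (ltW (mode_constant_gt0 R))) b0; lra.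
Qed.

(** Each half of the vector gap pays once for the distance, hence the factors 2; each scalar half
    enters only its own vector half. *)
Lemma vector_le_bicoupling (eta C r : R) : 0 <= eta -> 0 <= C ->
  (forall x y : torus R, ip_norm (@hm1_ip R) (delta x - delta y) <=
    eta + C * torus_dist x y) ->
  (\int[gam]_z (torus_dist (X1 z.1) (X2 z.2))%:E +
    coupling_gap ip1 (pq_norm ip1 P1 P2 p q) (pq_norm ip1 P2 P1 p q)
      kr kl w1 w2)%E = r%:E ->
  (coupling_gap ip2 (cut_norm ip2 P1 P2) (cut_norm ip2 P2 P1) kr kl
    (w_kernel w1 X1) (w_kernel w2 X2) <=
    (2 * (1 + wmax) * eta +
     (2 * (1 + wmax) * C + 4 * (delta_norm R + 1)) * r)%:E)%E.
Proof.
move=> eta0 C0 etaC; rewrite vector_coupling_gapE scalar_coupling_gapE.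
have p1' := ltW p1; have D0 := delta_norm_ge0 R.
have i0 : (0 <= \int[gam]_z (torus_dist (X1 z.1) (X2 z.2))%:E)%E.
  by apply: integral_ge0 => z _; rewrite lee_fin torus_dist_ge0.
have s12_0 := pq_norm_ge0 ip1P P1 P2 s12 p1' q1.
have s21_0 := pq_norm_ge0 ip1P P2 P1 (fun z => - s21 z) p1' q1.
move=> /(adde_fin i0 (adde_ge0 s12_0 s21_0))[t [s [t0 s0 it /[swap] ->]]].
move=> /(adde_fin s12_0 s21_0)[a [b [a0 b0 sa sb ->]]].
have s12a : (cut_norm ip1 P1 P2 s12 <= a%:E)%E.
  by rewrite -sa; exact: (cut_le_pq ip1P ip1R U0 s12_bounded p1' q1).
have s21b : (cut_norm ip1 P2 P1 s21 <= b%:E)%E.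
  rewrite -sb -(cut_opp ip1P ip1R s21_bounded).
  exact: (cut_le_pq ip1P ip1R U0 (ess_boundedN ip1P s21_bounded) p1' q1).
have h12 := cut_vector_le left_marginal right_marginal mw1 mX1 mw2 mX2 wmax0
  w1_le w2_le eta0 C0 etaC.
have h21 := cut_vector_le right_marginal left_marginal mw2 mX2 mw1 mX1 wmax0
  w2_le w1_le eta0 C0 etaC.
have E12 : mean_dist P2 kl X1 X2 = t.
  by apply/EFin_inj; rewrite -integral_dist_left.
have E21 : mean_dist P1 kr X2 X1 = t.
  by apply/EFin_inj; rewrite -integral_dist_right.
rewrite E12 in h12; rewrite E21 in h21.
rewrite (cut_opp ip2P ip2R v21_bounded).
have K0 : 0 <= 4 * (delta_norm R + 1) by rewrite mulr_ge0// addr_ge0.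
apply: (@le_trans _ _ (((1 + wmax) * (eta + C * t))%:E +
    (4 * (delta_norm R + 1))%:E * a%:E + (((1 + wmax) * (eta + C * t))%:E +
    (4 * (delta_norm R + 1))%:E * b%:E))%E).
  apply: leeD.
    by apply: (le_trans h12); rewrite leeD2l// lee_wpmul2l// lee_fin.
  by apply: (le_trans h21); rewrite leeD2l// lee_wpmul2l// lee_fin.
rewrite -!EFinM -!EFinD lee_fin.
have c0 : 0 <= 2 * (1 + wmax) * C by rewrite mulr_ge0// mulr_ge0// addr_ge0.
have := mulr_ge0 c0 a0; have := mulr_ge0 c0 b0; have := mulr_ge0 K0 t0.
move: (4 * _) => K; lra.
Qed.

Lemma vector_pq_le_cut (eps C r : R) :
  (forall (u : T1 * T2 -> hm1 R * hm1 R) v r', ess_bounded ip2 P1 P2 u U ->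
    ess_bounded ip2 P2 P1 v U ->
    (cut_norm ip2 P1 P2 u + cut_norm ip2 P2 P1 v)%E = r'%:E ->
    (pq_norm ip2 P1 P2 p q u + pq_norm ip2 P2 P1 p q v <= (eps + C * r')%:E)%E) ->
  coupling_gap ip2 (cut_norm ip2 P1 P2) (cut_norm ip2 P2 P1) kr kl
    (w_kernel w1 X1) (w_kernel w2 X2) = r%:E ->
  (coupling_gap ip2 (pq_norm ip2 P1 P2 p q) (pq_norm ip2 P2 P1 p q) kr kl
    (w_kernel w1 X1) (w_kernel w2 X2) <= (eps + C * r)%:E)%E.
Proof.
move=> h; rewrite !vector_coupling_gapE; apply: h => //.
exact: ess_boundedN.
Qed.

(** The distance term is common to both sides and accounts for the added 1. *)
Lemma bicoupling_pq_le_cut (eps C r : R) : 0 <= C ->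
  (forall (u : T1 * T2 -> R^o) v r', ess_bounded ip1 P1 P2 u U ->
    ess_bounded ip1 P2 P1 v U ->
    (cut_norm ip1 P1 P2 u + cut_norm ip1 P2 P1 v)%E = r'%:E ->
    (pq_norm ip1 P1 P2 p q u + pq_norm ip1 P2 P1 p q v <= (eps + C * r')%:E)%E) ->
  (\int[gam]_z (torus_dist (X1 z.1) (X2 z.2))%:E +
    coupling_gap ip1 (cut_norm ip1 P1 P2) (cut_norm ip1 P2 P1)
      kr kl w1 w2)%E = r%:E ->
  (\int[gam]_z (torus_dist (X1 z.1) (X2 z.2))%:E +
    coupling_gap ip1 (pq_norm ip1 P1 P2 p q) (pq_norm ip1 P2 P1 p q)
      kr kl w1 w2 <= (eps + (C + 1) * r)%:E)%E.
Proof.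
move=> C0 h; rewrite !scalar_coupling_gapE.
have i0 : (0 <= \int[gam]_z (torus_dist (X1 z.1) (X2 z.2))%:E)%E.
  by apply: integral_ge0 => z _; rewrite lee_fin torus_dist_ge0.
have s12_0 := cut_norm_ge0 ip1P P1 P2 s12.
have s21_0 := cut_norm_ge0 ip1P P2 P1 (fun z => - s21 z).
move=> /(adde_fin i0 (adde_ge0 s12_0 s21_0))[t [s [t0 s0 it st ->]]].
have := h _ _ _ s12_bounded (ess_boundedN ip1P s21_bounded) st => hs.
rewrite it; apply: (le_trans (leeD2l _ hs)); rewrite -EFinD lee_fin.
have := mulr_ge0 C0 t0; lra.
Qed.

End coupled_pair.

(** In the cycle 1, 2, 3, 4 each change between vector and scalar kernels starts from a (p,q)-norm
    and ends at a cut norm, so it absorbs the easy comparison of the norms; truncation is needed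
    only within a fixed kind of kernel. *)
Theorem lemma2p15 (R : realType) (d : nat -> measure_display)
    (I : forall n, measurableType (d n)) (P : forall n, probability (I n) R)
    (stdP : forall n, standard_probability (P n))
    (w : forall n, {mfun (I n * I n)%type >-> R})
    (X : forall n, {mfun I n >-> torus R})
    (wmax : R)
    (w_bounded : forall n,
      ('N[(P n \x P n)%E]_+oo[EFin \o w n] <= wmax%:E)%E)
    (p q : \bar R) (p_gt1 : (1 < p)%E) (q_ge1 : (1 <= q)%E) (q_fin : (q < +oo)%E) :
  [<-> asymptotically_cauchy (fun n1 n2 =>
         gamma_cut (@hm1x2_ip R) (P n1) (P n2)
           (w_kernel (w n1) (X n1)) (w_kernel (w n2) (X n2)));
       asymptotically_cauchy (fun n1 n2 =>
         gamma_pq (@hm1x2_ip R) p q (P n1) (P n2)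
           (w_kernel (w n1) (X n1)) (w_kernel (w n2) (X n2)));
       asymptotically_cauchy (fun n1 n2 =>
         d_cut_W1 (P n1) (P n2) (w n1) (X n1) (w n2) (X n2));
       asymptotically_cauchy (fun n1 n2 =>
         d_pq_W1 (P n1) (P n2) p q (w n1) (X n1) (w n2) (X n2))].
Proof.
have wmax0 : 0 <= wmax by have [] := Lnorm_ae_le (w_bounded 0%N).
have w_le n : {ae (P n \x P n)%E, forall y, `|w n y| <= wmax}.
  by have [] := Lnorm_ae_le (w_bounded n).
have mw n : measurable_fun setT (w n) by [].
have mX n : measurable_fun setT (X n) by [].
have U0 := gap_bound_ge0 wmax0; have p_ge1 := ltW p_gt1.
have ip2P := hm1x2_inner_product R; have ip1P := scalar_inner_product R.
have dist0 n m (g : probability (I n * I m)%type R) :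
    (0 <= \int[g]_z (torus_dist (X n z.1) (X m z.2))%:E)%E.
  by apply: integral_ge0 => z _; rewrite lee_fin torus_dist_ge0.
pose C1 n m (r : \bar R) := exists gam kr kl,
  [/\ coupling (P n) (P m) gam, disintegration (P n) (P m) gam kr kl &
      r = coupling_gap (@hm1x2_ip R) (cut_norm (@hm1x2_ip R) (P n) (P m))
        (cut_norm (@hm1x2_ip R) (P m) (P n)) kr kl
        (w_kernel (w n) (X n)) (w_kernel (w m) (X m))].
pose C2 n m (r : \bar R) := exists gam kr kl,
  [/\ coupling (P n) (P m) gam, disintegration (P n) (P m) gam kr kl &
      r = coupling_gap (@hm1x2_ip R) (pq_norm (@hm1x2_ip R) (P n) (P m) p q)
        (pq_norm (@hm1x2_ip R) (P m) (P n) p q) kr kl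
        (w_kernel (w n) (X n)) (w_kernel (w m) (X m))].
pose C3 n m (r : \bar R) := exists gam kr kl,
  [/\ coupling (P n) (P m) gam, disintegration (P n) (P m) gam kr kl &
      r = (\int[gam]_z (torus_dist (X n z.1) (X m z.2))%:E +
        coupling_gap (@scalar_ip R) (cut_norm (@scalar_ip R) (P n) (P m))
        (cut_norm (@scalar_ip R) (P m) (P n)) kr kl (w n) (w m))%E].
pose C4 n m (r : \bar R) := exists gam kr kl,
  [/\ coupling (P n) (P m) gam, disintegration (P n) (P m) gam kr kl &
      r = (\int[gam]_z (torus_dist (X n z.1) (X m z.2))%:E +
        coupling_gap (@scalar_ip R) (pq_norm (@scalar_ip R) (P n) (P m) p q)
        (pq_norm (@scalar_ip R) (P m) (P n) p q) kr kl (w n) (w m))%E].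
have C1_ge0 n m r : C1 n m r -> (0 <= r)%E.
  by move=> [g [kr [kl [_ _ ->]]]]; rewrite adde_ge0 ?cut_norm_ge0.
have C2_ge0 n m r : C2 n m r -> (0 <= r)%E.
  by move=> [g [kr [kl [_ _ ->]]]]; rewrite adde_ge0 ?pq_norm_ge0.
have C3_ge0 n m r : C3 n m r -> (0 <= r)%E.
  by move=> [g [kr [kl [_ _ ->]]]]; do 2?[apply: adde_ge0; rewrite ?dist0//]; exact: cut_norm_ge0.
have C4_ge0 n m r : C4 n m r -> (0 <= r)%E.
  by move=> [g [kr [kl [_ _ ->]]]]; do 2?[apply: adde_ge0; rewrite ?dist0//]; exact: pq_norm_ge0.
tfae.
- apply: (@asymptotically_cauchy_transfer R C1 C2) => // e e0.
  have [C C0 CP] := pq_gap_le ip2P (@hm1x2_riesz R) p_gt1 q_ge1 q_fin U0 e0.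
  exists C => // n m r [g [kr [kl [cpl dis rE]]]].
  eexists; first by exists g, kr, kl; split; [exact: cpl|exact: dis|exact: erefl].
  apply: (vector_pq_le_cut cpl dis (wmax := wmax)) => //; exact: CP.
- apply: (@asymptotically_cauchy_transfer R C2 C3) => // e e0.
  have [C C0 CP] := torus_dist_le_cos e0.
  have K0 := mode_constant_gt0 R.
  exists (C * mode_constant R + 1) => [|n m r [g [kr [kl [cpl dis rE]]]]].
    by rewrite addr_gt0// mulr_gt0.
  eexists; first by exists g, kr, kl; split; [exact: cpl|exact: dis|exact: erefl].
  exact: (bicoupling_le_vector cpl dis (mw n) (mX n) (mw m) (mX m) wmax0
    (w_le n) (w_le m) p_gt1 q_ge1 (ltW C0) CP (esym rE)).
- apply: (@asymptotically_cauchy_transfer R C3 C4) => // e e0.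
  have [C C0 CP] := pq_gap_le ip1P (@scalar_riesz R) p_gt1 q_ge1 q_fin U0 e0.
  exists (C + 1) => [|n m r [g [kr [kl [cpl dis rE]]]]]; first by rewrite addr_gt0.
  eexists; first by exists g, kr, kl; split; [exact: cpl|exact: dis|exact: erefl].
  apply: (bicoupling_pq_le_cut cpl dis (wmax := wmax)) => //; first exact: ltW.
  exact: CP.
- apply: (@asymptotically_cauchy_transfer R C4 C1) => // e e0.
  have w10 : 0 < 2 * (1 + wmax) by rewrite mulr_gt0// ltr_pwDl.
  (* The additive error of [vector_le_bicoupling] is [2 (1 + wmax)] times this value, that is
     [e]. *)
  have eta0 : 0 < e / (2 * (1 + wmax)) by rewrite divr_gt0.
  have [C C0 CP] := deltaB_norm_le eta0.
  have D0 := delta_norm_ge0 R.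
  exists (2 * (1 + wmax) * C + 4 * (delta_norm R + 1)) => [|n m r [g [kr [kl [cpl dis rE]]]]].
    by apply: addr_gt0; apply: mulr_gt0 => //; rewrite ltr_wpDl.
  eexists; first by exists g, kr, kl; split; [exact: cpl|exact: dis|exact: erefl].
  have := vector_le_bicoupling cpl dis (mw n) (mX n) (mw m) (mX m) wmax0
    (w_le n) (w_le m) p_gt1 q_ge1 (ltW eta0) (ltW C0) CP (esym rE).
  by rewrite mulrCA divff ?mulr1 ?gt_eqF.
Qed.
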